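(* Let $b\in P_+$ with reduced decomposition $b=\pi_rs_{j_l}\cdots s_{j_1}$ and $\tilde\alpha^p=s_{j_1}\cdots s_{j_{p-1}}(\alpha_{j_p})$, $1\le p\le l$. For $w\in W$ and $\nu\in\nu_R$, the $\mathrm{ord}^\nu_w$ of any particular product in the expansions of $$\kappa^\delta(b^{-1}Y_b)=\kappa^\delta\bigl(G^+_{\tilde\alpha^l}\cdots G^+_{\tilde\alpha^1}\bigr)\quad\text{or}\quad \kappa^\delta(Y_b^{-1}b)=\kappa^\delta\bigl(G^-_{-\tilde\alpha^1}\cdots G^-_{-\tilde\alpha^l}\bigr)$$ is no smaller than $\mathrm{ord}_w^\nu(b)$ and $\mathrm{ord}_w^\nu(b^{-1})$ correspondingly (that is, $\mathrm{ord}_w^\nu(b)$ for the first expansion and $\mathrm{ord}_w^\nu(b^{-1})$ for the second). Therefore the operators $\hat Y_b=RE^\delta(Y_b)$ and $\hat Y_b'=RE^\delta(Y_b^{-1})$ are well defined and invertible; $Y_bY_b^{-1}=1$ results in $\hat Y_b\hat Y_b'=1$. Moreover, the $RE^\delta$-limits of all products in their $G$-expansions are well defined.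
   Context: **Root data.** $R\subset\mathbb R^n$ is an irreducible reduced root system with simple roots $\alpha_1,\dots,\alpha_n$, positive roots $R_+$, Weyl group $W$, simple reflections $s_i$; the form is normalized by $(\alpha,\alpha)=2$ for short roots (all roots are short in the simply-laced case). $\nu_\alpha=(\alpha,\alpha)/2$, $\nu_R=\{\nu_\alpha\}$, $\alpha^\vee=2\alpha/(\alpha,\alpha)$; $P$ is the weight lattice, $P_+$ the dominant weights; $\rho_\nu^\vee=\frac1{2\nu}\sum_{\alpha\in R_+,\nu_\alpha=\nu}\alpha$. $\vartheta$ is the maximal short root. Affine roots are $\tilde\alpha=[\alpha,\nu_\alpha j]\in\mathbb R^n\times\mathbb R$ ($\alpha\in R$, $j\in\mathbb Z$), $\alpha_0=[-\vartheta,1]$, $s_{\tilde\alpha}([z,\zeta])=[z,\zeta]-(z,\alpha^\vee)\tilde\alpha$, and $b\in P$ acts by $b([z,\zeta])=[z,\zeta-(z,b)]$. $\hat W=W\ltimes P=\Pi\ltimes\langle s_0,\dots,s_n\rangle$, where $\Pi=\{\pi_r\}$ is the stabilizer of $\{\alpha_0,\dots,\alpha_n\}$; $l(\pi_r\tilde w)=l(\tilde w)$. **Operators.** $q$, $t_\nu$ are independent parameters, $t_\alpha=t_{\nu_\alpha}$, $t_i=t_{\alpha_i}$, $t_0=t_\vartheta$, $q^{(\rho_k,b)}:=\prod_\nu t_\nu^{(\rho_\nu^\vee,b)}$. Difference-reflection operators are finite sums of $g\,\Gamma_a\,v$ with $g$ rational in the $X_b$ ($b\in P$), $a\in P$, $v\in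 W$; $\Gamma_bX_a=q^{(a,b)}X_a\Gamma_b$, $vX_a=X_{v(a)}v$, $v\Gamma_b=\Gamma_{v(b)}v$. An element $b\in P\subset\hat W$ is identified with $\Gamma_{-b}$, so $s_{[\alpha,\nu_\alpha j]}=\Gamma_{j\alpha}s_\alpha$; $X_{[\alpha,\nu_\alpha j]}=q^{\nu_\alpha j}X_\alpha$. $T_i=t_i^{1/2}s_i+(t_i^{1/2}-t_i^{-1/2})(X_{\alpha_i}-1)^{-1}(s_i-1)$, $0\le i\le n$, and $Y_b=\pi_rT_{j_l}\cdots T_{j_1}$ for $b\in P_+$ and a reduced decomposition $b=\pi_rs_{j_l}\cdots s_{j_1}$. For an affine root $\tilde\alpha=[\alpha,\nu_\alpha j]$: $$f_{\tilde\alpha}=\frac{t_\alpha X_{\tilde\alpha}^{-1}-1}{X_{\tilde\alpha}^{-1}-1},\quad g_{\tilde\alpha}=\frac{t_\alpha-1}{1-X_{\tilde\alpha}^{-1}},\quad G^+_{\tilde\alpha}=t_\alpha^{-1/2}(f_{\tilde\alpha}+g_{\tilde\alpha}s_{\tilde\alpha}),\quad G^-_{\tilde\alpha}=t_\alpha^{-1/2}(f_{\tilde\alpha}-s_{\tilde\alpha}g_{\tilde\alpha}).$$ The *expansion* of a product of $G^\pm$'s is the sum of the products obtained by choosing one of the two summands (including the factor $t_\alpha^{-1/2}$) in each $G^\pm_{\tilde\alpha}$; multiplying by $b$ on the left, resp. $b^{-1}$ on the right, gives the $G$-expansions of $Y_b$, resp. $Y_b^{-1}$. **The map $\kappa^\delta$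 and orders.** $W$-spinors are functions on $W$ with values in functions of $X$, $f=\sum_wf_w\zeta_w$, with $\zeta_w$ the characteristic functions; $\delta(v)f=\sum_wf_{v^{-1}w}\zeta_w$. $\kappa^\delta$ is the algebra homomorphism from difference-reflection operators to operators on spinors with $\kappa^\delta(X_b)=\sum_wq^{-(\rho_k,w^{-1}(b))}X_{w^{-1}(b)}\zeta_w$, $\kappa^\delta(\Gamma_b)=\sum_wq^{-(\rho_k,w^{-1}(b))}\Gamma_{w^{-1}(b)}\zeta_w$, $\kappa^\delta(v)=\delta(v)$. $\mathrm{ord}_w^\nu(\kappa^\delta(g\Gamma_a))$ is the order in $t_\nu$ at $t_\nu=0$ of the coefficient of $\Gamma_{w^{-1}(a)}\zeta_w$ in $\kappa^\delta(g\Gamma_a)$, and for $v\in W$, $\mathrm{ord}_w^\nu(\kappa^\delta(g\Gamma_av)):=\mathrm{ord}_w^\nu(\kappa^\delta(g\Gamma_a))$. For $b\in P$, $\mathrm{ord}_w^\nu(b)$ means $\mathrm{ord}_w^\nu(\kappa^\delta(b))$ with $b=\Gamma_{-b}$, and $\mathrm{ord}_w^\nu(b^{-1})$ means $\mathrm{ord}_w^\nu(\kappa^\delta(b^{-1}))$ with $b^{-1}=\Gamma_b$. $RE^\delta(\mathcal L)=\lim\kappa^\delta(\mathcal L)$ as all $t_\nu\to0$.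
   Formalization: The printed order bounds fail already for A_1, b=ω; they are corrected to ord_w(b^{-1}) for products in the first expansion and, for a product gΓ_a v in the second, to ord_{v^{-1}w}(b), the bounds that make all terms of Y_b and Y_b^{-1} regular at t=0. *)

(* Defs.v *)
From HB Require Import structures.
From mathcomp Require Import all_boot all_order all_algebra all_fingroup.
From mathcomp Require Import finmap reals fraction generic_quotient.
From mathcomp.multinomials Require Import -(notations) monalg.
From mathcomp.multinomials Require Import mpoly.

Set Implicit Arguments.
Unset Strict Implicit.
Unset Printing Implicit Defensive.

Import Order.TTheory GRing.Theory Num.Theory.
Local Open Scope ring_scope.
Local Open Scope quotient_scope.

Local Notation "x %:F" := (@FracField.tofrac _ x).

Section Euclidean.
Variables (R : realType) (n : nat) (B : 'M[R]_n).

(* The Euclidean form on R^n with Gram matrix B. *)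
Definition form (x y : 'rV[R]_n) : R := (x *m B *m y^T) 0 0.
Definition coroot (a : 'rV[R]_n) : 'rV[R]_n := (2 / form a a) *: a.
Definition refl (a x : 'rV[R]_n) : 'rV[R]_n := x - form x (coroot a) *: a.

End Euclidean.

(* An irreducible reduced root system in R^n with a choice of simple roots;
   the maximal short root theta is recorded with its defining property. *)
Record root_system (R : realType) (n : nat) := RootSystem {
  gram : 'M[R]_n;
  roots : seq 'rV[R]_n;
  simple : 'I_n -> seq_sub roots;
  theta : seq_sub roots;
  gram_sym : gram^T = gram;
  gram_pos : forall x, x != 0 -> 0 < form gram x x;
  roots_neq0 : 0 \notin roots;
  refl_stable : forall a b,
    a \in roots -> b \in roots -> refl gram a b \in roots;
  crystallographic : forall a b,
    a \in roots -> b \in roots -> form gram b (coroot gram a) \is a Num.int;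
  reduced : forall a (c : R),
    a \in roots -> c *: a \in roots -> c = 1 \/ c = -1;
  roots_nonempty : roots <> [::];
  irreducible : forall p : pred 'rV[R]_n,
    (forall a b, a \in roots -> b \in roots -> p a -> ~~ p b ->
       form gram a b = 0) ->
    {in roots, forall a, p a} \/ {in roots, forall a, ~~ p a};
  simple_free : row_free (\matrix_(i < n) val (simple i));
  simple_base : forall a, a \in roots -> exists c : 'I_n -> nat,
    a = \sum_i (c i)%:R *: val (simple i) \/
    a = - \sum_i (c i)%:R *: val (simple i);
  form_normalized : forall a, a \in roots -> 2 <= form gram a a;
  theta_short : form gram (val theta) (val theta) = 2;
  theta_max : forall a, a \in roots -> form gram a a = 2 ->
    exists c : 'I_n -> nat, val theta - a = \sum_i (c i)%:R *: val (simple i)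
}.

Section FormalFields.

(* Q(q^{1/m}), with 'X standing for q^{1/m}. *)
Definition scalq : fieldType := {fraction {poly rat}}.

(* Rational functions in X_{omega_1}, ..., X_{omega_n} over Q(q^{1/m}). *)
Definition ratX (n : nat) : fieldType := {fraction {mpoly scalq[n]}}.

(* The same with r further variables t_nu^{1/2}, one for each nu; they are put
   on top so that orders and limits at t_nu = 0 are read off directly. *)
Definition ratXt (n r : nat) : fieldType := {fraction {mpoly (ratX n)[r]}}.

(* The extension to k(x_1,..,x_N) of phi : k -> K with x_i |-> h i; it is
   only meaningful when no nonzero polynomial is sent to 0. *)
Definition fsubst (k K : fieldType) (N : nat) (phi : k -> K) (h : 'I_N -> K)
    (x : {fraction {mpoly k[N]}}) : K :=
  mmap phi h \n_(repr x) / mmap phi h \d_(repr x).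

Variables (n r : nat).

Definition scalX (c : scalq) : ratX n := (c%:MP)%:F.
Definition constt (g : ratX n) : ratXt n r := (g%:MP)%:F.
Definition genX (i : 'I_n) : ratX n := ('X_i)%:F.
Definition tau (j : 'I_r) : ratXt n r := ('X_j)%:F.

Definition substX (h : 'I_n -> ratX n) : ratX n -> ratX n := fsubst scalX h.

(* Substitution of the X_{omega_i} that fixes q and the t_nu. *)
Definition substXt (h : 'I_n -> ratXt n r) : ratXt n r -> ratXt n r :=
  fsubst (fsubst (constt \o scalX) h) tau.

(* msize p bounds all exponents, hence is a neutral initial value. *)
Definition tau_order (j : 'I_r) (p : {mpoly (ratX n)[r]}) : nat :=
  \big[minn/msize p]_(m <- msupp p) m j.

(* The order in t_nu = tau_j ^+ 2 at t_nu = 0 of a nonzero x. *)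
Definition ordt (j : 'I_r) (x : ratXt n r) : rat :=
  ((tau_order j \n_(repr x))%:Q - (tau_order j \d_(repr x))%:Q) / 2.

(* y is the value of x when all t_nu are set to 0: x is regular there. *)
Definition limt (x : ratXt n r) (y : ratX n) : Prop :=
  exists p d : {mpoly (ratX n)[r]},
    [/\ d@_0%MM != 0, x = p%:F / d%:F & y = p@_0%MM / d@_0%MM].

End FormalFields.

Section RootData.
Variables (R : realType) (n : nat) (S : root_system R n).

Local Notation rootT := (seq_sub (roots S)).
Local Notation "''(' x , y ')'" := (form (gram S) x y) (format "''(' x ,  y ')'").

Definition cor (a : rootT) : 'rV[R]_n := coroot (gram S) (val a).
Definition nu (a : rootT) : R := '(val a, val a) / 2.

(* nu_R, whose elements index the parameters t_nu. *)
Definition nuR : seq R := undup [seq nu a | a : rootT].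
Definition nu_val (j : 'I_(size nuR)) : R := nuR`_j.

Definition simple_mx : 'M[R]_n := \matrix_(i < n) val (simple S i).
Definition simple_coords (x : 'rV[R]_n) : 'rV[R]_n := x *m invmx simple_mx.
Definition positive (a : rootT) : bool :=
  [forall i, 0 <= simple_coords (val a) 0 i].

Definition rho_check (j : 'I_(size nuR)) : 'rV[R]_n :=
  (2 * nu_val j)^-1 *: \sum_(a : rootT | positive a && (nu a == nu_val j)) val a.

Lemma refl_root_subproof (a b : rootT) : refl (gram S) (val a) (val b) \in roots S.
Proof. by apply: refl_stable; apply: valP. Qed.

Definition refl_root (a b : rootT) : rootT := SeqSub (refl_root_subproof a b).

Lemma refl_rootK (a : rootT) : involutive (refl_root a).
Proof.
move=> b; apply: val_inj; rewrite /= /refl.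
have a0 : form (gram S) (val a) (val a) != 0.
  apply/lt0r_neq0/gram_pos/negP => /eqP a0.
  by move: (roots_neq0 S); rewrite -a0 (valP a).
have linl x y c : form (gram S) (x - c *: y) (coroot (gram S) (val a)) =
    form (gram S) x (coroot (gram S) (val a)) -
    c * form (gram S) y (coroot (gram S) (val a)).
  by rewrite /form !mulmxBl -!scalemxAl !mxE.
rewrite linl; have -> : form (gram S) (val a) (coroot (gram S) (val a)) = 2.
  by rewrite {1}/form /coroot linearZ /= -scalemxAr mxE divfK.
rewrite mulr_natr mulr2n opprD addrA subrr sub0r scaleNr opprK.
by rewrite subrK.
Qed.

Definition refl_perm (a : rootT) : {perm rootT} :=
  perm (can_inj (refl_rootK a)).

Definition opp_root (a : rootT) : rootT := refl_root a a.

(* The Weyl group, as a group of permutations of the roots. *)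
Definition weyl : {group {perm rootT}} := <<[set refl_perm a | a : rootT]>>%G.
Definition W : finGroupType := subg_of weyl.

(* Permutations are multiplied in diagrammatic order, so the product v w of
   linear maps (first w, then v) is (w * v)%g. *)
Definition wcomp (v w : W) : W := (w * v)%g.
Definition sr (a : rootT) : W := subg weyl (refl_perm a).
Definition wroot (w : W) (a : rootT) : rootT := sgval w a.

(* The linear action of w on R^n, by alpha_i |-> w(alpha_i). *)
Definition wvec (w : W) (x : 'rV[R]_n) : 'rV[R]_n :=
  \sum_i simple_coords x 0 i *: val (wroot w (simple S i)).

(* P is identified with Z^n by coordinates in the fundamental weights. *)
Definition P := 'rV[int]_n.
Definition fund_mx : 'M[R]_n :=
  invmx (gram S *m (\matrix_(i < n) cor (simple S i))^T).
Definition wt (b : P) : 'rV[R]_n := map_mx intr b *m fund_mx.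
Definition omega (i : 'I_n) : P := delta_mx 0 i.
Definition dominant (b : P) : Prop := forall i, 0 <= b 0 i.

(* The weight equal to x, for x in P: the floors are of integers. *)
Definition to_weight (x : 'rV[R]_n) : P :=
  \row_i Num.floor '(x, cor (simple S i)).
Definition wact (w : W) (b : P) : P := to_weight (wvec w (wt b)).

(* (a, j) encodes the affine root [a, nu_a j]. *)
Definition aroot := (rootT * int)%type.
Definition aopp (ta : aroot) : aroot := (opp_root ta.1, - ta.2).
Definition asimple (i : 'I_n.+1) : aroot :=
  if unlift ord0 i is Some k then (simple S k, 0) else (opp_root (theta S), 1).

(* The extended affine Weyl group: (a, v) stands for Gamma_a v = (-a) v. *)
Definition What := (P * W)%type.
Definition hone : What := (0, 1%g).
Definition hmul (x y : What) : What := (x.1 + wact x.2 y.1, wcomp x.2 y.2).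
Definition hprod (s : seq What) : What := foldr hmul hone s.
Definition htrans (b : P) : What := (- b, 1%g).
Definition srefl (ta : aroot) : What := (ta.2 *: to_weight (val ta.1), sr ta.1).

(* Gamma_a v sends [z, zeta] to [v z, zeta + (v z, a)]. *)
Definition hact (x : What) (ta : aroot) : aroot :=
  let a := wroot x.2 ta.1 in (a, ta.2 + Num.floor '(wt x.1, cor a)).

Definition in_Pi (x : What) : Prop :=
  forall i, exists i', hact x (asimple i) = asimple i'.

(* The word [:: j_1; ...; j_l] and pi give pi s_{j_l} ... s_{j_1}. *)
Definition decomposes (x pi : What) (word : seq 'I_n.+1) : Prop :=
  in_Pi pi /\ x = hmul pi (hprod [seq srefl (asimple i) | i <- rev word]).
Definition reduced_decomposition x pi word : Prop :=
  decomposes x pi word /\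
  forall pi' word', decomposes x pi' word' -> (size word <= size word')%N.

(* alpha~^p = s_{j_1} ... s_{j_{p-1}}(alpha_{j_p}), for p = 1, ..., l. *)
Definition alpha_seq (word : seq 'I_n.+1) : seq aroot :=
  [seq hact (hprod [seq srefl (asimple i) | i <- take p word])
            (asimple (nth ord0 word p)) | p <- iota 0 (size word)].

(* [P : Q] up to sign, so that qden * (a, b) is an integer for a, b in P. *)
Definition qden : int :=
  Num.floor (\det (\matrix_(i, j) '(val (simple S i), cor (simple S j)))).
Definition qpow (x : R) : scalq := ('X)%:F ^ Num.floor (qden%:~R * x).

Local Notation r := (size nuR).
Local Notation E0 := (ratX n).
Local Notation E := (ratXt n r).

Definition qX (x : R) : E0 := scalX n (qpow x).
Definition qXt (x : R) : E := constt r (qX x).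
Definition monX (b : P) : E0 := \prod_i genX i ^ b 0 i.
Definition monXt (b : P) : E := constt r (monX b).

Definition t_half (a : rootT) : E := \prod_(j < r | nu_val j == nu a) tau n j.
Definition t_par (a : rootT) : E := t_half a ^+ 2.

(* q^{(rho_k, b)}; the exponents of the t_nu^{1/2} are integers. *)
Definition qrho (b : P) : E :=
  \prod_(j < r) tau n j ^ Num.floor (2 * '(rho_check j, wt b)).

Definition Xaff (ta : aroot) : E :=
  qXt (nu ta.1 * ta.2%:~R) * monXt (to_weight (val ta.1)).

Definition GammaX (a : P) : E0 -> E0 :=
  substX (fun i => qX '(wt (omega i), wt a) * genX i).

(* The automorphism g |-> x g x^-1 of the functions of X. *)
Definition conjXt (x : What) : E -> E :=
  substXt (fun i => let b := wact x.2 (omega i) in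
                    qXt '(wt b, wt x.1) * monXt b).

(* (g, (a, v)) is the operator g Gamma_a v. Difference-reflection operators are
   formal sums of such terms, in normal form. *)
Definition term := (E * What)%type.
Definition term_one : term := (1, hone).
Definition term_mul (x y : term) : term :=
  (x.1 * conjXt x.2 y.1, hmul x.2 y.2).
Definition term_prod (s : seq term) : term := foldr term_mul term_one s.

Definition refl_op := malg What E.
Definition op (x : term) : refl_op := mkmalgU x.2 x.1.
Definition op_one : refl_op := op term_one.
Definition op_mul (A C : refl_op) : refl_op :=
  \sum_(x <- monalg.msupp A) \sum_(y <- monalg.msupp C)
     op (term_mul (monalg.mcoeff x A, x) (monalg.mcoeff y C, y)).
Definition op_prod (s : seq refl_op) : refl_op := foldr op_mul op_one s.

Definition of_What (x : What) : term := (1, x).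
Definition of_fun (g : E) : term := (g, hone).

Definition T (i : 'I_n.+1) : refl_op :=
  let ta := asimple i in let s := op (of_What (srefl ta)) in
  op_mul (op (of_fun (t_half ta.1))) s +
  op_mul (op (of_fun ((t_half ta.1 - (t_half ta.1)^-1) * (Xaff ta - 1)^-1)))
         (s - op_one).

Definition Y (pi : What) (word : seq 'I_n.+1) : refl_op :=
  op_prod (op (of_What pi) :: [seq T i | i <- rev word]).

Definition faff (ta : aroot) : E :=
  (t_par ta.1 * (Xaff ta)^-1 - 1) / ((Xaff ta)^-1 - 1).
Definition gaff (ta : aroot) : E := (t_par ta.1 - 1) / (1 - (Xaff ta)^-1).

(* The two summands of G^+ and G^-; [true] selects the one with s. *)
Definition Gp_summand (c : bool) (ta : aroot) : term :=
  if c then ((t_half ta.1)^-1 * gaff ta, srefl ta)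
  else of_fun ((t_half ta.1)^-1 * faff ta).
Definition Gm_summand (c : bool) (ta : aroot) : term :=
  if c then term_mul (- (t_half ta.1)^-1, srefl ta) (of_fun (gaff ta))
  else of_fun ((t_half ta.1)^-1 * faff ta).

Definition Gp (ta : aroot) : refl_op :=
  op (Gp_summand false ta) + op (Gp_summand true ta).
Definition Gm (ta : aroot) : refl_op :=
  op (Gm_summand false ta) + op (Gm_summand true ta).

(* The product in the expansion of G^+_{alpha~^l} ... G^+_{alpha~^1}, resp.
   G^-_{-alpha~^1} ... G^-_{-alpha~^l}, given by the choices c_1, ..., c_l. *)
Definition Gp_product (word : seq 'I_n.+1) (c : seq bool) : term :=
  term_prod (rev [seq Gp_summand x.1 x.2 | x <- zip c (alpha_seq word)]).
Definition Gm_product (word : seq 'I_n.+1) (c : seq bool) : term :=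
  term_prod [seq Gm_summand x.1 (aopp x.2) | x <- zip c (alpha_seq word)].

Definition spinor (K : Type) := {ffun W -> K}.

(* A stands for the sum of (A w)_{(c,v)} Gamma_c zeta_w delta(v) over w, c, v. *)
Definition spinor_op (K : fieldType) := {ffun W -> malg What K}.

(* kappa^delta(g)_w: X_b |-> q^{-(rho_k,w^-1(b))} X_{w^-1(b)}. *)
Definition kappa_fun (w : W) : E -> E :=
  substXt (fun i => let b := wact w^-1%g (omega i) in (qrho b)^-1 * monXt b).

Definition kappa (A : refl_op) : spinor_op E :=
  [ffun w => \sum_(x <- monalg.msupp A)
     let a := wact w^-1%g x.1 in
     mkmalgU (a, x.2) (kappa_fun w (monalg.mcoeff x A) * (qrho a)^-1)].

(* ord_w^nu of kappa^delta(g Gamma_a v); v plays no role. *)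
Definition ordw (w : W) (j : 'I_r) (x : term) : rat :=
  let a := x.2.1 in
  ordt j (monalg.mcoeff (wact w^-1%g a, 1%g) (kappa (op (x.1, (a, 1%g))) w)).

(* L is the limit of kappa^delta(A) as all t_nu -> 0. *)
Definition RE (A : refl_op) (L : spinor_op E0) : Prop :=
  forall w x, limt (monalg.mcoeff x (kappa A w)) (monalg.mcoeff x (L w)).

Definition spinor_act (L : spinor_op E0) (f : spinor E0) : spinor E0 :=
  [ffun w => \sum_(x <- monalg.msupp (L w))
     monalg.mcoeff x (L w) * GammaX x.1 (f (wcomp x.2^-1%g w))].

End RootData.

(* Main.v *)
From HB Require Import structures.
From mathcomp Require Import all_boot all_order all_algebra all_fingroup.
From mathcomp Require Import finmap reals fraction generic_quotient.
From mathcomp.multinomials Require Import -(notations) monalg.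
From mathcomp.multinomials Require Import mpoly.
From mathcomp Require Import ring lra zify.
Require Import Defs.

Set Implicit Arguments.
Unset Strict Implicit.
Unset Printing Implicit Defensive.

Import Order.TTheory GRing.Theory Num.Theory.
Local Open Scope ring_scope.

(** Moving the reflections [s_i] of [T_i = s_i G^+_{alpha_i}] to the left turns
    [Y_b] into [b] times the product of the intertwiners [G^+] of the affine
    roots [alpha~^p], and [G^-_{-alpha} G^+_alpha = 1] gives the inverse
    ([Y_fact], [Gm_Gp], [Gp_Gm]). The point is the bound on the orders.

    For [x] in the extended affine Weyl group let [crossN x a] be the signed
    number of hyperplanes orthogonal to the root [a] that separate the
    fundamental alcove from its image under the inverse of [x]. Multiplying [x]
    on the left by a simple reflection crosses one wall, so it changes [crossN]
    only at one root, by one, and at the opposite root ([crossN_step]). Along a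
    reduced word of a dominant [b] every wall is crossed in the direction of a
    positive root ([reduced_positive]), and at the end [crossN] is the pairing
    with [b], because the remaining factor [pi] preserves the alcove
    ([crossN_final]). Summing [crossN x] over the roots of one length that are
    positive for a chamber [u] gives [crossS j x u]; for the complete word this
    is the pairing of [u(b)] with [2 rho_nu^vee], twice the order of [b] at
    [u^-1].

    The bound follows by induction on the word from the claim that a partial
    product has order in [t_nu^{1/2}] at least [- crossS] at [w^-1] for [G^+], and
    at least [crossS] at [w^-1 v] for [G^-], where [v] is the finite part of the
    product ([Gp_product_order], [Gm_product_order]). Choosing the summand
    without reflection in the next factor changes the order by a sign that is
    exactly the change of [crossS] ([hv_faff], [crossS_step]). Choosing the other
    one moves the chamber by the reflection in the current root [rt]. Two
    chambers that differ in this way are compared in [key_inequality]: only the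
    roots whose sign the reflection changes contribute; they come in pairs [a],
    [- s_rt(a)], and since the affine root of the next letter is a wall of the
    alcove reached so far, the sum of the two crossing numbers lies between
    consecutive multiples of the pairing of [rt] with [a] ([cross_pair]). These
    pairings add up to the height of [rt], which is the exponent that kappa
    attaches to [X_rt] and [Gamma_rt].

    Multiplied by [b], resp. by its inverse, all products in the two expansions
    thus have nonnegative orders, hence limits; so have the sums [Y_b] and
    [Y_b^-1]. Since kappa is a homomorphism ([kappa_mul]) and limits respect the
    twisted product of spinor operators ([RE_mul]), the two limits are mutually
    inverse. *)

(** * The form and the reflections *)

Section RootTheory.
Variables (R : realType) (n : nat) (S : root_system R n).
Local Notation rootT := (seq_sub (roots S)).
Local Notation "''(' x , y ')'" := (form (gram S) x y) (format "''(' x ,  y ')'").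
Implicit Types (a b c : rootT) (x y z : 'rV[R]_n) (w v : W S) (i : 'I_n).

Lemma formDl x y z : '(x + y, z) = '(x, z) + '(y, z).
Proof. by rewrite /form !mulmxDl mxE. Qed.
Lemma formZl k x y : '(k *: x, y) = k * '(x, y).
Proof. by rewrite /form -!scalemxAl mxE. Qed.
Lemma formC x y : '(x, y) = '(y, x).
Proof.
rewrite /form; set A := y *m _ *m _; have -> : A = A^T.
  by apply/matrixP => i j; rewrite !ord1 [RHS]mxE.
by rewrite /A !trmx_mul trmxK gram_sym mulmxA.
Qed.
Lemma formDr x y z : '(x, y + z) = '(x, y) + '(x, z).
Proof. by rewrite formC formDl !(formC x). Qed.
Lemma formZr k x y : '(x, k *: y) = k * '(x, y).
Proof. by rewrite formC formZl formC. Qed.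
Lemma formNl x y : '(- x, y) = - '(x, y).
Proof. by rewrite -scaleN1r formZl mulN1r. Qed.
Lemma formNr x y : '(x, - y) = - '(x, y).
Proof. by rewrite formC formNl formC. Qed.
Lemma formBl x y z : '(x - y, z) = '(x, z) - '(y, z).
Proof. by rewrite formDl formNl. Qed.
Lemma formBr x y z : '(x, y - z) = '(x, y) - '(x, z).
Proof. by rewrite formDr formNr. Qed.
Lemma form0l x : '(0, x) = 0.
Proof. by rewrite -(scale0r 0) formZl mul0r. Qed.
Lemma form0r x : '(x, 0) = 0.
Proof. by rewrite formC form0l. Qed.
Lemma form_suml (I : Type) (r : seq I) (Q : pred I) (F : I -> 'rV[R]_n) y :
  '(\sum_(i <- r | Q i) F i, y) = \sum_(i <- r | Q i) '(F i, y).
Proof.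
by apply: (big_morph (fun x => '(x, y))) => [u v|]; rewrite ?formDl ?form0l.
Qed.
Lemma form_sumr (I : Type) (r : seq I) (Q : pred I) (F : I -> 'rV[R]_n) y :
  '(y, \sum_(i <- r | Q i) F i) = \sum_(i <- r | Q i) '(y, F i).
Proof. by rewrite formC form_suml; apply: eq_bigr => i _; rewrite formC. Qed.

Lemma root_neq0 a : val a != 0.
Proof. by apply/negP => /eqP a0; move: (roots_neq0 S); rewrite -a0 (valP a). Qed.
Lemma form_gt0 a : 0 < '(val a, val a).
Proof. exact/gram_pos/root_neq0. Qed.
Lemma nu_gt0 a : 0 < nu a.
Proof. by rewrite /nu divr_gt0 ?form_gt0. Qed.
Lemma nu_neq0 a : nu a != 0.
Proof. exact/lt0r_neq0/nu_gt0. Qed.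
Lemma nu_ge1 a : 1 <= nu a.
Proof. by rewrite /nu ler_pdivlMr ?ltr0n // mul1r form_normalized ?(valP a). Qed.

Lemma corE a : cor a = (nu a)^-1 *: val a.
Proof. by rewrite /cor /coroot /nu invf_div. Qed.
Lemma valE_cor a : val a = nu a *: cor a.
Proof. by rewrite corE scalerA divff ?nu_neq0 ?scale1r. Qed.
Lemma form_cor_self a : '(val a, cor a) = 2.
Proof.
by rewrite corE formZr /nu invf_div divfK // lt0r_neq0 // form_gt0.
Qed.
Lemma form_val_cor x a : '(x, val a) = nu a * '(x, cor a).
Proof. by rewrite {1}valE_cor formZr. Qed.

Lemma reflE a x : refl (gram S) (val a) x = x - '(x, cor a) *: val a.
Proof. by []. Qed.

Lemma val_refl_root a b : val (refl_root a b) = val b - '(val b, cor a) *: val a.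
Proof. by []. Qed.
Lemma val_opp_root a : val (opp_root a) = - val a.
Proof. by rewrite /opp_root val_refl_root form_cor_self scaler_nat mulr2n opprD addrA subrr sub0r. Qed.
Lemma opp_rootK : involutive (@opp_root R n S).
Proof. by move=> a; apply: val_inj; rewrite !val_opp_root opprK. Qed.
Lemma nu_opp a : nu (opp_root a) = nu a.
Proof. by rewrite /nu val_opp_root formNl formNr opprK. Qed.
Lemma cor_opp a : cor (opp_root a) = - cor a.
Proof. by rewrite !corE val_opp_root nu_opp scalerN. Qed.

Lemma form_refl a x y :
  '(refl (gram S) (val a) x, refl (gram S) (val a) y) = '(x, y).
Proof.
rewrite !reflE formBl !formBr !formZl !formZr !(formC (val a)).
by have a0 := lt0r_neq0 (form_gt0 a); field.
Qed.
Lemma nu_refl a b : nu (refl_root a b) = nu b.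
Proof. by rewrite /nu /= form_refl. Qed.
Lemma refl_root_opp a b : refl_root (opp_root a) b = refl_root a b.
Proof.
apply: val_inj; rewrite [LHS]val_refl_root [RHS]val_refl_root.
by rewrite cor_opp val_opp_root formNr scaleNr scalerN opprK.
Qed.
Lemma refl_oppr a b : refl_root a (opp_root b) = opp_root (refl_root a b).
Proof.
apply: val_inj; rewrite [LHS]val_refl_root !val_opp_root val_refl_root.
by rewrite formNl scaleNr opprB opprK addrC.
Qed.

Lemma pair_int a b : '(val b, cor a) \is a Num.int.
Proof. by apply: crystallographic; apply: valP. Qed.

(** * Simple roots *)

Local Notation al := (simple S).
Local Notation co x i := (simple_coords S x 0 i).

Lemma simple_mx_unit : simple_mx S \in unitmx.
Proof. by rewrite -row_free_unit; exact: simple_free. Qed.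

Lemma coordsD x y i : co (x + y) i = co x i + co y i.
Proof. by rewrite /simple_coords mulmxDl mxE. Qed.
Lemma coordsZ k x i : co (k *: x) i = k * co x i.
Proof. by rewrite /simple_coords -scalemxAl mxE. Qed.
Lemma coordsN x i : co (- x) i = - co x i.
Proof. by rewrite -scaleN1r coordsZ mulN1r. Qed.
Lemma coordsB x y i : co (x - y) i = co x i - co y i.
Proof. by rewrite coordsD coordsN. Qed.

Lemma coords_eq x : x = \sum_i co x i *: val (al i).
Proof.
rewrite -{1}(mulmxKV simple_mx_unit x) mulmx_sum_row.
by apply: eq_bigr => i _; rewrite rowK.
Qed.
Lemma coords_inj x y : (forall i, co x i = co y i) -> x = y.
Proof. by move=> e; rewrite (coords_eq x) (coords_eq y); apply: eq_bigr => i _; rewrite e. Qed.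
Lemma coords_sum (c : 'I_n -> R) i : co (\sum_j c j *: val (al j)) i = c i.
Proof.
have -> : \sum_j c j *: val (al j) = (\row_j c j) *m simple_mx S.
  by rewrite mulmx_sum_row; apply: eq_bigr => j _; rewrite rowK mxE.
by rewrite /simple_coords mulmxK ?simple_mx_unit // mxE.
Qed.
Lemma coords_simple i j : co (val (al j)) i = (i == j)%:R.
Proof.
rewrite -(coords_sum (fun k => (k == j)%:R)); congr (simple_coords S _ 0 i).
rewrite (bigD1 j) //= eqxx scale1r big1 ?addr0 // => k /negbTE ->.
by rewrite scale0r.
Qed.

Lemma positiveP a : reflect (forall i, 0 <= co (val a) i) (positive a).
Proof. exact: forallP. Qed.

Lemma root_coords_nat a : exists c : 'I_n -> nat,
  (forall i, co (val a) i = (c i)%:R) \/ (forall i, co (val a) i = - (c i)%:R).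
Proof.
have [c [e|e]] := simple_base (valP a); exists c; [left|right] => i.
  by rewrite e coords_sum.
by rewrite e coordsN coords_sum.
Qed.
Lemma coords_neq0 a : exists i, co (val a) i != 0.
Proof.
apply/existsP; apply: contraTT (root_neq0 a); rewrite negb_exists => /forallP e.
apply/negPn/eqP/coords_inj => i; move: (e i); rewrite negbK => /eqP ->.
by rewrite -(scale0r 0) coordsZ mul0r.
Qed.
Lemma positive_opp a : positive (opp_root a) = ~~ positive a.
Proof.
apply/positiveP/idP => [h|].
  apply/negP => /positiveP h'; have [i] := coords_neq0 a; apply/negP; rewrite negbK.
  by rewrite eq_le h' andbT -oppr_ge0 -coordsN -val_opp_root h.
have [c [e|e]] := root_coords_nat a.
  by case/negP; apply/positiveP => i; rewrite e ler0n.
by move=> _ i; rewrite val_opp_root coordsN e opprK ler0n.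
Qed.
Lemma positive_simple i : positive (al i).
Proof. by apply/positiveP => j; rewrite coords_simple ler0n. Qed.
Lemma coords_nat a i : positive a -> exists k : nat, co (val a) i = k%:R.
Proof.
have [c [e|e]] := root_coords_nat a => /positiveP pa; first by exists (c i).
exists (0 : nat); apply/eqP; rewrite eq_le pa andbT e oppr_le0 ler0n //.
Qed.
Lemma negative_coord_le0 a i : ~~ positive a -> co (val a) i <= 0.
Proof. by rewrite -positive_opp => /positiveP/(_ i); rewrite val_opp_root coordsN oppr_ge0. Qed.
(** The coordinates of a root all have the same sign. *)
Lemma pos_of_coord a i : 0 < co (val a) i -> positive a.
Proof. by move=> h; apply/negPn/negP => /(negative_coord_le0 i); rewrite leNgt h. Qed.

Lemma positive_multiple_simple a i : positive a ->
  (forall j, j != i -> co (val a) j = 0) -> a = al i.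
Proof.
move=> pa h; have e : val a = co (val a) i *: val (al i).
  apply: coords_inj => j; rewrite coordsZ coords_simple.
  by case: eqP => [->|/eqP/h ->]; rewrite ?mulr1 ?mulr0.
have := valP a; rewrite e => /(reduced (valP (al i)))[] c1.
  by apply: val_inj; rewrite e c1 scale1r.
by move/positiveP: pa => /(_ i); rewrite c1 oppr_ge0 ler10.
Qed.

(** A simple reflection changes a single simple coordinate, so it permutes the
    positive roots other than its own. *)
Lemma simple_refl_positive a i : positive a -> a != al i -> positive (refl_root (al i) a).
Proof.
move=> pa ne; have [j ji aj] : exists2 j, j != i & co (val a) j != 0.
  apply/exists_inP; apply: contraNT ne => /exists_inPn h.
  by apply/eqP/positive_multiple_simple => // j /h; rewrite negbK => /eqP.
apply: (@pos_of_coord _ j); rewrite val_refl_root coordsB coordsZ coords_simple.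
by rewrite (negbTE ji) mulr0 subr0 lt0r aj; move/positiveP: pa; apply.
Qed.
Lemma refl_root_self a : refl_root a a = opp_root a. Proof. by []. Qed.

Lemma positive_refl_simple a i :
  positive (refl_root (al i) a) = positive a (+) (a == al i) (+) (a == opp_root (al i)).
Proof.
have [->|ne] := eqVneq a (al i).
  rewrite refl_root_self positive_opp positive_simple /=.
  case: eqP => // e; have := positive_opp (al i); by rewrite -e positive_simple.
have [->|ne'] := eqVneq a (opp_root (al i)).
  by rewrite refl_oppr refl_root_self opp_rootK positive_opp positive_simple.
rewrite !addbF; have [pa|pa] := boolP (positive a); first exact: simple_refl_positive.
apply/negbTE; rewrite -positive_opp -refl_oppr; apply: simple_refl_positive.
  by rewrite positive_opp.
by apply: contra ne' => /eqP <-; rewrite opp_rootK.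
Qed.

(** * Induction on positive roots *)

Definition hgt x : R := \sum_i co x i.

(** Otherwise the square length of the root would be a sum of terms at most 0. *)
Lemma pos_root_descend a : positive a -> exists i, 0 < '(val a, cor (al i)).
Proof.
move=> pa; apply/existsP; apply: contraLR (form_gt0 a).
rewrite negb_exists => /forallP h; rewrite -leNgt {2}(coords_eq (val a)) form_sumr.
apply: sumr_le0 => i _; rewrite formZr mulr_ge0_le0 //; first exact/positiveP.
by rewrite form_val_cor mulr_ge0_le0 ?(ltW (nu_gt0 _)) // leNgt.
Qed.

(** Reflecting a positive root in a simple root with which it pairs positively
    lowers its height and keeps it positive. *)
Lemma pos_root_ind (Q : rootT -> Prop) :
  (forall i, Q (al i)) ->
  (forall a i, positive a -> a != al i -> 0 < '(val a, cor (al i)) ->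
     Q (refl_root (al i) a) -> Q a) ->
  forall a, positive a -> Q a.
Proof.
move=> Q0 Qs a; have hN b : positive b -> exists k : nat, hgt (val b) = k%:R.
  move=> pb; rewrite /hgt; apply: (big_ind (fun s => exists k : nat, s = k%:R)).
  - by exists (0 : nat).
  - by move=> _ _ [k ->] [l ->]; exists (k + l)%N; rewrite natrD.
  - by move=> i _; apply: coords_nat.
move=> pa; have [k hk] := hN a pa; have [m] := ubnP k.
elim: m a pa k hk => // m IH a pa k hk km.
have [i ai] := pos_root_descend pa; have [->//|ne] := eqVneq a (al i).
have pr := simple_refl_positive pa ne; apply: (Qs a i) => //.
have [k' hk'] := hN _ pr; apply: (IH _ pr k' hk').
rewrite (leq_trans _ (ltnSE km)) // -(ltr_nat R) -hk' -hk.
rewrite /hgt val_refl_root.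
rewrite -subr_lt0 -sumrB (eq_bigr (fun j => - '(val a, cor (al i)) * (j == i)%:R)).
  by rewrite -mulr_sumr (bigD1 i) //= eqxx big1 ?addr0 ?mulr1 ?oppr_lt0 // => j /negbTE ->.
by move=> j _; rewrite coordsB coordsZ coords_simple; ring.
Qed.

Lemma cor_refl a b : cor (refl_root a b) = cor b - '(cor b, val a) *: cor a.
Proof.
rewrite !corE nu_refl val_refl_root corE formZl formZr scalerBr !scalerA.
by congr (_ - _ *: _); ring.
Qed.
Lemma form_cor_pair_int a b : '(cor b, val a) \is a Num.int.
Proof. by rewrite formC pair_int. Qed.

(** This makes the pairings of a weight with all coroots integral, although a
    weight is only given by its pairings with the simple ones. *)
Lemma cor_int a : exists m : 'I_n -> int, cor a = \sum_i (m i)%:~R *: cor (al i).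
Proof.
have key b : positive b -> exists m : 'I_n -> int, cor b = \sum_i (m i)%:~R *: cor (al i).
  elim/pos_root_ind => [i|{}b i pb _ _ [m e]].
    exists (fun j => (j == i)%:Z); rewrite (bigD1 i) //= eqxx scale1r big1 ?addr0 //.
    by move=> j /negbTE ->; rewrite scale0r.
  have -> : cor b = cor (refl_root (al i) b) - '(cor (refl_root (al i) b), val (al i)) *: cor (al i).
    by rewrite -cor_refl refl_rootK.
  move: (form_cor_pair_int (al i) (refl_root (al i) b)) => /intrP[k ->].
  exists (fun j => m j - k * (j == i)%:Z); rewrite e.
  rewrite [RHS](eq_bigr (fun j => (m j)%:~R *: cor (al j) - (k * (j == i)%:Z)%:~R *: cor (al j))).
    rewrite sumrB; congr (_ - _); rewrite (bigD1 i) //= eqxx mulr1 big1 ?addr0 //.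
    by move=> j /negbTE ->; rewrite mulr0 scale0r.
  by move=> j _; rewrite intrD intrN scalerDl scaleNr.
have [/key//|] := boolP (positive a); rewrite -positive_opp => /key [m e].
exists (fun i => - m i); rewrite -[a]opp_rootK cor_opp e -sumrN.
by apply: eq_bigr => i _; rewrite intrN scaleNr.
Qed.

Lemma refl_simple_coord a i j :
  co (val (refl_root (al i) a)) j = co (val a) j - '(val a, cor (al i)) * (j == i)%:R.
Proof. by rewrite val_refl_root coordsB coordsZ coords_simple. Qed.

(** * The maximal short root *)

Local Notation th := (theta S).

Lemma nu_theta : nu th = 1.
Proof. by rewrite /nu theta_short divff ?pnatr_eq0. Qed.
Lemma cor_theta : cor th = val th.
Proof. by rewrite corE nu_theta invr1 scale1r. Qed.

Lemma theta_max_coord a i : nu a = 1 -> co (val a) i <= co (val th) i.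
Proof.
move=> na; have [|c e] := @theta_max _ _ S _ (valP a).
  by move: na; rewrite /nu => /divr1_eq.
by rewrite -subr_ge0 -coordsB e coords_sum ler0n.
Qed.

(** A negative pairing with a simple root would produce a larger short root. *)
Lemma theta_dominant_simple i : 0 <= '(val th, cor (al i)).
Proof.
have := @theta_max_coord (refl_root (al i) th) i.
rewrite nu_refl nu_theta => /(_ erefl); rewrite refl_simple_coord eqxx mulr1.
by rewrite gerBl.
Qed.

Lemma dominant_pos x a : (forall i, 0 <= '(x, cor (al i))) -> positive a -> 0 <= '(x, val a).
Proof.
move=> dx /positiveP pa; rewrite (coords_eq (val a)) form_sumr sumr_ge0 // => i _.
rewrite formZr form_val_cor; apply: mulr_ge0 => //.
by apply: mulr_ge0 => //; exact/ltW/nu_gt0.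
Qed.
Lemma dominant_pos_cor x a : (forall i, 0 <= '(x, cor (al i))) -> positive a -> 0 <= '(x, cor a).
Proof. by move=> dx pa; rewrite corE formZr mulr_ge0 ?dominant_pos // invr_ge0 ltW ?nu_gt0. Qed.

(** The maximal short root is at least as high as its opposite. *)
Lemma theta_positive : positive th.
Proof.
have h i : co (val (opp_root th)) i <= co (val th) i.
  by apply: theta_max_coord; rewrite nu_opp nu_theta.
apply/positiveP => i; move: (h i); rewrite val_opp_root coordsN; lra.
Qed.

Lemma int_ge1 (x : R) : x \is a Num.int -> 0 < x -> 1 <= x.
Proof. by move=> /intrP[k ->]; rewrite ltr0z ler1z. Qed.

(** By Cauchy-Schwarz: the square length of the difference is positive and theta is
    at most as long as the other root, so an integral pairing of 2 is excluded. *)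
Lemma short_pairing a : 0 < '(val th, cor a) -> a != th -> '(val th, cor a) = 1.
Proof.
move=> k0 ne; have kZ := pair_int a th.
have k1 := int_ge1 kZ k0; apply/eqP; rewrite eq_le k1 andbT.
have d0 : 0 < '(val th - val a, val th - val a).
  apply: gram_pos; rewrite subr_eq0; apply: contra ne => /eqP e.
  by apply/eqP/val_inj.
rewrite leNgt; apply/negP => k2.
have {}k2 : 2 <= '(val th, cor a).
  by move: kZ k2 => /intrP[k ->]; rewrite ltr1z -[2]/(2%:~R) ler_int.
have na := nu_ge1 a; have e2 : '(val a, val a) = 2 * nu a by rewrite /nu mulrC divfK ?pnatr_eq0.
move: d0; rewrite formBl !formBr (formC (val a) (val th)) theta_short e2 form_val_cor.
nra.
Qed.

Lemma pairing_theta_range a : a != th -> a != opp_root th ->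
  [\/ '(val th, cor a) = -1, '(val th, cor a) = 0 | '(val th, cor a) = 1].
Proof.
move=> n1 n2; have [h|h|h] := ltgtP '(val th, cor a) 0.
- constructor 1; apply: oppr_inj; rewrite opprK -formNr -cor_opp; apply: short_pairing.
    by rewrite cor_opp formNr oppr_gt0.
  by apply: contra n2 => /eqP <-; rewrite opp_rootK.
- by constructor 3; apply: short_pairing.
- by constructor 2.
Qed.

(** The roots that are orthogonal to all short roots and the others are mutually
    orthogonal: if the reflection in a root moves a short root, the new short
    root differs from the old one by a multiple of that root. So irreducibility
    applies. *)
Lemma short_nonorth a : exists2 s : rootT, nu s = 1 & '(val s, val a) != 0.
Proof.
pose p x := [exists s : rootT, (nu s == 1) && ('(val s, x) != 0)].
have [|h|h] := @irreducible _ _ S p.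
- move=> x y xr yr /existsP[s /andP[/eqP s1 sx]] /existsPn py.
  pose xr' : rootT := SeqSub xr; have xr'E : x = val xr' by [].
  have orth (s' : rootT) : nu s' = 1 -> '(val s', y) = 0.
    by move=> e; have := py s'; rewrite e eqxx /= negbK => /eqP.
  have := orth (refl_root xr' s); rewrite nu_refl => /(_ s1).
  rewrite val_refl_root formBl orth // sub0r formZl => /eqP.
  rewrite oppr_eq0 mulf_eq0 corE formZr mulf_eq0 invr_eq0 (negbTE (nu_neq0 _)) /=.
  by case/orP => /eqP // e; case/negP: sx; apply/eqP.
- by have /existsP[s /andP[/eqP e n0]] := h _ (valP a); exists s.
- have := h _ (valP th); case/negP; apply/existsP; exists th.
  by rewrite nu_theta eqxx lt0r_neq0 // form_gt0.
Qed.

Lemma short_pair_le1 s a : nu s = 1 -> s != a -> s != opp_root a -> `|'(val s, cor a)| <= 1.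
Proof.
move=> s1 n1 n2.
have es : '(val s, val s) = 2 by move: s1; rewrite /nu => /divr1_eq.
have ea : '(val a, val a) = 2 * nu a by rewrite /nu mulrC divfK ?pnatr_eq0.
have na := nu_ge1 a.
have d0 : 0 < '(val s - val a, val s - val a).
  apply: gram_pos; rewrite subr_eq0; apply: contra n1 => /eqP e.
  by apply/eqP/val_inj.
have d1 : 0 < '(val s + val a, val s + val a).
  apply: gram_pos; rewrite addr_eq0 -val_opp_root; apply: contra n2 => /eqP e.
  by apply/eqP/val_inj.
have /intrP[k kE] := pair_int a s.
move: d0 d1; rewrite formBl !formBr formDl !formDr (formC (val a) (val s)) es ea.
rewrite form_val_cor kE => d0 d1; rewrite -intr_norm -[1]/(1%:~R) ler_int leNgt; apply/negP => k2.
have {}k2 : (2 <= k) || (k <= -2) by lia.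
case/orP: k2; rewrite -(ler_int R) => k2; [move: d0|move: d1]; nra.
Qed.

(** A short root that is not orthogonal to [a] has pairing 1 or -1 with the coroot
    of [a], so the opposite pairing, an integer, is the ratio of the square
    lengths up to sign. *)
Lemma nu_int a : nu a \is a Num.int.
Proof.
have [s s1 sa] := short_nonorth a.
have [->|n1] := eqVneq a s; first by rewrite s1.
have [->|n2] := eqVneq a (opp_root s); first by rewrite nu_opp s1.
have e : '(val a, cor s) = nu a * '(val s, cor a).
  by rewrite -form_val_cor corE s1 invr1 scale1r formC.
have le1 : `|'(val s, cor a)| <= 1.
  apply: short_pair_le1 => //; first by rewrite eq_sym.
  by apply: contra n2 => /eqP ->; rewrite opp_rootK.
have k0 : '(val s, cor a) != 0 by apply: contra sa; rewrite form_val_cor => /eqP ->; rewrite mulr0.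
move: e le1 k0 (pair_int s a); have /intrP[k ->] := pair_int a s => e.
rewrite -intr_norm -[1]/(1%:~R) ler_int intr_eq0 => le1 k0.
have [k1|k1] : k = 1 \/ k = -1 by lia.
  by rewrite e k1 mulr1.
by rewrite e k1 mulrN1 rpredN.
Qed.

(** * The maximal short root dominates all coroots *)

(** If [a] is not theta, its pairing with theta is 1; then the reflected coroot
    [cor a - th] pairs negatively with theta, so it belongs to a negative root. *)
Lemma theta_ge_cor_dominant a : positive a ->
  (forall i, 0 <= '(val a, cor (al i))) -> forall i, co (cor a) i <= co (val th) i.
Proof.
move=> pa da i.
have ta0 : 0 < '(val th, cor a).
  have gt0 (s : rootT) : nu s = 1 -> 0 < '(val a, val s) -> 0 < '(val th, cor a).
    move=> s1 h; rewrite corE formZr mulr_gt0 ?invr_gt0 ?nu_gt0 // formC.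
    apply: lt_le_trans h _; rewrite -subr_ge0 -formBr (coords_eq (val th - val s)).
    rewrite form_sumr sumr_ge0 // => j _; rewrite formZr form_val_cor.
    apply: mulr_ge0; first by rewrite coordsB subr_ge0 theta_max_coord.
    by apply: mulr_ge0 => //; exact/ltW/nu_gt0.
  have [s s1] := short_nonorth a; rewrite neq_lt => /orP[] h.
    by apply: (gt0 (opp_root s)); rewrite ?nu_opp // val_opp_root formNr oppr_gt0 formC.
  by apply: (gt0 s) => //; rewrite formC.
have [->|ne] := eqVneq a th; first by rewrite cor_theta.
have k1 := short_pairing ta0 ne.
have ce : cor (refl_root th a) = cor a - val th.
  by rewrite cor_refl formC k1 scale1r cor_theta.
have ng : ~~ positive (refl_root th a).
  apply/negP => /(dominant_pos_cor theta_dominant_simple).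
  by rewrite ce formBr k1 theta_short; lra.
have := negative_coord_le0 i ng.
rewrite valE_cor nu_refl coordsZ pmulr_rle0 ?nu_gt0 // ce coordsB; lra.
Qed.

(** Reflecting in simple roots raises a coroot until it becomes dominant; a
    highest counterexample is therefore dominant. *)
Lemma theta_ge_cor a i : co (cor a) i <= co (val th) i.
Proof.
wlog pa : a / positive a => [hw|].
  have [/hw//|na] := boolP (positive a); apply: le_trans (_ : 0 <= _).
    by rewrite corE coordsZ pmulr_rle0 ?invr_gt0 ?nu_gt0 // negative_coord_le0.
  exact/positiveP/theta_positive.
apply/negPn/negP => bad0.
pose B b := positive b && [exists j, ~~ (co (cor b) j <= co (val th) j)].
have Ba : B a by rewrite /B pa /=; apply/existsP; exists i.
case: (arg_maxP (fun b => hgt (cor b)) Ba) => b /andP[pb /existsP[j jb]] mx.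
case/negP: (jb); apply: theta_ge_cor_dominant => // k; rewrite leNgt; apply/negP => neg.
have nk : b != al k.
  by apply/eqP => e; move: neg; rewrite e form_cor_self ltrn0.
have neg' : '(cor b, val (al k)) < 0.
  by rewrite corE formZl pmulr_rlt0 ?invr_gt0 ?nu_gt0 // form_val_cor pmulr_rlt0 ?nu_gt0.
have up l : co (cor (refl_root (al k) b)) l
          = co (cor b) l - '(cor b, val (al k)) / nu (al k) * (l == k)%:R.
  rewrite cor_refl coordsB; congr (_ - _).
    by rewrite coordsZ (corE (al k)) coordsZ coords_simple mulrA.
have mlt0 : '(cor b, val (al k)) / nu (al k) < 0.
  by rewrite pmulr_llt0 ?invr_gt0 ?nu_gt0.
have [Bs|] := boolP (B (refl_root (al k) b)).
  have : hgt (cor (refl_root (al k) b)) <= hgt (cor b) := mx _ Bs.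
  rewrite leNgt => /negP; apply.
  rewrite /hgt -subr_gt0 -sumrB (eq_bigr _ (fun l _ => congr1 (fun t => t - _) (up l))).
  rewrite (bigD1 k) //= eqxx big1 ?addr0; first by rewrite mulr1; lra.
  by move=> l /negbTE ->; rewrite mulr0 subr0 subrr.
rewrite /B simple_refl_positive //= => /existsPn h; have := h j; rewrite negbK up.
move=> hh; case/negP: jb; apply: le_trans hh.
by case: (j == k); rewrite ?mulr0 ?mulr1; lra.
Qed.
End RootTheory.

Section RootTheory2.
Variables (R : realType) (n : nat) (S : root_system R n).
Local Notation rootT := (seq_sub (roots S)).
Local Notation "''(' x , y ')'" := (form (gram S) x y) (format "''(' x ,  y ')'").
Implicit Types (a b c : rootT) (x y z : 'rV[R]_n) (w v : W S) (i : 'I_n).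
Local Notation al := (simple S).
Local Notation co x i := (simple_coords S x 0 i).

(** * The Weyl group acts by linear isometries *)

Definition linear_isometry (f : 'rV[R]_n -> 'rV[R]_n) : Prop :=
  (forall k x y, f (k *: x + y) = k *: f x + f y) /\
  (forall x y, '(f x, f y) = '(x, y)).

Lemma wroot_isometry w : exists2 f, linear_isometry f &
  forall a, f (val a) = val (wroot w a).
Proof.
rewrite /wroot; have: sgval w \in weyl S by apply: subgP.
case/gen_prodgP => m [c cP ->].
apply: (big_ind (fun s : {perm rootT} => exists2 f, linear_isometry f &
  forall a, f (val a) = val (s a))).
- exists id; first by split.
  by move=> a; rewrite perm1.
- move=> s t [f [fl fi] fs] [g [gl gi] gt]; exists (g \o f).
    by split=> [k x y|x y] /=; rewrite ?fl ?gl // gi fi.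
  by move=> a; rewrite /= fs gt permM.
- move=> k _; have /imsetP[a _ ->] := cP k; exists (refl (gram S) (val a)).
    split=> [l x y|x y]; last exact: form_refl.
    rewrite !reflE formDl formZl scalerBr scalerDl opprD !scalerA.
    by rewrite addrACA.
  by move=> b; rewrite permE.
Qed.

(** The roots span, so the linear extension of a product of reflections is
    determined by the permutation of the simple roots. *)
Lemma wvec_spec w : [/\ linear_isometry (wvec w),
  forall a, wvec w (val a) = val (wroot w a) &
  forall f, linear_isometry f -> (forall a, f (val a) = val (wroot w a)) -> f =1 wvec w].
Proof.
have [f fl fr] := wroot_isometry w.
have fs (g : 'rV[R]_n -> 'rV[R]_n) : linear_isometry g ->
    (forall a, g (val a) = val (wroot w a)) -> g =1 wvec w.
  case=> gl _ gr x; rewrite {1}(coords_eq S x).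
  have g0 : g 0 = 0.
    by have := gl (-1) 0 0; rewrite scaler0 add0r scaleN1r addNr.
  have gD y z : g (y + z) = g y + g z by have := gl 1 y z; rewrite !scale1r.
  have gZ k y : g (k *: y) = k *: g y by have := gl k y 0; rewrite !addr0 g0 addr0.
  rewrite (big_morph g gD g0); apply: eq_bigr => i _.
  by rewrite gZ gr.
have E := fs f fl fr; split; last exact: fs.
- by case: fl => fl fi; split=> [k x y|x y]; rewrite -!E.
- by move=> a; rewrite -E.
Qed.

Lemma wvec_root w a : wvec w (val a) = val (wroot w a).
Proof. by case: (wvec_spec w). Qed.
Lemma form_wvec w x y : '(wvec w x, wvec w y) = '(x, y).
Proof. by case: (wvec_spec w) => -[]. Qed.
Lemma wvec_lin w k x y : wvec w (k *: x + y) = k *: wvec w x + wvec w y.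
Proof. by case: (wvec_spec w) => -[]. Qed.
Lemma wvecD w x y : wvec w (x + y) = wvec w x + wvec w y.
Proof. by have := wvec_lin w 1 x y; rewrite !scale1r. Qed.
Lemma wvec0 w : wvec w 0 = 0.
Proof. by apply: (addrI (wvec w 0)); rewrite -wvecD !addr0. Qed.
Lemma wvecZ w k x : wvec w (k *: x) = k *: wvec w x.
Proof. by have := wvec_lin w k x 0; rewrite !addr0 wvec0 addr0. Qed.
Lemma wvecN w x : wvec w (- x) = - wvec w x.
Proof. by rewrite -scaleN1r wvecZ scaleN1r. Qed.

Lemma wroot_comp v w a : wroot (wcomp v w) a = wroot v (wroot w a).
Proof. by rewrite /wroot /wcomp /= permM. Qed.
Lemma wroot1 a : wroot (1%g : W S) a = a.
Proof. by rewrite /wroot /= perm1. Qed.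
Lemma W_ext v w : (forall a, wroot v a = wroot w a) -> v = w.
Proof. by move=> e; apply/val_inj/permP => a; apply: e. Qed.
Lemma wcompA : associative (@wcomp R n S).
Proof. by move=> u v w; rewrite /wcomp mulgA. Qed.
Lemma wcomp1 w : wcomp w 1%g = w. Proof. exact: mul1g. Qed.
Lemma w1comp w : wcomp 1%g w = w. Proof. exact: mulg1. Qed.
Lemma wcompV w : wcomp w w^-1%g = 1%g. Proof. exact: mulVg. Qed.
Lemma wVcomp w : wcomp w^-1%g w = 1%g. Proof. exact: mulgV. Qed.
Lemma wcomp_inv v w : (wcomp v w)^-1%g = wcomp w^-1%g v^-1%g.
Proof. by rewrite /wcomp invMg. Qed.
Lemma wrootK w : cancel (wroot w) (wroot w^-1%g).
Proof. by move=> a; rewrite -wroot_comp wVcomp wroot1. Qed.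
Lemma wrootVK w : cancel (wroot w^-1%g) (wroot w).
Proof. by move=> a; rewrite -wroot_comp wcompV wroot1. Qed.
Lemma wroot_inj w : injective (wroot w).
Proof. exact: can_inj (wrootK w). Qed.

Lemma wvec_comp v w x : wvec (wcomp v w) x = wvec v (wvec w x).
Proof.
apply/esym; case: (wvec_spec (wcomp v w)) => _ _ h.
apply: (h (wvec v \o wvec w)) => [|a] /=.
  by split=> [k y z|y z] /=; rewrite ?wvec_lin // !form_wvec.
by rewrite !wvec_root wroot_comp.
Qed.
Lemma wvec1 x : wvec (1%g : W S) x = x.
Proof.
apply/esym; case: (wvec_spec 1%g) => _ _ h.
by apply: (h id) => [|a]; rewrite ?wroot1.
Qed.

Lemma nu_wroot w a : nu (wroot w a) = nu a.
Proof. by rewrite /nu -wvec_root form_wvec. Qed.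
Lemma wvec_cor w a : wvec w (cor a) = cor (wroot w a).
Proof. by rewrite !corE wvecZ wvec_root nu_wroot. Qed.
Lemma form_wvec_cor w x a : '(wvec w x, cor (wroot w a)) = '(x, cor a).
Proof. by rewrite -wvec_cor form_wvec. Qed.
Lemma wroot_opp w a : wroot w (opp_root a) = opp_root (wroot w a).
Proof. by apply: val_inj; rewrite -wvec_root !val_opp_root wvecN wvec_root. Qed.

Lemma wroot_sr a b : wroot (sr a) b = refl_root a b.
Proof.
by rewrite /wroot /sr subgK ?permE // mem_gen // imset_f.
Qed.
Lemma wvec_sr a x : wvec (sr a) x = refl (gram S) (val a) x.
Proof.
apply/esym; case: (wvec_spec (sr a)) => _ _ h; apply: h => [|b].
  split=> [k y z|y z]; last exact: form_refl.
  by rewrite !reflE formDl formZl scalerBr scalerDl opprD !scalerA addrACA.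
by rewrite wroot_sr.
Qed.
Lemma sr_sq a : wcomp (sr a) (sr a) = 1%g.
Proof. by apply: W_ext => b; rewrite wroot_comp !wroot_sr refl_rootK wroot1. Qed.
Lemma sr_inv a : (sr a)^-1%g = sr a.
Proof. by rewrite -[RHS]w1comp -{1}(wVcomp (sr a)) -wcompA sr_sq wcomp1. Qed.
Lemma sr_opp a : sr (opp_root a) = sr a.
Proof. by apply: W_ext => b; rewrite !wroot_sr refl_root_opp. Qed.
Lemma wroot_refl w a b : wroot w (refl_root a b) = refl_root (wroot w a) (wroot w b).
Proof.
apply: val_inj; rewrite -wvec_root !val_refl_root -!wvec_root -wvec_cor form_wvec.
by rewrite -scaleNr addrC wvec_lin scaleNr addrC.
Qed.
Lemma wcomp_sr w a : wcomp w (sr a) = wcomp (sr (wroot w a)) w.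
Proof. by apply: W_ext => b; rewrite !wroot_comp !wroot_sr wroot_refl. Qed.

(** * Weights *)

Lemma simple_cor_unit : gram S *m (\matrix_(i < n) cor (al i))^T \in unitmx.
Proof.
rewrite unitmx_mul; apply/andP; split.
  rewrite -row_free_unit -kermx_eq0; apply/eqP/row_matrixP => i; rewrite row0.
  apply/eqP; apply: contraT => /(@gram_pos _ _ S); rewrite /form.
  have -> : row i (kermx (gram S)) *m gram S = 0.
    by apply/sub_kermxP/row_sub.
  by rewrite mul0mx mxE ltxx.
rewrite unitmx_tr -row_free_unit -kermx_eq0; apply/eqP/row_matrixP => i; rewrite row0.
set u := row i _; have: u *m (\matrix_(i < n) cor (al i)) = 0.
  by apply/sub_kermxP/row_sub.
rewrite mulmx_sum_row => u0; apply/rowP => j; rewrite [RHS]mxE.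
have := congr1 (fun x => co x j) u0.
rewrite (eq_bigr (fun k => (u 0 k * (nu (al k))^-1) *: val (al k))); last first.
  by move=> k _; rewrite rowK corE scalerA.
rewrite /= coords_sum -(scale0r 0) coordsZ mul0r => /eqP.
by rewrite mulf_eq0 invr_eq0 (negbTE (nu_neq0 _)) orbF => /eqP.
Qed.

Lemma form_simple_cor x i : '(x, cor (al i)) = (x *m (gram S *m (\matrix_(i < n) cor (al i))^T)) 0 i.
Proof.
rewrite /form mulmxA !mxE; apply: eq_bigr => j _; congr (_ * _).
by rewrite !mxE.
Qed.
Lemma cor_coords_inj x y : (forall i, '(x, cor (al i)) = '(y, cor (al i))) -> x = y.
Proof.
move=> e; apply: (can_inj (mulmxK simple_cor_unit)).
by apply/rowP => i; rewrite -!form_simple_cor.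
Qed.
Lemma form_wt_simple (b : P n) i : '(wt S b, cor (al i)) = (b 0 i)%:~R.
Proof. by rewrite form_simple_cor /wt /fund_mx mulmxKV ?simple_cor_unit // mxE. Qed.
Lemma wt_inj : injective (@wt R n S).
Proof.
move=> b b' e; apply/rowP => i; apply/eqP; rewrite -(eqr_int R).
by rewrite -!form_wt_simple e.
Qed.
Lemma wtD (b c : P n) : wt S (b + c) = wt S b + wt S c.
Proof. by apply: cor_coords_inj => i; rewrite formDl !form_wt_simple mxE intrD. Qed.
Lemma wtN (b : P n) : wt S (- b) = - wt S b.
Proof. by apply: cor_coords_inj => i; rewrite formNl !form_wt_simple mxE intrN. Qed.
Lemma wt0 : wt S 0 = 0.
Proof. by apply: cor_coords_inj => i; rewrite form0l form_wt_simple mxE. Qed.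
Lemma wtZ (k : int) (b : P n) : wt S (k *: b) = k%:~R *: wt S b.
Proof. by apply: cor_coords_inj => i; rewrite formZl !form_wt_simple mxE intrM. Qed.

Definition integral_weight x := forall i, '(x, cor (al i)) \is a Num.int.
Lemma to_weightK x : integral_weight x -> wt S (to_weight S x) = x.
Proof.
move=> h; apply: cor_coords_inj => i; rewrite form_wt_simple mxE.
by move: (h i) => /floorK.
Qed.

Lemma pair_wt_int (b : P n) a : '(wt S b, cor a) \is a Num.int.
Proof.
have [m ->] := cor_int a; rewrite form_sumr; apply: rpred_sum => i _.
by rewrite formZr form_wt_simple rpredM // intr_int.
Qed.

Definition wpair (b : P n) a : int := Num.floor '(wt S b, cor a).
Lemma wpairE (b : P n) a : (wpair b a)%:~R = '(wt S b, cor a).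
Proof. exact/floorK/pair_wt_int. Qed.

Lemma wt_wact w (b : P n) : wt S (wact w b) = wvec w (wt S b).
Proof.
apply: to_weightK => i; rewrite -(wrootVK w (al i)) form_wvec_cor.
exact: pair_wt_int.
Qed.
Lemma wactD w (b c : P n) : wact w (b + c) = wact w b + wact w c.
Proof. by apply: wt_inj; rewrite wtD !wt_wact wtD wvecD. Qed.
Lemma wact0 w : wact w 0 = 0.
Proof. by apply: wt_inj; rewrite wt_wact wt0 wvec0. Qed.
Lemma wactN w (b : P n) : wact w (- b) = - wact w b.
Proof. by apply: wt_inj; rewrite wtN !wt_wact wtN wvecN. Qed.
Lemma wact_comp v w (b : P n) : wact (wcomp v w) b = wact v (wact w b).
Proof. by apply: wt_inj; rewrite !wt_wact wvec_comp. Qed.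
Lemma wact1 (b : P n) : wact (1%g : W S) b = b.
Proof. by apply: wt_inj; rewrite wt_wact wvec1. Qed.
Lemma wactK w : cancel (wact w) (wact w^-1%g).
Proof. by move=> a; rewrite -wact_comp wVcomp wact1. Qed.
Lemma wactVK w : cancel (wact w^-1%g) (wact w).
Proof. by move=> a; rewrite -wact_comp wcompV wact1. Qed.

Definition rweight a : P n := to_weight S (val a).
Lemma wt_rweight a : wt S (rweight a) = val a.
Proof. by apply: to_weightK => i; apply: pair_int. Qed.
Lemma wact_rweight w a : wact w (rweight a) = rweight (wroot w a).
Proof. by apply: wt_inj; rewrite wt_wact !wt_rweight wvec_root. Qed.
Lemma rweight_opp a : rweight (opp_root a) = - rweight a.
Proof. by apply: wt_inj; rewrite wtN !wt_rweight val_opp_root. Qed.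
Lemma rweight_neq0 a : rweight a != 0.
Proof.
by apply/negP => /eqP/(congr1 (@wt R n S)); rewrite wt0 wt_rweight => /eqP; rewrite (negbTE (root_neq0 a)).
Qed.
Lemma wact_sr a (b : P n) : wact (sr a) b = b - wpair b a *: rweight a.
Proof. by apply: wt_inj; rewrite wt_wact wvec_sr reflE wtD wtN wtZ wpairE wt_rweight. Qed.

Lemma wpair_wact w (b : P n) a : wpair (wact w b) (wroot w a) = wpair b a.
Proof. by rewrite /wpair wt_wact form_wvec_cor. Qed.
Lemma wpairD (b c : P n) a : wpair (b + c) a = wpair b a + wpair c a.
Proof. by apply/eqP; rewrite -(eqr_int R) intrD !wpairE wtD formDl. Qed.
Lemma wpairN (b : P n) a : wpair (- b) a = - wpair b a.
Proof. by apply/eqP; rewrite -(eqr_int R) intrN !wpairE wtN formNl. Qed.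
Lemma wpairZ k (b : P n) a : wpair (k *: b) a = k * wpair b a.
Proof. by apply/eqP; rewrite -(eqr_int R) intrM !wpairE wtZ formZl. Qed.
Lemma wpair_opp (b : P n) a : wpair b (opp_root a) = - wpair b a.
Proof. by apply/eqP; rewrite -(eqr_int R) intrN !wpairE cor_opp formNr. Qed.
Lemma wpair0 a : wpair 0 a = 0.
Proof. by apply/eqP; rewrite -(eqr_int R) wpairE wt0 form0l. Qed.
Lemma wpair_self a : wpair (rweight a) a = 2.
Proof. by apply/eqP; rewrite -(eqr_int R) wpairE wt_rweight form_cor_self. Qed.

(** * Integrality of the exponents of q *)

Lemma qdenE : (qden S)%:~R = \det (\matrix_(i, j) '(val (al i), cor (al j))) :> R.
Proof.
apply: floorK; rewrite /determinant rpred_sum // => s _.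
rewrite rpredM ?rpredX ?rpredN1 // rpred_prod // => i _; rewrite mxE; exact: pair_int.
Qed.

(** The Cartan matrix expresses simple roots in fundamental weights; its inverse
    is its adjugate, an integral matrix, divided by its determinant. *)
Lemma qden_form_int (b c : P n) : (qden S)%:~R * '(wt S b, wt S c) \is a Num.int.
Proof.
set C := \matrix_(i, j) '(val (al i), cor (al j)) : 'M[R]_n.
have CZ i j : C i j \is a Num.int by rewrite mxE pair_int.
have adjZ i j : (\adj C) i j \is a Num.int.
  rewrite mxE /cofactor rpredM ?rpredX ?rpredN1 // /determinant rpred_sum // => s _.
  by rewrite rpredM ?rpredX ?rpredN1 // rpred_prod // => k _; rewrite !mxE pair_int.
pose d := map_mx intr b *m \adj C : 'rV[R]_n.
have dZ j : d 0 j \is a Num.int.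
  by rewrite mxE rpred_sum // => k _; rewrite rpredM ?adjZ // mxE intr_int.
have e : (qden S)%:~R *: wt S b = \sum_i d 0 i *: val (al i).
  apply: cor_coords_inj => j; rewrite formZl form_wt_simple form_suml qdenE -/C.
  transitivity ((map_mx intr b *m (\det C)%:M) 0 j : R).
    by rewrite mul_mx_scalar !mxE.
  rewrite -mul_adj_mx mulmxA mxE; apply: eq_bigr => i _; rewrite formZl; congr (_ * _).
  by rewrite mxE.
rewrite -formZl e form_suml rpred_sum // => i _.
by rewrite formZl rpredM // formC form_val_cor rpredM ?nu_int // form_wt_simple intr_int.
Qed.
End RootTheory2.

Local Open Scope quotient_scope.
Local Notation "x %:F" := (@FracField.tofrac _ x).

(** * Substitution in rational functions *)

Section Fractions.

Lemma frac_repr (D : idomainType) (x : {fraction D}) :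
  x = (\n_(repr x))%:F / (\d_(repr x))%:F.
Proof.
have d0 := denom_ratioP (repr x); apply: (canRL (mulfK _)); first by rewrite tofrac_eq0.
rewrite -{1}[x]reprK -[LHS]/(FracField.mul _ _) !piE.
apply/eqmodP; rewrite /= FracField.equivfE /FracField.mulf.
by rewrite !numden_Ratio ?(oner_eq0, mulf_neq0) // !mulr1 mulrC.
Qed.

Variables (k K : fieldType) (N : nat).
Implicit Types (p d : {mpoly k[N]}) (x : {fraction {mpoly k[N]}}).

Lemma denom_repr_neq0 (D : idomainType) (x : {fraction D}) : \d_(repr x) != 0.
Proof. exact: denom_ratioP. Qed.

Definition pack_rmorphism (A B : nzRingType) (f : A -> B)
    (fz : zmod_morphism f) (fm : monoid_morphism f) : {rmorphism A -> B} :=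
  HB.pack f (GRing.isZmodMorphism.Build A B f fz)
            (GRing.isMonoidMorphism.Build A B f fm).

(** A substitution that sends no nonzero polynomial to 0 does not depend on the
    representative of a fraction. *)
Lemma fsubst_frac (phi : {rmorphism k -> K}) (h : 'I_N -> K) :
  (forall p, p != 0 -> mmap phi h p != 0) ->
  forall p d, d != 0 -> fsubst phi h (p%:F / d%:F) = mmap phi h p / mmap phi h d.
Proof.
move=> inj p d d0; rewrite /fsubst; set x := p%:F / d%:F.
have e0 := denom_repr_neq0 x; have := frac_repr x.
move: (\n_(repr x)) (\d_(repr x)) e0 => a b b0.
have F0 (q : {mpoly k[N]}) : q != 0 -> q%:F != 0 by rewrite tofrac_eq0.
move/eqP; rewrite eqr_div ?F0 // -!tofracM tofrac_eq => /eqP e.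
apply/eqP; rewrite eqr_div ?inj //.
by rewrite -!rmorphM /= -e mulrC.
Qed.

Lemma fsubst_rmorphism (phi : {rmorphism k -> K}) (h : 'I_N -> K) :
  (forall p, p != 0 -> mmap phi h p != 0) ->
  exists f : {rmorphism {fraction {mpoly k[N]}} -> K},
    [/\ f =1 fsubst phi h, forall c, f (c%:MP)%:F = phi c & forall i, f ('X_i)%:F = h i].
Proof.
move=> inj; have E := fsubst_frac inj.
have P1 (p : {mpoly k[N]}) : fsubst phi h p%:F = mmap phi h p.
  by have := E p 1 (oner_neq0 _); rewrite tofrac1 divr1 rmorph1 divr1.
have fz : zmod_morphism (fsubst phi h).
  move=> x y; rewrite {1}(frac_repr x) {1}(frac_repr y) /fsubst.
  move: (\n_(repr x)) (\d_(repr x)) (denom_repr_neq0 x) => a b b0.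
  move: (\n_(repr y)) (\d_(repr y)) (denom_repr_neq0 y) => c d d0.
  rewrite -mulNr -tofracN addf_div ?tofrac_eq0 // -!tofracM -tofracD -/(fsubst phi h _) E ?mulf_neq0 //.
  by rewrite !rmorphM rmorphD !rmorphM rmorphN /= -mulNr addf_div ?inj.
have fm : monoid_morphism (fsubst phi h).
  split=> [|x y]; first by rewrite -tofrac1 P1 rmorph1.
  rewrite {1}(frac_repr x) {1}(frac_repr y) /fsubst.
  move: (\n_(repr x)) (\d_(repr x)) (denom_repr_neq0 x) => a b b0.
  move: (\n_(repr y)) (\d_(repr y)) (denom_repr_neq0 y) => c d d0.
  rewrite mulf_div -!tofracM -/(fsubst phi h _) E ?mulf_neq0 //.
  by rewrite !rmorphM /= mulf_div.
exists (pack_rmorphism fz fm); split=> // [c|i].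
  by rewrite [LHS]P1 mmapC.
by rewrite [LHS]P1 mmapX mmap1U.
Qed.

Lemma frac_mpoly_ext (f g : {rmorphism {fraction {mpoly k[N]}} -> K}) :
  (forall c, f (c%:MP)%:F = g (c%:MP)%:F) -> (forall i, f ('X_i)%:F = g ('X_i)%:F) ->
  f =1 g.
Proof.
move=> fc fX x; rewrite (frac_repr x) !rmorphM !fmorphV.
suff E p : f p%:F = g p%:F by rewrite !E.
rewrite (mpolyE p) !rmorph_sum /=; apply: eq_bigr => m _.
rewrite -mul_mpolyC !rmorphM /= fc mpolyXE_id !rmorph_prod; congr (_ * _).
by apply: eq_bigr => i _; rewrite !rmorphXn /= fX.
Qed.

Lemma common_denominator (s : seq {fraction {mpoly k[N]}}) :
  exists (D : {mpoly k[N]}) (Q : {fraction {mpoly k[N]}} -> {mpoly k[N]}),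
    D != 0 /\ forall x, x \in s -> x = (Q x)%:F / D%:F.
Proof.
elim: s => [|y s [D [Q [D0 e]]]].
  by exists 1, (fun=> 0); split; rewrite ?oner_neq0.
have d0 := denom_repr_neq0 y.
exists (D * \d_(repr y)), (fun x => if x == y then \n_(repr y) * D else Q x * \d_(repr y)).
split=> [|x]; first by rewrite mulf_neq0.
rewrite inE; case: eqVneq => [-> _|_ /= /e {1}->].
  rewrite {1}(frac_repr y); apply/eqP.
  by rewrite eqr_div ?tofrac_eq0 ?mulf_neq0 // -!tofracM tofrac_eq; apply/eqP; ring.
apply/eqP.
by rewrite eqr_div ?tofrac_eq0 ?mulf_neq0 // -!tofracM tofrac_eq; apply/eqP; ring.
Qed.

End Fractions.

Lemma mpolyX_neq0 (D : nzRingType) N (m : 'X_{1..N}) : 'X_[m] != 0 :> {mpoly D[N]}.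
Proof. by rewrite -msupp_eq0 msuppX. Qed.

(** * Laurent monomials *)

Definition posexp N (a : 'rV[int]_N) : 'X_{1..N} := [multinom absz (a 0%R j) | j < N].
Definition nonneg N (a : 'rV[int]_N) := forall j, 0 <= a 0 j.
Lemma posexp_inj N (a b : 'rV[int]_N) : nonneg a -> nonneg b -> posexp a = posexp b -> a = b.
Proof.
move=> ha hb /mnmP e; apply/rowP => j; have := e j; rewrite !mnmE => ej.
by rewrite -(gez0_abs (ha j)) -(gez0_abs (hb j)) ej.
Qed.

Section LaurentMonomials.
Variables (k : fieldType) (N : nat).
Local Notation F := {fraction {mpoly k[N]}}.
Implicit Types e f : 'rV[int]_N.

Definition tvar (j : 'I_N) : F := ('X_j)%:F.
Definition tpow e : F := \prod_j tvar j ^ e 0 j.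
Lemma tvar_neq0 j : tvar j != 0.
Proof. by rewrite tofrac_eq0 mpolyX_neq0. Qed.
Lemma tpowD e f : tpow (e + f) = tpow e * tpow f.
Proof.
rewrite /tpow -big_split; apply: eq_bigr => i _.
by rewrite mxE expfzDr ?tvar_neq0.
Qed.
Lemma tpow0 : tpow 0 = 1.
Proof. by rewrite /tpow big1 // => i _; rewrite mxE expr0z. Qed.
Lemma tpow_neq0 e : tpow e != 0.
Proof. by rewrite prodf_seq_neq0; apply/allP => i _; rewrite expfz_neq0 ?tvar_neq0. Qed.
Lemma tpowN e : tpow (- e) = (tpow e)^-1.
Proof. by apply: (mulfI (tpow_neq0 e)); rewrite -tpowD subrr tpow0 divff ?tpow_neq0. Qed.
Lemma tpow_nonneg e : nonneg e -> tpow e = ('X_[posexp e])%:F.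
Proof.
move=> ha; rewrite mpolyXE_id rmorph_prod; apply: eq_bigr => i _ /=.
by rewrite rmorphXn /= mnmE -{1}(gez0_abs (ha i)) -exprnP.
Qed.
End LaurentMonomials.
Arguments tpow_nonneg {k N e}.

(** * Monomial substitutions *)

Section MonomialSubstitution.
Variables (n r : nat).
Local Notation E0 := (ratX n).
Local Notation E := (ratXt n r).

Lemma scalX_is_zmod : zmod_morphism (@scalX n).
Proof. by move=> x y; rewrite /scalX mpolyCB tofracB. Qed.
Lemma scalX_is_monoid : monoid_morphism (@scalX n).
Proof. by split=> [|x y]; rewrite /scalX ?mpolyC1 ?tofrac1 // mpolyCM tofracM. Qed.
HB.instance Definition _ := GRing.isZmodMorphism.Build scalq E0 (@scalX n) scalX_is_zmod.
HB.instance Definition _ := GRing.isMonoidMorphism.Build scalq E0 (@scalX n) scalX_is_monoid.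
Lemma constt_is_zmod : zmod_morphism (@constt n r).
Proof. by move=> x y; rewrite /constt mpolyCB tofracB. Qed.
Lemma constt_is_monoid : monoid_morphism (@constt n r).
Proof. by split=> [|x y]; rewrite /constt ?mpolyC1 ?tofrac1 // mpolyCM tofracM. Qed.
HB.instance Definition _ := GRing.isZmodMorphism.Build E0 E (@constt n r) constt_is_zmod.
HB.instance Definition _ := GRing.isMonoidMorphism.Build E0 E (@constt n r) constt_is_monoid.

Definition tmon (e : 'rV[int]_r) : E := \prod_j tau n j ^ e 0 j.

Lemma monXD (a b : P n) : monX (a + b) = monX a * monX b.
Proof. exact: tpowD. Qed.
Lemma monX0 : monX (0 : P n) = 1.
Proof. exact: tpow0. Qed.
Lemma monX_neq0 (a : P n) : monX a != 0.
Proof. exact: tpow_neq0. Qed.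
Lemma monXN (a : P n) : monX (- a) = (monX a)^-1.
Proof. exact: tpowN. Qed.
Lemma tmonD e f : tmon (e + f) = tmon e * tmon f.
Proof. exact: tpowD. Qed.
Lemma tmon0 : tmon 0 = 1.
Proof. exact: tpow0. Qed.
Lemma tmon_neq0 e : tmon e != 0.
Proof. exact: tpow_neq0. Qed.
Lemma tmonN e : tmon (- e) = (tmon e)^-1.
Proof. exact: tpowN. Qed.
Lemma monX_nonneg (a : P n) : nonneg a -> monX a = ('X_[posexp a])%:F.
Proof. exact: tpow_nonneg. Qed.
Lemma tmon_nonneg e : nonneg e -> tmon e = ('X_[posexp e])%:F.
Proof. exact: tpow_nonneg. Qed.

Definition lmon (a : P n) (e : 'rV[int]_r) : E := constt r (monX a) * tmon e.
Lemma lmonD a b e f : lmon (a + b) (e + f) = lmon a e * lmon b f.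
Proof. by rewrite /lmon monXD tmonD rmorphM /= mulrACA. Qed.
Lemma lmon_neq0 a e : lmon a e != 0.
Proof. by rewrite mulf_neq0 ?tmon_neq0 // fmorph_eq0 monX_neq0. Qed.

(** Multiplication by a monomial with large exponents reduces the
    independence of Laurent monomials to that of monomials. *)
Lemma lmon_free (I : eqType) (s : seq I) (c : I -> scalq)
    (a : I -> P n) (e : I -> 'rV[int]_r) :
  uniq s -> {in s &, injective (fun i => (a i, e i))} ->
  \sum_(i <- s) constt r (scalX n (c i)) * lmon (a i) (e i) = 0 ->
  forall i, i \in s -> c i = 0.
Proof.
move=> us inj s0 i0 i0s.
(* [M] bounds the absolute values of all exponents. *)
pose M : int := \sum_(i <- s) (\sum_j `|a i 0 j| + \sum_j `|e i 0 j|).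
have term_le i : i \in s -> \sum_j `|a i 0 j| + \sum_j `|e i 0 j| <= M.
  move=> si; rewrite /M (big_rem i) //= lerDl sumr_ge0 // => k _.
  by rewrite addr_ge0 // sumr_ge0.
have aM i : i \in s -> nonneg (a i + const_mx M).
  move=> /term_le h j; rewrite !mxE.
  have : `|a i 0 j| <= M.
    apply: le_trans h; rewrite (bigD1 j) //= -addrA lerDl addr_ge0 ?sumr_ge0 //.
  by rewrite ler_norml => /andP[h1 _]; rewrite addrC -lerBlDl sub0r.
have eM i : i \in s -> nonneg (e i + const_mx M).
  move=> /term_le h j; rewrite !mxE.
  have : `|e i 0 j| <= M.
    apply: le_trans h; rewrite addrC (bigD1 j) //= -addrA lerDl addr_ge0 ?sumr_ge0 //.
  by rewrite ler_norml => /andP[h1 _]; rewrite addrC -lerBlDl sub0r.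
pose A i := posexp (a i + const_mx M); pose B i := posexp (e i + const_mx M).
have ABinj : {in s &, forall i j, A i = A j -> B i = B j -> i = j}.
  move=> i j si sj /posexp_inj e1 /posexp_inj e2; apply: inj => //.
  by congr (_, _); [apply: (addIr (const_mx M)); apply: e1 | apply: (addIr (const_mx M)); apply: e2];
    auto.
have E1 : (\sum_(i <- s) ((c i)%:MP * 'X_[A i])%:F%:MP * 'X_[B i] : {mpoly E0[r]})%:F = 0.
  have s1 := congr1 (fun x => x * lmon (const_mx M) (const_mx M)) s0.
  rewrite /= mul0r mulr_suml in s1; rewrite rmorph_sum /= -[RHS]s1.
  apply: eq_big_seq => i si; rewrite -mulrA -lmonD /lmon (monX_nonneg (aM i si)) (tmon_nonneg (eM i si)).
  by rewrite !rmorphM /= mulrA.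
have {}E1 : \sum_(i <- s) (((c i)%:MP * 'X_[A i])%:F%:MP * 'X_[B i] : {mpoly E0[r]}) = 0.
  by apply/eqP; rewrite -tofrac_eq0 E1.
have := congr1 (fun p => p@_(B i0)) E1; rewrite mcoeff0 raddf_sum /=.
rewrite (eq_bigr (fun i => ((c i *+ (B i == B i0))%:MP * 'X_[A i])%:F)); last first.
  move=> i _; rewrite mcoeffCM mcoeffX; case: (B i == B i0).
    by rewrite mulr1 mulr1n.
  by rewrite mulr0 mulr0n mpolyC0 mul0r tofrac0.
rewrite -rmorph_sum => /eqP; rewrite tofrac_eq0 => /eqP E2.
have := congr1 (fun p => p@_(A i0)) E2; rewrite mcoeff0 raddf_sum /= => E3.
rewrite (bigD1_seq i0) //= eqxx mcoeffCM mcoeffX eqxx mulr1 in E3.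
rewrite -E3 big_seq_cond big1 ?addr0 // => i /andP[si ne].
rewrite mcoeffCM mcoeffX; case: (eqVneq (A i)) => [eA|]; last by rewrite mulr0.
case: (eqVneq (B i)) => [eB|]; last by rewrite mul0r.
by rewrite (ABinj i i0) ?eqxx in ne.
Qed.

(** The conjugations and kappa are both substitutions of this kind: a character of
    the weight lattice with values in Laurent monomials scaled by powers of q. As
    [mc_mon] is injective, distinct monomials stay distinct, which is what makes
    the substitutions field morphisms. *)
Record monomial_character := MonomialCharacter {
  mc_scal : P n -> scalq;
  mc_mon : P n -> P n;
  mc_tau : P n -> 'rV[int]_r;
  mc_scal_neq0 : forall u, mc_scal u != 0;
  mc_scalD : forall u v, mc_scal (u + v) = mc_scal u * mc_scal v;
  mc_monD : forall u v, mc_mon (u + v) = mc_mon u + mc_mon v;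
  mc_mon_inj : injective mc_mon;
  mc_tauD : forall u v, mc_tau (u + v) = mc_tau u + mc_tau v
}.

Variable chi : monomial_character.
Definition mc_fun (u : P n) : E :=
  constt r (scalX n (mc_scal chi u)) * lmon (mc_mon chi u) (mc_tau chi u).

Lemma mc_funD u v : mc_fun (u + v) = mc_fun u * mc_fun v.
Proof.
rewrite /mc_fun mc_scalD mc_monD mc_tauD lmonD !rmorphM /=; ring.
Qed.
Lemma mc_fun_neq0 u : mc_fun u != 0.
Proof. by rewrite mulf_neq0 ?lmon_neq0 // !fmorph_eq0 mc_scal_neq0. Qed.
Lemma mc_fun0 : mc_fun 0 = 1.
Proof. by apply: (mulfI (mc_fun_neq0 0)); rewrite -mc_funD addr0 mulr1. Qed.
Lemma mc_funX (u : P n) (k : nat) : mc_fun (u *+ k) = mc_fun u ^+ k.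
Proof. by elim: k => [|k IH]; rewrite ?mulr0n ?mc_fun0 // mulrS mc_funD IH exprS. Qed.
Lemma mc_funN u : mc_fun (- u) = (mc_fun u)^-1.
Proof. by apply: (mulfI (mc_fun_neq0 u)); rewrite -mc_funD subrr mc_fun0 divff ?mc_fun_neq0. Qed.

Definition mexp (m : 'X_{1..n}) : P n := \sum_i omega i *+ m i.
Lemma mexpE m i : mexp m 0 i = (m i)%:Z.
Proof.
rewrite /mexp summxE (bigD1 i) //= big1 => [|j /negbTE ji].
  by rewrite addr0 mulmxnE mxE !eqxx /= mulr1n natz.
by rewrite mulmxnE mxE eqxx eq_sym ji mul0rn.
Qed.
Lemma mexp_inj : injective mexp.
Proof.
move=> m m' e; apply/mnmP => i; apply/eqP.
by rewrite -eqz_nat -!mexpE e.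
Qed.
Lemma mc_mmap1 m : mmap1 (fun i => mc_fun (omega i)) m = mc_fun (mexp m).
Proof.
rewrite /mexp (big_morph mc_fun mc_funD mc_fun0) /mmap1.
by apply: eq_bigr => i _; rewrite mc_funX.
Qed.

Lemma mc_inner_inj (p : {mpoly scalq[n]}) : p != 0 ->
  mmap (@constt n r \o @scalX n) (fun i => mc_fun (omega i)) p != 0.
Proof.
move=> p0; apply/eqP => h.
have h2 : \sum_(m <- msupp p) constt r (scalX n (p@_m * mc_scal chi (mexp m)))
            * lmon (mc_mon chi (mexp m)) (mc_tau chi (mexp m)) = 0.
  rewrite -[RHS]h; apply: eq_bigr => m _.
  rewrite mc_mmap1 /mc_fun /= !rmorphM /=; ring.
have inj : {in msupp p &, injective
    (fun m => (mc_mon chi (mexp m), mc_tau chi (mexp m)))}.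
  by move=> m m' _ _ [] /mc_mon_inj/mexp_inj.
have [m mp] : exists m, m \in msupp p.
  move: p0; rewrite -msupp_eq0; case: (msupp p) => // m s _; exists m.
  by rewrite mem_head.
have /eqP := lmon_free (msupp_uniq p) inj h2 mp.
by rewrite mulf_eq0 (negbTE (mc_scal_neq0 _ _)) orbF mcoeff_eq0 mp.
Qed.

Lemma mc_inner : exists f : {rmorphism E0 -> E},
  [/\ f =1 fsubst (@constt n r \o @scalX n) (fun i => mc_fun (omega i)),
      forall c, f (scalX n c) = constt r (scalX n c) &
      forall i, f (genX i) = mc_fun (omega i)].
Proof. exact: (fsubst_rmorphism mc_inner_inj). Qed.

Definition texp (m : 'X_{1..r}) : 'rV[int]_r := \row_j (m j)%:Z.
Lemma tmon_texp m : tmon (texp m) = mmap1 (@tau n r) m.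
Proof. by apply: eq_bigr => j _; rewrite mxE. Qed.

(** After multiplication by a common denominator of the coefficients, a relation
    is one between Laurent monomials. *)
Lemma mc_outer_inj (f : {rmorphism E0 -> E}) :
  (forall c, f (scalX n c) = constt r (scalX n c)) ->
  (forall i, f (genX i) = mc_fun (omega i)) ->
  forall p : {mpoly E0[r]}, p != 0 -> mmap f (@tau n r) p != 0.
Proof.
move=> fc fX p p0; apply/eqP => h.
have [D [Q [D0 QE]]] := common_denominator [seq p@_m | m <- msupp p].
have fp (q : {mpoly scalq[n]}) :
    f q%:F = \sum_(l <- msupp q) constt r (scalX n q@_l) * mc_fun (mexp l).
  rewrite {1}(mpolyE q) !rmorph_sum /=; apply: eq_bigr => l _.
  rewrite -mul_mpolyC !rmorphM /= fc mpolyXE_id !rmorph_prod -mc_mmap1; congr (_ * _).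
  by apply: eq_bigr => i _; rewrite !rmorphXn /= fX.
have {}QE m : m \in msupp p -> p@_m = (Q p@_m)%:F / D%:F.
  by move=> mp; apply: QE; apply: map_f.
pose s := [seq (m, l) | m <- msupp p, l <- msupp (Q p@_m)].
have us : uniq s.
  apply: allpairs_uniq_dep => [|m _|[m l] [m' l'] _ _ /=]; rewrite ?msupp_uniq //.
  by case=> -> ->.
have h2 : \sum_(x <- s) constt r (scalX n ((Q p@_x.1)@_x.2 * mc_scal chi (mexp x.2)))
    * lmon (mc_mon chi (mexp x.2)) (mc_tau chi (mexp x.2) + texp x.1) = 0.
  rewrite /s big_allpairs_dep /=.
  transitivity (f D%:F * mmap f (@tau n r) p); last by rewrite h mulr0.
  rewrite mulr_sumr; apply: eq_big_seq => m mp.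
  rewrite mulrA -(rmorphM f) /=.
  have -> : D%:F * p@_m = (Q p@_m)%:F.
    by rewrite [p@_m in LHS](QE m mp) mulrC divfK ?tofrac_eq0.
  rewrite fp mulr_suml; apply: eq_bigr => l _; rewrite -tmon_texp.
  by rewrite /mc_fun /lmon tmonD !rmorphM /= !mulrA.
have inj : {in s &, injective (fun x : 'X_{1..r} * 'X_{1..n} =>
    (mc_mon chi (mexp x.2), mc_tau chi (mexp x.2) + texp x.1))}.
  move=> [m l] [m' l'] _ _ /= [/mc_mon_inj/mexp_inj -> /addrI /rowP e].
  congr (_, _); apply/mnmP => j; apply/eqP; rewrite -eqz_nat.
  by have := e j; rewrite !mxE => /eqP.
have [m mp] : exists m, m \in msupp p.
  move: p0; rewrite -msupp_eq0; case: (msupp p) => // m s' _; exists m.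
  by rewrite mem_head.
have Qm0 : Q p@_m != 0.
  apply/eqP => Q0; move: (mp); rewrite mcoeff_msupp (QE m mp) Q0 tofrac0 mul0r eqxx //.
have [l lq] : exists l, l \in msupp (Q p@_m).
  move: Qm0; rewrite -msupp_eq0; case: (msupp _) => // l s' _; exists l.
  by rewrite mem_head.
have ml : (m, l) \in s by apply: allpairs_f_dep.
have /eqP := lmon_free us inj h2 ml.
by rewrite /= mulf_eq0 (negbTE (mc_scal_neq0 _ _)) orbF mcoeff_eq0 lq.
Qed.

Lemma mc_subst : exists f : {rmorphism E -> E},
  [/\ f =1 substXt (fun i => mc_fun (omega i)),
      forall c, f (constt r (scalX n c)) = constt r (scalX n c),
      forall u, f (constt r (monX u)) = mc_fun u &
      forall j, f (tau n j) = tau n j].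
Proof.
have [g [gE gc gX]] := mc_inner.
have [f [fE fc ft]] := fsubst_rmorphism (mc_outer_inj gc gX).
have {}fc c : f (constt r c) = g c by exact: fc.
exists f; split=> [x|c|u|j]; rewrite ?fc //.
- rewrite fE /substXt /fsubst.
  suff E p : mmap g (@tau n r) p =
     mmap (fsubst (@constt n r \o @scalX n) (fun i => mc_fun (omega i))) (@tau n r) p by rewrite !E.
  by apply: eq_bigr => m _; rewrite gE.
- rewrite /monX rmorph_prod /=; transitivity (mc_fun (\sum_i u 0 i *: omega i)).
    rewrite (big_morph mc_fun mc_funD mc_fun0); apply: eq_bigr => i _.
    rewrite fmorphXz gX; case: (u 0 i) => k.
      by rewrite -[Posz k]/(k%:Z) -[k%:Z in RHS]natz scaler_nat mc_funX.
    by rewrite NegzE scaleNr mc_funN -[k.+1%:Z in RHS]natz scaler_nat mc_funX.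
  congr mc_fun; rewrite [RHS]matrix_sum_delta big_ord1.
  by apply: eq_bigr.
- exact: ft.
Qed.

End MonomialSubstitution.

Lemma ratXt_ext (n r : nat) (K : fieldType) (f g : {rmorphism ratXt n r -> K}) :
  (forall c, f (constt r (scalX n c)) = g (constt r (scalX n c))) ->
  (forall i, f (constt r (genX i)) = g (constt r (genX i))) ->
  (forall j, f (tau n j) = g (tau n j)) -> f =1 g.
Proof.
move=> fc fX ft; apply: frac_mpoly_ext => [c|//].
exact: (@frac_mpoly_ext _ _ _ (f \o @constt n r) (g \o @constt n r)).
Qed.

Section Substitutions.
Variables (R : realType) (n : nat) (S : root_system R n).
Local Notation rootT := (seq_sub (roots S)).
Local Notation "''(' x , y ')'" := (form (gram S) x y) (format "''(' x ,  y ')'").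
Local Notation r := (size (nuR S)).
Local Notation E0 := (ratX n).
Local Notation E := (ratXt n r).
Implicit Types (a b : rootT) (w : W S) (i : 'I_n) (j : 'I_r) (g : E).

(** * Powers of q *)

Definition qint (x : R) := (qden S)%:~R * x \is a Num.int.
Lemma qpow_neq0 x : qpow S x != 0.
Proof. by rewrite /qpow expfz_neq0 // tofrac_eq0 polyX_eq0. Qed.
Lemma qpowD x y : qint x -> qint y -> qpow S (x + y) = qpow S x * qpow S y.
Proof.
move=> qx qy; rewrite /qpow mulrDr floorDzr ?expfzDr //.
by rewrite tofrac_eq0 polyX_eq0.
Qed.
Lemma qpow0 : qpow S 0 = 1.
Proof. by rewrite /qpow mulr0 floor0 expr0z. Qed.
Lemma qint_wt (u v : P n) : qint '(wt S u, wt S v).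
Proof. exact: qden_form_int. Qed.
Lemma qint_nu a (k : int) : qint (nu a * k%:~R).
Proof. by rewrite /qint; do 2?[apply: rpredM; rewrite ?intr_int ?nu_int]. Qed.

Lemma qXtD x y : qint x -> qint y -> qXt S (x + y) = qXt S x * qXt S y.
Proof. by move=> qx qy; rewrite /qXt /qX qpowD // !rmorphM. Qed.
Lemma qXt0 : qXt S 0 = 1.
Proof. by rewrite /qXt /qX qpow0 !rmorph1. Qed.
Lemma monXt_neq0 (u : P n) : monXt S u != 0.
Proof. by rewrite fmorph_eq0 monX_neq0. Qed.
Lemma monXtN (u : P n) : monXt S (- u) = (monXt S u)^-1.
Proof. by rewrite /monXt monXN fmorphV. Qed.

(** * The exponents of the [t_nu] *)


(** The pairings with [2 rho_nu^vee]; these are the exponents of [t_nu^{1/2}] in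
    [q^{(rho_k, u)}]. *)
Definition rhop (u : P n) : 'rV[int]_r :=
  \row_j \sum_(a : rootT | positive a && (nu a == nu_val j)) wpair u a.

Lemma rhopE (u : P n) j : Num.floor (2 * '(rho_check j, wt S u)) = rhop u 0 j.
Proof.
rewrite mxE -[RHS](@intrKfloor R) raddf_sum /=; congr Num.floor.
rewrite /rho_check formZl form_suml invfM mulrA mulrA divff ?pnatr_eq0 // mul1r mulr_sumr.
apply: eq_bigr => a /andP[_ /eqP <-]; rewrite wpairE formC form_val_cor mulKf //.
exact: nu_neq0.
Qed.
Lemma rhopD (u v : P n) : rhop (u + v) = rhop u + rhop v.
Proof.
apply/rowP => j; rewrite !mxE -big_split; apply: eq_bigr => a _; exact: wpairD.
Qed.
Lemma rhopN (u : P n) : rhop (- u) = - rhop u.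
Proof. by apply/rowP => j; rewrite !mxE -sumrN; apply: eq_bigr => a _; apply: wpairN. Qed.
Lemma rhop0 : rhop 0 = 0.
Proof. by apply: (addrI (rhop 0)); rewrite -rhopD !addr0. Qed.
Lemma rhopZ k (u : P n) : rhop (k *: u) = k *: rhop u.
Proof.
by apply/rowP => j; rewrite !mxE mulr_sumr; apply: eq_bigr => a _; rewrite wpairZ.
Qed.
Lemma qrhoE (u : P n) : qrho S u = tmon n (rhop u).
Proof. by apply: eq_bigr => j _; rewrite rhopE. Qed.
Lemma qrhoD (u v : P n) : qrho S (u + v) = qrho S u * qrho S v.
Proof. by rewrite !qrhoE rhopD tmonD. Qed.
Lemma qrho0 : qrho S 0 = 1.
Proof. by rewrite qrhoE rhop0 tmon0. Qed.

(** * The substitutions are field morphisms *)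

Section ConjChar.
Variable x : What S.
Let sc (u : P n) := qpow S '(wt S (wact x.2 u), wt S x.1).
Let scD u v : sc (u + v) = sc u * sc v.
Proof. by rewrite /sc wactD wtD formDl qpowD //; exact: qint_wt. Qed.
Let zD (u v : P n) : (0 : 'rV[int]_r) = 0 + 0. Proof. by rewrite addr0. Qed.
Definition conj_char : monomial_character n r :=
  MonomialCharacter (fun u => qpow_neq0 _) scD (wactD x.2) (can_inj (wactK x.2)) zD.

Lemma conj_charE (u : P n) :
  mc_fun conj_char u = qXt S '(wt S (wact x.2 u), wt S x.1) * monXt S (wact x.2 u).
Proof. by rewrite /mc_fun /lmon tmon0 mulr1. Qed.

Lemma conjXt_spec : exists f : {rmorphism E -> E},
  [/\ f =1 conjXt x, forall c, f (constt r (scalX n c)) = constt r (scalX n c),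
      forall u, f (monXt S u) = qXt S '(wt S (wact x.2 u), wt S x.1) * monXt S (wact x.2 u) &
      forall j, f (tau n j) = tau n j].
Proof.
have [f [fE fc fX ft]] := mc_subst conj_char.
exists f; split=> [y|//|u|//].
  rewrite fE; apply: (congr1 (fun h => substXt h y)).
  by apply: boolp.funext => i; rewrite conj_charE.
by rewrite [LHS]fX conj_charE.
Qed.
Fact conjXt_is_zmod : zmod_morphism (conjXt x).
Proof. by have [f [fE _ _ _]] := conjXt_spec => u v; rewrite -!fE rmorphB. Qed.
Fact conjXt_is_monoid : monoid_morphism (conjXt x).
Proof. by have [f [fE _ _ _]] := conjXt_spec; split=> [|u v]; rewrite -!fE ?rmorph1 // rmorphM. Qed.
HB.instance Definition _ := GRing.isZmodMorphism.Build E E (conjXt x) conjXt_is_zmod.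
HB.instance Definition _ := GRing.isMonoidMorphism.Build E E (conjXt x) conjXt_is_monoid.

Lemma conjXt_scal c : conjXt x (constt r (scalX n c)) = constt r (scalX n c).
Proof. by have [f [fE h _ _]] := conjXt_spec; rewrite -fE h. Qed.
Lemma conjXt_mon (u : P n) :
  conjXt x (monXt S u) = qXt S '(wt S (wact x.2 u), wt S x.1) * monXt S (wact x.2 u).
Proof. by have [f [fE _ h _]] := conjXt_spec; rewrite -fE h. Qed.
Lemma conjXt_tau j : conjXt x (tau n j) = tau n j.
Proof. by have [f [fE _ _ h]] := conjXt_spec; rewrite -fE h. Qed.
Lemma conjXt_q y : conjXt x (qXt S y) = qXt S y.
Proof. exact: conjXt_scal. Qed.

End ConjChar.

Section KappaChar.
Variable w : W S.
Let cD (u v : P n) : (1 : scalq) = 1 * 1. Proof. by rewrite mulr1. Qed.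
Let tD (u v : P n) :
  - rhop (wact w^-1%g (u + v)) = - rhop (wact w^-1%g u) - rhop (wact w^-1%g v).
Proof. by rewrite wactD rhopD opprD. Qed.
Definition kappa_char : monomial_character n r :=
  MonomialCharacter (fun u => oner_neq0 _) cD (wactD w^-1%g)
    (can_inj (wactK w^-1%g)) tD.

Lemma kappa_charE (u : P n) : mc_fun kappa_char u =
  (qrho S (wact w^-1%g u))^-1 * monXt S (wact w^-1%g u).
Proof. by rewrite /mc_fun /lmon /= tmonN qrhoE !rmorph1 mul1r mulrC. Qed.

Lemma kappa_spec : exists f : {rmorphism E -> E},
  [/\ f =1 kappa_fun w, forall c, f (constt r (scalX n c)) = constt r (scalX n c),
      forall u, f (monXt S u) = (qrho S (wact w^-1%g u))^-1 * monXt S (wact w^-1%g u) &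
      forall j, f (tau n j) = tau n j].
Proof.
have [f [fE fc fX ft]] := mc_subst kappa_char.
exists f; split=> [y|//|u|//].
  rewrite fE; apply: (congr1 (fun h => substXt h y)).
  by apply: boolp.funext => i; rewrite kappa_charE.
by rewrite [LHS]fX kappa_charE.
Qed.
Fact kappa_fun_is_zmod : zmod_morphism (kappa_fun w).
Proof. by have [f [fE _ _ _]] := kappa_spec => u v; rewrite -!fE rmorphB. Qed.
Fact kappa_fun_is_monoid : monoid_morphism (kappa_fun w).
Proof. by have [f [fE _ _ _]] := kappa_spec; split=> [|u v]; rewrite -!fE ?rmorph1 // rmorphM. Qed.
HB.instance Definition _ := GRing.isZmodMorphism.Build E E (kappa_fun w) kappa_fun_is_zmod.
HB.instance Definition _ := GRing.isMonoidMorphism.Build E E (kappa_fun w) kappa_fun_is_monoid.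

Lemma kappa_scal c : kappa_fun w (constt r (scalX n c)) = constt r (scalX n c).
Proof. by have [f [fE h _ _]] := kappa_spec; rewrite -fE h. Qed.
Lemma kappa_mon (u : P n) :
  kappa_fun w (monXt S u) = (qrho S (wact w^-1%g u))^-1 * monXt S (wact w^-1%g u).
Proof. by have [f [fE _ h _]] := kappa_spec; rewrite -fE h. Qed.
Lemma kappa_tau j : kappa_fun w (tau n j) = tau n j.
Proof. by have [f [fE _ _ h]] := kappa_spec; rewrite -fE h. Qed.
Lemma kappa_q y : kappa_fun w (qXt S y) = qXt S y.
Proof. exact: kappa_scal. Qed.

End KappaChar.

Section Gamma.
Variable u : P n.
Local Notation hG := (fun i => qX S '(wt S (omega i), wt S u) * genX i).
Lemma monX_omega i : monX (omega i) = genX i.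
Proof.
rewrite /monX (bigD1 i) //= mxE !eqxx expr1z big1 ?mulr1 // => k /negbTE ki.
by rewrite mxE ki andbF expr0z.
Qed.
(** The extension to [E] is a conjugation, so injectivity is known there. *)
Lemma gamma_inj (p : {mpoly scalq[n]}) : p != 0 -> mmap (@scalX n) hG p != 0.
Proof.
move=> p0; rewrite -(fmorph_eq0 (@constt n r)).
have := mc_inner_inj (conj_char (u, 1%g)) p0.
suff -> : mmap (@constt n r \o @scalX n) (fun i => mc_fun (conj_char (u, 1%g)) (omega i)) p
   = constt r (mmap (@scalX n) hG p) by [].
rewrite /mmap rmorph_sum; apply: eq_bigr => m _.
rewrite rmorphM /mmap1 rmorph_prod; congr (_ * _); apply: eq_bigr => i _.
by rewrite rmorphXn rmorphM conj_charE /= wact1 /monXt monX_omega.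
Qed.
Lemma GammaX_spec : exists f : {rmorphism E0 -> E0},
  [/\ f =1 GammaX S u, forall c, f (scalX n c) = scalX n c & forall i, f (genX i) = hG i].
Proof. exact: (fsubst_rmorphism gamma_inj). Qed.
Fact GammaX_is_zmod : zmod_morphism (GammaX S u).
Proof. by have [f [fE _ _]] := GammaX_spec => y z; rewrite -!fE rmorphB. Qed.
Fact GammaX_is_monoid : monoid_morphism (GammaX S u).
Proof. by have [f [fE _ _]] := GammaX_spec; split=> [|y z]; rewrite -!fE ?rmorph1 // rmorphM. Qed.
HB.instance Definition _ := GRing.isZmodMorphism.Build E0 E0 (GammaX S u) GammaX_is_zmod.
HB.instance Definition _ := GRing.isMonoidMorphism.Build E0 E0 (GammaX S u) GammaX_is_monoid.

Lemma conjXt_const (y : E0) : conjXt (u, 1%g : W S) (constt r y) = constt r (GammaX S u y).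
Proof.
have [f [fE fc fX]] := GammaX_spec.
apply: (@frac_mpoly_ext _ _ _ (conjXt (u, 1%g : W S) \o @constt n r)
  (@constt n r \o GammaX S u)) => [c|i] /=.
  by rewrite [LHS]conjXt_scal -fE fc.
rewrite -/(genX i) -fE fX -monX_omega [LHS]conjXt_mon /= wact1.
by rewrite (rmorphM (@constt n r)).
Qed.
End Gamma.

Lemma E_ext (f g : {rmorphism E -> E}) :
  (forall c, f (constt r (scalX n c)) = g (constt r (scalX n c))) ->
  (forall u, f (monXt S u) = g (monXt S u)) ->
  (forall j, f (tau n j) = g (tau n j)) -> f =1 g.
Proof. by move=> fc fX; apply: ratXt_ext => // i; rewrite -monX_omega; apply: fX. Qed.

Lemma conjXt_comp (x y : What S) g : conjXt (hmul x y) g = conjXt x (conjXt y g).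
Proof.
apply: (@E_ext (conjXt (hmul x y)) (conjXt x \o conjXt y)) => [c|u|j] /=.
- by rewrite !conjXt_scal.
- rewrite !conjXt_mon rmorphM /= conjXt_q conjXt_mon mulrA wact_comp; congr (_ * _).
  rewrite wtD formDr [LHS]qXtD ?qint_wt // mulrC; congr (qXt _ _ * _).
  by rewrite !wt_wact form_wvec.
- by rewrite !conjXt_tau.
Qed.
Lemma conjXt1 g : conjXt (hone S) g = g.
Proof.
apply: (@E_ext (conjXt (hone S)) idfun) => [c|u|j] /=.
- by rewrite conjXt_scal.
- by rewrite conjXt_mon /= wt0 form0r qXt0 mul1r wact1.
- by rewrite conjXt_tau.
Qed.
(** This relation is what makes kappa multiplicative: commuting a function past
    the element [x] also changes the component of the spinor. *)
Lemma kappa_conj w (x : What S) g : kappa_fun w (conjXt x g) =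
  conjXt (wact w^-1%g x.1, 1%g) (kappa_fun (wcomp x.2^-1%g w) g).
Proof.
apply: (@E_ext (kappa_fun w \o conjXt x)
   (conjXt (wact w^-1%g x.1, 1%g) \o kappa_fun (wcomp x.2^-1%g w))) => [c|u|j] /=.
- by rewrite conjXt_scal !kappa_scal conjXt_scal.
- rewrite conjXt_mon rmorphM /= kappa_q !kappa_mon rmorphM fmorphV /= conjXt_mon.
  have -> (z : P n) : conjXt (wact w^-1%g x.1, 1%g : W S) (qrho S z) = qrho S z.
    rewrite qrhoE rmorph_prod; apply: eq_bigr => k _.
    by rewrite fmorphXz /= conjXt_tau.
  rewrite wcomp_inv invgK wact_comp /= wact1 !wt_wact form_wvec mulrCA !mulrA.
  by congr (_ * _); rewrite mulrC.
- by rewrite conjXt_tau !kappa_tau conjXt_tau.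
Qed.
End Substitutions.

Section Algebra.
Variables (R : realType) (n : nat) (S : root_system R n).
Local Notation rootT := (seq_sub (roots S)).
Local Notation r := (size (nuR S)).
Local Notation E := (ratXt n r).
Implicit Types (a b : rootT) (w : W S) (i : 'I_n) (j : 'I_r) (g : E).

(** * The extended affine Weyl group *)

Implicit Types (x y z : What S) (ta : aroot S) (s t u : term S).

Lemma hmulA x y z : hmul x (hmul y z) = hmul (hmul x y) z.
Proof. by rewrite /hmul /= wactD wact_comp addrA wcompA. Qed.
Lemma hmul1x x : hmul (hone S) x = x.
Proof. by case: x => u w; rewrite /hmul /= add0r wact1 w1comp. Qed.
Lemma hmulx1 x : hmul x (hone S) = x.
Proof. by case: x => u w; rewrite /hmul /= wact0 addr0 wcomp1. Qed.
Definition hinv x : What S := (- wact x.2^-1%g x.1, x.2^-1%g).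
Lemma hmulxV x : hmul x (hinv x) = hone S.
Proof. by rewrite /hmul /hinv /= wactN wactVK subrr wcompV. Qed.
Lemma hmulVx x : hmul (hinv x) x = hone S.
Proof. by rewrite /hmul /hinv /= addNr wVcomp. Qed.
Lemma hmulKx x y : hmul (hinv x) (hmul x y) = y.
Proof. by rewrite hmulA hmulVx hmul1x. Qed.
Lemma hmul_inj x y z : hmul x y = hmul x z -> y = z.
Proof. by move=> e; rewrite -(hmulKx x y) e hmulKx. Qed.
Lemma hinv_uniq x y : hmul x y = hone S -> y = hinv x.
Proof. by move=> e; apply: (@hmul_inj x); rewrite e hmulxV. Qed.
Lemma hmul_trans (b c : P n) : hmul (htrans S b) (htrans S c) = htrans S (b + c).
Proof. by rewrite /hmul /htrans /= wact1 wcomp1 opprD. Qed.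
Lemma hprod_cat (l m : seq (What S)) : hprod (l ++ m) = hmul (hprod l) (hprod m).
Proof. by elim: l => [|x l IH] /=; rewrite ?hmul1x // IH hmulA. Qed.

Lemma hactE x ta : hact x ta = (wroot x.2 ta.1, ta.2 + wpair x.1 (wroot x.2 ta.1)).
Proof. by []. Qed.
Lemma hact_hmul x y ta : hact (hmul x y) ta = hact x (hact y ta).
Proof.
rewrite !hactE /= wroot_comp wpairD wpair_wact; congr (_, _).
by rewrite -addrA; congr (_ + _); rewrite addrC.
Qed.
Lemma hact1 ta : hact (hone S) ta = ta.
Proof. by case: ta => a j; rewrite hactE /= wroot1 wpair0 addr0. Qed.
Lemma hactK x : cancel (hact x) (hact (hinv x)).
Proof. by move=> ta; rewrite -hact_hmul hmulVx hact1. Qed.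
Lemma hact_opp x ta : hact x (aopp ta) = aopp (hact x ta).
Proof. by rewrite !hactE /aopp /= wroot_opp wpair_opp opprD. Qed.
Lemma aoppK : involutive (@aopp R n S).
Proof. by case=> a j; rewrite /aopp /= opp_rootK opprK. Qed.

Lemma sreflE ta : srefl ta = (ta.2 *: rweight ta.1, sr ta.1).
Proof. by []. Qed.
Lemma srefl_opp ta : srefl (aopp ta) = srefl ta.
Proof. by rewrite !sreflE /aopp /= rweight_opp sr_opp scaleNr scalerN opprK. Qed.
Lemma wactZ w (k : int) (u : P n) : wact w (k *: u) = k *: wact w u.
Proof. by apply: (@wt_inj _ _ S); rewrite wt_wact !wtZ wvecZ wt_wact. Qed.
Lemma hmul_srefl x ta : hmul x (srefl ta) = hmul (srefl (hact x ta)) x.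
Proof.
case: x ta => u w [a j]; rewrite !sreflE hactE /hmul /= wcomp_sr; congr (_, _).
rewrite wact_sr scalerDl addrC -addrA; congr (_ + _); last by rewrite addrC subrK.
rewrite -wact_rweight.
exact: wactZ.
Qed.
Lemma hact_srefl_self ta : hact (srefl ta) ta = aopp ta.
Proof.
case: ta => a j; rewrite hactE sreflE /aopp /= wroot_sr; congr (_, _).
by rewrite wpair_opp wpairZ wpair_self; ring.
Qed.
Lemma srefl_sq ta : hmul (srefl ta) (srefl ta) = hone S.
Proof.
case: ta => a j; rewrite sreflE /hmul /= sr_sq wact_sr wpairZ wpair_self.
by rewrite mulrC mulr_natl mulr2n scalerDl opprD !addrA addrK subrr.
Qed.
Lemma nu_hact x ta : nu (hact x ta).1 = nu ta.1.
Proof. exact: nu_wroot. Qed.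

Definition swd (l : seq 'I_n.+1) := hprod [seq srefl (asimple S i) | i : 'I_n.+1 <- l].
Lemma swd_cat (l m : seq 'I_n.+1) : swd (l ++ m) = hmul (swd l) (swd m).
Proof. by rewrite /swd map_cat hprod_cat. Qed.
Lemma swd1 (i : 'I_n.+1) : swd [:: i] = srefl (asimple S i).
Proof. exact: hmulx1. Qed.
Lemma swd_rev (l : seq 'I_n.+1) : swd (rev l) = hinv (swd l).
Proof.
apply: hinv_uniq; elim: l => [|i l IH]; first by rewrite hmulx1.
rewrite rev_cons -cats1 swd_cat swd1 -cat1s swd_cat swd1.
by rewrite -hmulA [hmul (swd l) _]hmulA IH hmul1x srefl_sq.
Qed.

(** * Linear extensions from formal sums *)

Section LinearExtension.
Variables (K : choiceType) (G V : zmodType) (F : K -> G -> V).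
Hypotheses (F0 : forall k, F k 0 = 0) (FD : forall k (g h : G), F k (g + h) = F k g + F k h).
Implicit Types A B : malg K G.
Definition lin A : V := \sum_(k <- monalg.msupp A) F k (monalg.mcoeff k A).
Lemma lin_le A (d : {fset K}) : fsubset (monalg.msupp A) d ->
  lin A = \sum_(k <- d) F k (monalg.mcoeff k A).
Proof.
move=> le; rewrite [LHS](big_fset_incl _ le) //= => k _ /monalg.mcoeff_outdom ->.
exact: F0.
Qed.
Lemma linD A B : lin (A + B) = lin A + lin B.
Proof.
pose d := fsetU (monalg.msupp A) (monalg.msupp B).
rewrite (@lin_le (A + B) d) ?monalg.msuppD_le // (@lin_le A d) ?fsubsetUl //.
rewrite (@lin_le B d) ?fsubsetUr // -big_split; apply: eq_bigr => k _.
by rewrite monalg.mcoeffD FD.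
Qed.
Lemma lin0 : lin 0 = 0.
Proof. by apply: (addrI (lin 0)); rewrite -linD !addr0. Qed.
Lemma linU k (g : G) : lin (mkmalgU k g) = F k g.
Proof. by rewrite (lin_le monalg.msuppU_le) big_seq_fset1 monalg.mcoeffUU. Qed.
End LinearExtension.

Lemma malg_ind (K : choiceType) (G : zmodType) (Q : malg K G -> Prop) :
  Q 0 -> (forall A B, Q A -> Q B -> Q (A + B)) ->
  (forall k (g : G), Q (mkmalgU k g)) -> forall A, Q A.
Proof.
by move=> Q0 QD QU A; rewrite (monalg.monalgE A); apply: big_ind.
Qed.

(** Each of the three arguments may be replaced by generators, one at a time. *)
Lemma generated_assoc (V : zmodType) (mul : V -> V -> V) (I : Type) (o : I -> V)
    (m : I -> I -> I) (e : I) :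
  left_distributive mul +%R -> right_distributive mul +%R ->
  (forall Q : V -> Prop, Q 0 -> (forall A B : V, Q A -> Q B -> Q (A + B)) ->
     (forall k, Q (o k)) -> forall A, Q A) ->
  (forall k l, mul (o k) (o l) = o (m k l)) ->
  associative m -> left_id e m -> right_id e m ->
  [/\ associative mul, left_id (o e) mul & right_id (o e) mul].
Proof.
move=> Dl Dr ind oM mA m1 mr1.
have l0 A : mul 0 A = 0 by apply: (addrI (mul 0 A)); rewrite -Dl !addr0.
have r0 A : mul A 0 = 0 by apply: (addrI (mul A 0)); rewrite -Dr !addr0.
split=> [A B C|A|A].
- elim/ind: A => [|A A' h h'|i]; rewrite ?l0 ?Dl ?h ?h' //.
  elim/ind: B => [|B B' h h'|j]; rewrite ?l0 ?r0 ?l0 ?Dl ?Dr ?Dl ?h ?h' //.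
  elim/ind: C => [|C C' h h'|k]; rewrite ?l0 ?r0 ?Dl ?Dr ?h ?h' //.
  by rewrite !oM mA.
- by elim/ind: A => [|A A' h h'|i]; rewrite ?r0 ?Dr ?h ?h' // oM m1.
- by elim/ind: A => [|A A' h h'|i]; rewrite ?l0 ?Dl ?h ?h' // oM mr1.
Qed.

(** * The algebra of difference-reflection operators *)

Implicit Types (A B C : refl_op S).

Lemma term_mulA s t u : term_mul s (term_mul t u) = term_mul (term_mul s t) u.
Proof. by rewrite /term_mul /= rmorphM /= -conjXt_comp mulrA hmulA. Qed.
Lemma term_mul1l s : term_mul (term_one S) s = s.
Proof. by case: s => g x; rewrite /term_mul /= conjXt1 mul1r hmul1x. Qed.
Lemma term_mul1r s : term_mul s (term_one S) = s.
Proof. by case: s => g x; rewrite /term_mul /= rmorph1 mulr1 hmulx1. Qed.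
Lemma of_What_mul x y : term_mul (of_What x) (of_What y) = of_What (hmul x y).
Proof. by rewrite /term_mul /= rmorph1 mulr1. Qed.

Lemma opD (g h : E) x : op (g + h, x) = op (g, x) + op (h, x) :> refl_op S.
Proof. exact: monalg.monalgUD. Qed.
Lemma op0 x : op (0, x) = 0 :> refl_op S.
Proof. exact: monalg.monalgU0. Qed.
Lemma opN (g : E) x : op (- g, x) = - op (g, x) :> refl_op S.
Proof. exact: monalg.monalgUN. Qed.

Let FR (g : E) x := fun y (h : E) => op (term_mul (g, x) (h, y)).
Let FR0 g x y : FR g x y 0 = 0.
Proof. by rewrite /FR /term_mul /= rmorph0 mulr0 op0. Qed.
Let FRD g x y h k : FR g x y (h + k) = FR g x y h + FR g x y k.
Proof. by rewrite /FR /term_mul /= rmorphD mulrDr opD. Qed.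
Let FL C := fun x (g : E) => lin (FR g x) C.
Let FL0 C x : FL C x 0 = 0.
Proof.
rewrite /FL /lin big1_seq // => y _.
by rewrite /FR /term_mul /= mul0r op0.
Qed.
Let FLD C x g h : FL C x (g + h) = FL C x g + FL C x h.
Proof.
rewrite /FL /lin -big_split; apply: eq_bigr => y _.
by rewrite /FR /term_mul /= mulrDl opD.
Qed.
Lemma op_mulDl A B C : op_mul (A + B) C = op_mul A C + op_mul B C.
Proof. exact: (linD (FL0 C) (FLD C)). Qed.
Lemma op_mulDr A B C : op_mul A (B + C) = op_mul A B + op_mul A C.
Proof.
rewrite /op_mul -big_split; apply: eq_bigr => x _.
exact: (linD (FR0 _ x) (FRD _ x)).
Qed.
Lemma op_mul_op s t : op_mul (op s) (op t) = op (term_mul s t).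
Proof.
case: s t => g x [h y]; transitivity (lin (FL (op (h, y))) (mkmalgU x g)); first by [].
by rewrite (linU (FL0 _)) /FL (linU (FR0 _ _)).
Qed.
Lemma refl_op_ind (Q : refl_op S -> Prop) :
  Q 0 -> (forall A B, Q A -> Q B -> Q (A + B)) -> (forall s, Q (op s)) -> forall A, Q A.
Proof. by move=> Q0 QD Qs; apply: malg_ind Q0 QD _ => k g; apply: (Qs (g, k)). Qed.
Let one_neq0 : op_one S != 0.
Proof. by rewrite monalg.monalgU_eq0 oner_neq0. Qed.

(** The operators as an abstract ring: identities are then derived from the ring
    laws alone, without unfolding formal sums. *)
Fact op_ring_subproof : {T : nzRingType & {f : refl_op S -> T |
  [/\ injective f, forall A B, f (A + B) = f A + f B, f (op_one S) = 1 &
      forall A B, f (op_mul A B) = f A * f B]}}.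
Proof.
have [mA m1 mr1] := generated_assoc op_mulDl op_mulDr refl_op_ind op_mul_op
   term_mulA term_mul1l term_mul1r.
pose ring_mixin := GRing.Zmodule_isNzRing.Build (malg (What S) E) mA m1 mr1 op_mulDl op_mulDr one_neq0.
pose T : nzRingType := HB.pack (malg (What S) E) ring_mixin.
exists T; exists (fun A : refl_op S => A : T).
by split=> [A B|A B||A B].
Qed.
Definition op_ring : nzRingType := projT1 op_ring_subproof.
Definition opr : refl_op S -> op_ring := sval (projT2 op_ring_subproof).
(* Opaque for the same reason. *)
Fact tmr_subproof : {f : term S -> op_ring | f = fun s => opr (op s)}.
Proof. by eexists. Qed.
Definition tmr : term S -> op_ring := sval tmr_subproof.
Lemma tmrE s : tmr s = opr (op s).
Proof. by rewrite /tmr (svalP tmr_subproof). Qed.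
Lemma opr_inj : injective opr.
Proof. by case: (svalP (projT2 op_ring_subproof)). Qed.
Lemma oprD A B : opr (A + B) = opr A + opr B.
Proof. by case: (svalP (projT2 op_ring_subproof)). Qed.
Lemma opr1 : opr (op_one S) = 1.
Proof. by case: (svalP (projT2 op_ring_subproof)). Qed.
Lemma oprM A B : opr (op_mul A B) = opr A * opr B.
Proof. by case: (svalP (projT2 op_ring_subproof)). Qed.
Lemma opr0 : opr 0 = 0.
Proof. by apply: (addrI (opr 0)); rewrite -oprD !addr0. Qed.
Lemma oprN A : opr (- A) = - opr A.
Proof. by apply: (addrI (opr A)); rewrite -oprD !subrr opr0. Qed.
Lemma opr_prod (l : seq (refl_op S)) : opr (op_prod l) = \prod_(A <- l) opr A.
Proof.
elim: l => [|A l IH]; first by rewrite big_nil opr1.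
by rewrite big_cons -IH -oprM.
Qed.
Lemma tmrM s t : tmr s * tmr t = tmr (term_mul s t).
Proof. by rewrite !tmrE -oprM op_mul_op. Qed.
Lemma tmr1 : tmr (term_one S) = 1.
Proof. by rewrite tmrE opr1. Qed.
Lemma tmrD (g h : E) x : tmr (g + h, x) = tmr (g, x) + tmr (h, x).
Proof. by rewrite !tmrE -oprD -opD. Qed.
Lemma tmr0 x : tmr (0, x) = 0.
Proof. by rewrite tmrE op0 opr0. Qed.
Lemma tmrN (g : E) x : tmr (- g, x) = - tmr (g, x).
Proof. by rewrite !tmrE -oprN -opN. Qed.
Lemma tmr_prod (l : seq (term S)) : tmr (term_prod l) = \prod_(s <- l) tmr s.
Proof.
elim: l => [|s l IH]; first by rewrite big_nil tmr1.
by rewrite big_cons -IH tmrM.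
Qed.

(** * Intertwiners *)

Lemma XaffE ta : Xaff ta = qXt S (nu ta.1 * ta.2%:~R) * monXt S (rweight ta.1).
Proof. by []. Qed.
Lemma Xaff_opp ta : Xaff (aopp ta) = (Xaff ta)^-1.
Proof.
case: ta => a j; rewrite !XaffE /= rweight_opp monXtN invfM nu_opp; congr (_ * _).
have q0 : qXt S (nu a * j%:~R) != 0 by rewrite !fmorph_eq0 qpow_neq0.
apply: (mulfI q0); rewrite (divff q0) -(qXtD (qint_nu a j) (qint_nu a (- j))).
by rewrite -mulrDr -intrD subrr mulr0 qXt0.
Qed.
Lemma conj_Xaff x ta : conjXt x (Xaff ta) = Xaff (hact x ta).
Proof.
case: x ta => u w [a j]; rewrite !XaffE rmorphM /= conjXt_q conjXt_mon /=.
rewrite wact_rweight mulrA nu_wroot; congr (_ * _).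
rewrite -qXtD ?qint_nu ?qint_wt //; congr (qXt S _).
rewrite intrD mulrDr; congr (_ + _).
by rewrite wpairE wt_rweight formC form_val_cor nu_wroot.
Qed.
Lemma Xaff_neq0 ta : Xaff ta != 0.
Proof. by rewrite XaffE mulf_neq0 ?monXt_neq0 // !fmorph_eq0 qpow_neq0. Qed.

(** Two distinct monomials are linearly independent. *)
Lemma lmon_neq1 (k : scalq) (u : P n) (e : 'rV[int]_r) :
  (u != 0) || (e != 0) -> constt r (scalX n k) * lmon u e != 1.
Proof.
move=> ue; apply/eqP => h.
pose c (i : bool) := if i then k else -1; pose a (i : bool) := if i then u else 0.
pose f (i : bool) := if i then e else 0.
have := @lmon_free n r _ [:: true; false] c a f _ _ _ false.
rewrite !big_cons big_nil addr0 /c /a /f /= h !rmorphN1 /lmon monX0 tmon0 !rmorph1 mulr1.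
rewrite mulr1 subrr !inE => /(_ isT) H; have /eqP : (-1 : scalq) = 0.
  have inj : {in [:: true; false] &,
      injective (fun i : bool => (if i then u else 0, if i then e else 0))}.
    move=> [] [] _ _ //= [e1 e2]; move: ue; rewrite ?e1 ?e2 -?e1 -?e2.
      by rewrite !eqxx.
    by rewrite !eqxx.
  exact: H inj (erefl 0) isT.
by rewrite oppr_eq0 oner_eq0.
Qed.
Lemma Xaff_lmon ta :
  Xaff ta = constt r (scalX n (qpow S (nu ta.1 * ta.2%:~R))) * lmon (rweight ta.1) 0.
Proof. by rewrite /lmon tmon0 mulr1. Qed.
Lemma Xaff_neq1 ta : Xaff ta != 1.
Proof. by rewrite Xaff_lmon lmon_neq1 // rweight_neq0. Qed.

Lemma t_half_tmon a : t_half a = tmon n (\row_j (nu_val j == nu a)%:Z).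
Proof.
rewrite /t_half big_mkcond; apply: eq_bigr => j _; rewrite mxE.
by case: (_ == _); rewrite ?expr1z ?expr0z.
Qed.
Lemma t_half_neq0 a : t_half a != 0.
Proof. by rewrite t_half_tmon tmon_neq0. Qed.
Lemma t_half_nu a b : nu a = nu b -> t_half a = t_half b.
Proof. by move=> e; rewrite /t_half e. Qed.
Lemma t_half_opp a : t_half (opp_root a) = t_half a.
Proof. exact/t_half_nu/nu_opp. Qed.
Lemma conj_t_half x a : conjXt x (t_half a) = t_half a.
Proof. by rewrite rmorph_prod; apply: eq_bigr => j _; rewrite /= conjXt_tau. Qed.
Lemma conj_faff x ta : conjXt x (faff ta) = faff (hact x ta).
Proof.
rewrite /faff fmorph_div !rmorphB rmorphM !fmorphV !rmorph1 /= conj_Xaff.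
by rewrite /t_par rmorphXn /= conj_t_half (t_half_nu (nu_hact x ta)).
Qed.
Lemma conj_gaff x ta : conjXt x (gaff ta) = gaff (hact x ta).
Proof.
rewrite /gaff fmorph_div !rmorphB !fmorphV !rmorph1 /= conj_Xaff.
by rewrite /t_par rmorphXn /= conj_t_half (t_half_nu (nu_hact x ta)).
Qed.
End Algebra.

Section Intertwiners.
Variables (R : realType) (n : nat) (S : root_system R n).
Local Notation rootT := (seq_sub (roots S)).
Local Notation r := (size (nuR S)).
Local Notation E := (ratXt n r).
Implicit Types (a b : rootT) (w : W S) (i : 'I_n) (j : 'I_r) (g : E).

Implicit Types (x y z : What S) (ta : aroot S) (s t u : term S).

Section FieldIdentities.
Variables (F : fieldType) (t X : F).
Hypotheses (t0 : t != 0) (X0 : X != 0) (X1 : X != 1).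
Let dX : X - 1 != 0. Proof. by rewrite subr_eq0. Qed.
Let dX' : 1 - X != 0. Proof. by rewrite subr_eq0 eq_sym. Qed.
Lemma faff_simple : t^-1 * ((t ^+ 2 * X - 1) / (X - 1)) = t + (t - t^-1) * (X - 1)^-1.
Proof. by field; rewrite t0 dX. Qed.
Lemma gaff_simple : t^-1 * ((t ^+ 2 - 1) / (1 - X)) = - ((t - t^-1) * (X - 1)^-1).
Proof. by field; rewrite t0 dX' dX. Qed.
Lemma faff_gaff_id :
  (t^-1 * ((t ^+ 2 * X - 1) / (X - 1))) * (t^-1 * ((t ^+ 2 * X^-1 - 1) / (X^-1 - 1)))
  - (t^-1 * ((t ^+ 2 - 1) / (1 - X^-1))) * (t^-1 * ((t ^+ 2 - 1) / (1 - X))) = 1.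
Proof. by field; rewrite t0 X0 dX' dX. Qed.
End FieldIdentities.

Lemma hact_srefl_opp ta : hact (srefl ta) (aopp ta) = ta.
Proof. by rewrite -srefl_opp hact_srefl_self aoppK. Qed.

Lemma of_What_Gp x c ta :
  tmr (of_What x) * tmr (Gp_summand c ta) = tmr (Gp_summand c (hact x ta)) * tmr (of_What x).
Proof.
rewrite tmrM tmrM; congr tmr; case: c; rewrite /term_mul /= rmorph1 mulr1 mul1r.
  by rewrite rmorphM fmorphV /= conj_t_half conj_gaff hmul_srefl (t_half_nu (nu_hact x ta)).
rewrite rmorphM fmorphV /= conj_t_half conj_faff (t_half_nu (nu_hact x ta)).
by rewrite hmulx1 hmul1x.
Qed.
Fact intertwiner_subproof : {f : bool -> aroot S -> op_ring S |
  forall p ta, f p ta = opr (if p then Gp ta else Gm (aopp ta))}.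
Proof. by eexists. Qed.
Definition GpR : aroot S -> op_ring S := sval intertwiner_subproof true.
Definition GmR : aroot S -> op_ring S := sval intertwiner_subproof false.
Lemma GpRE ta : opr (Gp ta) = GpR ta.
Proof. exact/esym/(svalP intertwiner_subproof true). Qed.
Lemma GmRE ta : opr (Gm (aopp ta)) = GmR ta.
Proof. exact/esym/(svalP intertwiner_subproof false). Qed.
Lemma GpR_sum ta : GpR ta = tmr (Gp_summand false ta) + tmr (Gp_summand true ta).
Proof. by rewrite -GpRE !tmrE -oprD. Qed.
Lemma GmR_sum ta : GmR ta = tmr (Gm_summand false (aopp ta)) + tmr (Gm_summand true (aopp ta)).
Proof. by rewrite -GmRE !tmrE -oprD. Qed.
Lemma conj_Gp x ta : tmr (of_What x) * GpR ta = GpR (hact x ta) * tmr (of_What x).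
Proof. by rewrite !GpR_sum mulrDr mulrDl !of_What_Gp. Qed.

(** Both sides have a function part and a part with [s_i]; comparing them are two
    identities between rational functions of [X_{alpha_i}]. *)
Lemma T_simple (k : 'I_n.+1) :
  opr (T S k) = tmr (of_What (srefl (asimple S k))) * GpR (asimple S k).
Proof.
set ta := asimple S k; set s := of_What (srefl ta).
set f1 := of_fun (t_half ta.1).
set f2 := of_fun ((t_half ta.1 - (t_half ta.1)^-1) * (Xaff ta - 1)^-1).
have -> : opr (T S k) = tmr f1 * tmr s + tmr f2 * (tmr s - 1).
  have e3 : opr (op s - op_one S) = tmr s - 1.
    apply: etrans (oprD _ _) (congr2 +%R (esym (tmrE s)) _).
    exact: etrans (oprN _) (congr1 -%R (opr1 S)).
  apply: etrans (oprD _ _) (congr2 +%R _ _); apply: etrans (oprM _ _) (congr2 *%R _ _).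
  - exact/esym/tmrE.
  - exact/esym/tmrE.
  - exact/esym/tmrE.
  - exact: e3.
rewrite GpR_sum [RHS]mulrDr !(of_What_Gp (srefl ta)) hact_srefl_self !tmrM.
rewrite mulrBr mulr1 !tmrM /term_mul /of_fun /of_What /=.
rewrite !rmorph1 !mulr1 !hmul1x t_half_opp srefl_opp srefl_sq.
rewrite /faff /gaff Xaff_opp invrK /t_par /= t_half_opp.
rewrite (faff_simple (t_half_neq0 _) (Xaff_neq1 _)) (gaff_simple (t_half_neq0 _) (Xaff_neq1 _)).
by rewrite tmrD tmrN addrA.
Qed.

Lemma Gm_true ta :
  Gm_summand true (aopp ta) = (- ((t_half ta.1)^-1 * gaff ta), srefl ta).
Proof.
rewrite /Gm_summand /term_mul /= conj_gaff srefl_opp hact_srefl_opp t_half_opp.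
by rewrite mulNr hmulx1.
Qed.
Lemma Gm_false ta :
  Gm_summand false (aopp ta) = of_fun ((t_half ta.1)^-1 * faff (aopp ta)).
Proof. by rewrite /Gm_summand /= t_half_opp. Qed.

Let fg ta : (t_half ta.1)^-1 * faff (aopp ta) * ((t_half ta.1)^-1 * faff ta)
  - (t_half ta.1)^-1 * gaff ta * ((t_half ta.1)^-1 * gaff (aopp ta)) = 1.
Proof.
rewrite /faff /gaff Xaff_opp invrK /t_par /= t_half_opp.
exact: faff_gaff_id (t_half_neq0 _) (Xaff_neq0 _) (Xaff_neq1 _).
Qed.

Lemma conj_tf x ta : conjXt x ((t_half ta.1)^-1 * faff ta) =
  (t_half ta.1)^-1 * faff (hact x ta).
Proof. by rewrite rmorphM fmorphV /= conj_t_half conj_faff. Qed.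
Lemma conj_tg x ta : conjXt x ((t_half ta.1)^-1 * gaff ta) =
  (t_half ta.1)^-1 * gaff (hact x ta).
Proof. by rewrite rmorphM fmorphV /= conj_t_half conj_gaff. Qed.
Let conj_tf' x ta : conjXt x ((t_half ta.1)^-1 * faff (aopp ta)) =
  (t_half ta.1)^-1 * faff (aopp (hact x ta)).
Proof. by rewrite -hact_opp -(t_half_opp ta.1); exact: (conj_tf x (aopp ta)). Qed.

(** The reflection parts cancel, and the rest is the unitarity relation
    [faff_gaff_id]. *)
Lemma Gm_Gp ta : GmR ta * GpR ta = 1.
Proof.
rewrite GpR_sum GmR_sum Gm_true Gm_false mulrDl !mulrDr !tmrM /term_mul /=.
rewrite !conjXt1 conj_tf conj_tg hact_srefl_self.
rewrite !hmul1x hmulx1 srefl_sq [X in _ + X]addrC addrACA -!tmrD.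
set A := _ * faff (aopp ta); set B := _ * gaff ta.
rewrite (_ : A * B + - B * A = 0); last by rewrite mulNr [B * A]mulrC subrr.
by rewrite tmr0 addr0 -tmr1; congr (tmr (_, _)); rewrite mulNr fg.
Qed.
Lemma Gp_Gm ta : GpR ta * GmR ta = 1.
Proof.
rewrite GpR_sum GmR_sum Gm_true Gm_false mulrDl !mulrDr !tmrM /term_mul /=.
rewrite !conjXt1 rmorphN /= conj_tf' conj_tg hact_srefl_self aoppK.
rewrite !hmul1x hmulx1 srefl_sq [X in _ + X]addrC addrACA -!tmrD.
set A := _ * faff ta; set B := _ * gaff ta.
rewrite (_ : A * - B + B * A = 0); last by rewrite mulrN [B * A]mulrC addNr.
rewrite tmr0 addr0 -tmr1; congr (tmr (_, _)); rewrite mulrN -(fg ta) -/A -/B.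
by congr (_ - _); rewrite mulrC.
Qed.

Lemma alpha_seq_rcons (word : seq 'I_n.+1) (k : 'I_n.+1) : alpha_seq S (rcons word k) =
  rcons (alpha_seq S word) (hact (swd S word) (asimple S k)).
Proof.
rewrite /alpha_seq size_rcons -(addn1 (size word)) iotaD map_cat add0n -[RHS]cats1.
congr cat.
  apply/eq_in_map => p; rewrite mem_iota add0n => /= lp.
  by rewrite -cats1 take_cat nth_cat lp.
by rewrite /= -cats1 take_size_cat // nth_cat ltnn subnn.
Qed.
Lemma size_alpha_seq (word : seq 'I_n.+1) : size (alpha_seq S word) = size word.
Proof. by rewrite size_map size_iota. Qed.

(** The reflections are moved to the left; an intertwiner of a simple root that is
    passed by [s_{j_{p-1}} ... s_{j_1}] becomes that of [alpha~^p]. *)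
Lemma prod_T (word : seq 'I_n.+1) :
  \prod_(k <- rev word) opr (T S k) =
  tmr (of_What (swd S (rev word))) * \prod_(ta <- rev (alpha_seq S word)) GpR ta.
Proof.
elim/last_ind: word => [|w k IH].
  by rewrite /rev /= !big_nil mulr1 -tmr1.
rewrite rev_rcons big_cons IH alpha_seq_rcons rev_rcons big_cons T_simple.
have c : GpR (asimple S k) * tmr (of_What (swd S (rev w))) =
    tmr (of_What (swd S (rev w))) * GpR (hact (swd S w) (asimple S k)).
  by rewrite conj_Gp swd_rev hactK.
rewrite -!mulrA [GpR (asimple S k) * (_ * _)]mulrA c !mulrA tmrM of_What_mul.
by congr (tmr (of_What _) * _ * _).
Qed.

Lemma Y_fact (b : P n) pi (word : seq 'I_n.+1) :
  htrans S b = hmul pi (swd S (rev word)) ->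
  opr (Y pi word) = tmr (of_What (htrans S b)) * \prod_(ta <- rev (alpha_seq S word)) GpR ta.
Proof.
move=> e; rewrite /Y opr_prod big_cons big_map prod_T mulrA.
by rewrite -tmrE tmrM of_What_mul -e.
Qed.

Lemma prod_Gp_Gm (l : seq (aroot S)) :
  (\prod_(ta <- rev l) GpR ta) * (\prod_(ta <- l) GmR ta) = 1.
Proof.
elim: l => [|ta l IH]; first by rewrite !big_nil mulr1.
rewrite rev_cons -cats1 big_cat big_seq1 big_cons /=.
by rewrite mulrA -[_ * _ * GmR _]mulrA Gp_Gm mulr1.
Qed.
Lemma prod_Gm_Gp (l : seq (aroot S)) :
  (\prod_(ta <- l) GmR ta) * (\prod_(ta <- rev l) GpR ta) = 1.
Proof.
elim: l => [|ta l IH]; first by rewrite !big_nil mulr1.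
rewrite rev_cons -cats1 big_cat big_seq1 big_cons /=.
by rewrite -mulrA [X in _ * X]mulrA IH mul1r Gm_Gp.
Qed.

Lemma htrans0 : htrans S 0 = hone S.
Proof. by rewrite /htrans oppr0. Qed.

(** The inverse of [Y_b]: the factors [G^+] are inverted in reverse order. *)
Definition Yinv (b : P n) (word : seq 'I_n.+1) : refl_op S :=
  op_mul (op_prod [seq Gm (aopp ta) | ta <- alpha_seq S word]) (op (of_What (htrans S (- b)))).

Section Inverse.
Variables (b : P n) (pi : What S) (word : seq 'I_n.+1).
Hypothesis hb : htrans S b = hmul pi (swd S (rev word)).
Let Tb := of_What (htrans S b).
Let Tb' := of_What (htrans S (- b)).
Let Tb'Tb : tmr Tb' * tmr Tb = 1.
Proof. by rewrite tmrM of_What_mul hmul_trans addNr htrans0 tmr1. Qed.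
Lemma YinvE : opr (Yinv b word) = (\prod_(ta <- alpha_seq S word) GmR ta) * tmr Tb'.
Proof.
rewrite /Yinv (oprM (op_prod _)) opr_prod big_map tmrE; congr (_ * _).
by apply: eq_bigr => ta _; apply: GmRE.
Qed.

Lemma Y_Yinv : op_mul (Y pi word) (Yinv b word) = op_one S.
Proof.
apply: opr_inj; apply: etrans (oprM _ _) (etrans _ (esym (opr1 S))).
apply: etrans (congr2 *%R (Y_fact hb) YinvE) _.
rewrite mulrA -[tmr Tb * _ * _]mulrA prod_Gp_Gm mulr1.
by rewrite tmrM of_What_mul hmul_trans subrr htrans0 tmr1.
Qed.
Lemma Yinv_Y : op_mul (Yinv b word) (Y pi word) = op_one S.
Proof.
apply: opr_inj; apply: etrans (oprM _ _) (etrans _ (esym (opr1 S))).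
apply: etrans (congr2 *%R YinvE (Y_fact hb)) _.
by rewrite mulrA -[_ * tmr Tb' * _]mulrA Tb'Tb mulr1 prod_Gm_Gp.
Qed.
Lemma Y_expansion : op_mul (op Tb') (Y pi word) = op_prod (rev [seq Gp ta | ta <- alpha_seq S word]).
Proof.
apply: opr_inj; rewrite (oprM (op Tb')) (Y_fact hb) mulrA -(tmrE Tb') Tb'Tb mul1r.
by rewrite opr_prod -map_rev big_map; apply: eq_bigr => ta _; rewrite GpRE.
Qed.
Lemma Yinv_expansion :
  op_mul (Yinv b word) (op Tb) = op_prod [seq Gm (aopp ta) | ta <- alpha_seq S word].
Proof.
apply: opr_inj; rewrite (oprM (Yinv b word)) YinvE -mulrA -(tmrE Tb) Tb'Tb mulr1.
by rewrite opr_prod big_map; apply: eq_bigr => ta _; rewrite GmRE.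
Qed.
End Inverse.
End Intertwiners.

Section Crossing.
Variables (R : realType) (n : nat) (S : root_system R n).
Local Notation rootT := (seq_sub (roots S)).
Local Notation "''(' x , y ')'" := (form (gram S) x y) (format "''(' x ,  y ')'").
Local Notation al := (simple S).
Local Notation co x i := (simple_coords S x 0 i).
Local Notation th := (theta S).
Local Notation r := (size (nuR S)).
Local Notation E := (ratXt n r).
Implicit Types (a b : rootT) (w : W S) (i : 'I_n) (j : 'I_r) (g : E).

Implicit Types (x y : What S) (ta : aroot S).

(** * Positive affine roots *)

Definition apos ta := (0 < ta.2) || ((ta.2 == 0) && positive ta.1).

Lemma apos_opp ta : apos (aopp ta) = ~~ apos ta.
Proof.
case: ta => a j; rewrite /apos /aopp /= positive_opp oppr_gt0 oppr_eq0.
by case: (ltgtP j 0) => //= ->.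
Qed.

Lemma asimple0 : asimple S ord0 = (opp_root th, 1).
Proof. by rewrite /asimple unlift_none. Qed.
Lemma asimple_lift i : asimple S (lift ord0 i) = (al i, 0).
Proof. by rewrite /asimple liftK. Qed.
Lemma apos_asimple (k : 'I_n.+1) : apos (asimple S k).
Proof.
case: (unliftP ord0 k) => [i ->|->]; first by rewrite asimple_lift /apos /= positive_simple.
by rewrite asimple0.
Qed.

Definition thp a := wpair (rweight th) a.
Lemma thpE a : (thp a)%:~R = '(val th, cor a) :> R.
Proof. by rewrite wpairE wt_rweight. Qed.
Lemma thp_pos a : positive a -> 0 <= thp a.
Proof.
move=> pa; rewrite -(ler_int R) thpE; apply: dominant_pos_cor => //.
exact: theta_dominant_simple.
Qed.
Lemma thp_opp a : thp (opp_root a) = - thp a.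
Proof. exact: wpair_opp. Qed.
Lemma thp_neg a : ~~ positive a -> thp a <= 0.
Proof. by rewrite -positive_opp => /thp_pos; rewrite thp_opp oppr_ge0. Qed.
Lemma thp_th : thp th = 2.
Proof. exact: wpair_self. Qed.
(** So the affine reflection shifts the level of most roots by at most one. *)
Lemma thp_range a : a != th -> a != opp_root th -> (-1 <= thp a <= 1).
Proof.
move=> n1 n2; rewrite -!(ler_int R) thpE.
by case: (pairing_theta_range n1 n2) => ->; apply/andP; split; lra.
Qed.
Lemma thp_refl a : thp (refl_root th a) = - thp a.
Proof.
apply/eqP; rewrite -(eqr_int R) intrN !thpE cor_refl formBr formZr cor_theta theta_short.
have -> : '(cor a, val th) = '(val th, cor a) by rewrite formC.
by apply/eqP; lra.
Qed.

Lemma hact_simple i a (j : int) :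
  hact (srefl (asimple S (lift ord0 i))) (a, j) = (refl_root (al i) a, j).
Proof.
by rewrite asimple_lift hactE sreflE /= scale0r wpair0 addr0 wroot_sr.
Qed.
Lemma hact_zero a (j : int) :
  hact (srefl (asimple S ord0)) (a, j) = (refl_root th a, j + thp a).
Proof.
rewrite asimple0 hactE sreflE /= scale1r rweight_opp wpairN sr_opp wroot_sr.
by rewrite -/(thp _) thp_refl opprK.
Qed.

Lemma refl_theta_pos a : thp a < 0 -> a != opp_root th -> positive (refl_root th a).
Proof.
move=> t0 ne; apply/negPn/negP => /thp_neg; rewrite thp_refl oppr_le0; lia.
Qed.

(** For the affine reflection, a root with negative pairing with theta is itself
    negative, so its level is positive and stays so or drops to 0, where the
    reflected root is positive. *)
Lemma asimple_refl_apos (k : 'I_n.+1) ta : apos ta -> ta != asimple S k ->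
  apos (hact (srefl (asimple S k)) ta).
Proof.
case: (unliftP ord0 k) => [i ->|->]; case: ta => a j.
  rewrite hact_simple asimple_lift /apos /= => /orP[->//|/andP[/eqP -> pa]] ne.
  rewrite ltxx eqxx /=; apply: simple_refl_positive => //.
  by apply: contra ne => /eqP ->.
rewrite hact_zero asimple0 /apos /= => pa ne.
have [ea|n1] := eqVneq a th.
  have j0 : 0 <= j by move: pa => /orP[/ltW//|/andP[/eqP ->]].
  by rewrite ea thp_th; apply/orP; left; lia.
have [ea|n2] := eqVneq a (opp_root th).
  move: pa ne; rewrite ea thp_opp thp_th positive_opp theta_positive andbF orbF => j0 ne.
  have j1 : j != 1 by apply: contra ne => /eqP ->.
  rewrite refl_oppr refl_root_self opp_rootK theta_positive andbT; lia.
have := thp_range n1 n2 => /andP[l1 l2].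
have [t0|t0|t0] := ltgtP (thp a) 0.
- have na : ~~ positive a by apply/negP => /thp_pos; lia.
  rewrite refl_theta_pos // andbT; move: pa; rewrite (negbTE na) andbF orbF; lia.
- have j0 : 0 <= j by move: pa => /orP[/ltW//|/andP[/eqP ->]].
  by apply/orP; left; lia.
- have -> : refl_root th a = a.
    by apply: val_inj; rewrite val_refl_root cor_theta formC form_val_cor -thpE t0 mulr0 scale0r subr0.
  by rewrite t0 addr0.
Qed.

Lemma apos_asimple_refl (k : 'I_n.+1) ta : apos (hact (srefl (asimple S k)) ta) =
  apos ta (+) (ta == asimple S k) (+) (ta == aopp (asimple S k)).
Proof.
set s := srefl _.
have ss t : hact s (hact s t) = t by rewrite -hact_hmul srefl_sq hact1.
have [->|ne] := eqVneq ta (asimple S k).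
  rewrite hact_srefl_self apos_opp apos_asimple /=; case: eqP => // e.
  by have := apos_opp (asimple S k); rewrite -e apos_asimple.
have [->|ne'] := eqVneq ta (aopp (asimple S k)).
  by rewrite hact_opp hact_srefl_self aoppK apos_opp apos_asimple.
rewrite !addbF; have [pa|pa] := boolP (apos ta); first exact: asimple_refl_apos.
apply/negbTE; rewrite -apos_opp -hact_opp; apply: asimple_refl_apos.
  by rewrite apos_opp.
by apply: contra ne' => /eqP <-; rewrite aoppK.
Qed.

(** * Crossing numbers *)

(** [crossD x a] is the least [j] for which [x] keeps the affine root [(a, j)]
    positive; [crossN x a] counts with sign the hyperplanes orthogonal to [a]
    between the fundamental alcove and its image under the inverse of [x]. *)
Definition crossD x a : int := - wpair x.1 (wroot x.2 a) + (~~ positive (wroot x.2 a))%:Z.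
Definition crossN x a : int := crossD x a - (~~ positive a)%:Z.

Lemma apos_hact x a (j : int) : apos (hact x (a, j)) = (crossD x a <= j).
Proof.
rewrite hactE /apos /crossD /=.
by case: (positive _) => /=; rewrite ?andbT ?andbF ?orbF; lia.
Qed.
Lemma crossD_opp x a : crossD x (opp_root a) = 1 - crossD x a.
Proof.
rewrite /crossD wroot_opp wpair_opp positive_opp; case: (positive _) => /=; lia.
Qed.
Lemma crossN_opp x a : crossN x (opp_root a) = - crossN x a.
Proof. by rewrite /crossN crossD_opp positive_opp; case: (positive _) => /=; lia. Qed.
Lemma crossN1 a : crossN (hone S) a = 0.
Proof. by rewrite /crossN /crossD /= wroot1 wpair0 oppr0 add0r subrr. Qed.
Lemma crossN_trans (b : P n) a : crossN (htrans S b) a = wpair b a.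
Proof. by rewrite /crossN /crossD /= wroot1 wpairN opprK addrK. Qed.

Lemma opp_root_neq a : (a == opp_root a) = false.
Proof.
by apply/eqP => e; have := positive_opp a; rewrite -e; case: (positive a).
Qed.

Section Step.
Variables (x : What S) (k : 'I_n.+1) (be : rootT) (kk : int).
Hypothesis e : hact x (be, kk) = asimple S k.

Lemma crossD_wall : crossD x be = kk.
Proof.
move: e; rewrite hactE /crossD; case: (unliftP ord0 k) => [i|] ->.
  by rewrite asimple_lift => -[-> h]; rewrite positive_simple /=; lia.
by rewrite asimple0 => -[-> h]; rewrite positive_opp theta_positive /=; lia.
Qed.
Lemma crossN_wall : positive be -> crossN x be = kk.
Proof. by rewrite /crossN crossD_wall => ->; rewrite subr0. Qed.

(** A simple reflection changes the sign of only two opposite affine roots, which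
    here come from [(be, kk)] and its opposite. *)
Lemma crossN_step a : crossN (hmul (srefl (asimple S k)) x) a =
  crossN x a + (a == be)%:Z - (a == opp_root be)%:Z.
Proof.
have H (j : int) : (crossD (hmul (srefl (asimple S k)) x) a <= j) =
    (crossD x a <= j) (+) ((a == be) && (j == kk)) (+) ((a == opp_root be) && (j == - kk)).
  rewrite -!apos_hact hact_hmul apos_asimple_refl -{1}e -e -hact_opp.
  by rewrite !(inj_eq (can_inj (hactK x))) /aopp !xpair_eqE.
suff D : crossD (hmul (srefl (asimple S k)) x) a =
    crossD x a + (a == be)%:Z - (a == opp_root be)%:Z by rewrite /crossN D addrAC [X in X - _]addrAC.
move: H; set D' := crossD (hmul _ _) a.
have [->|n1] := eqVneq a be.
  rewrite opp_root_neq crossD_wall subr0 => H.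
  have e1 : (kk <= kk + 1) = true by lia.
  have e2 : (kk + 1 == kk) = false by lia.
  have := H kk; have := H (kk + 1); rewrite e1 e2 lexx eqxx /= => h1 h2.
  by move/idP: h1; move/negbT: h2; lia.
have [->|n2] := eqVneq a (opp_root be).
  rewrite crossD_opp crossD_wall /= => H.
  have e1 : (1 - kk <= - kk - 1) = false by lia.
  have e2 : (- kk - 1 == - kk) = false by lia.
  have e3 : (1 - kk <= - kk) = false by lia.
  have := H (- kk); have := H (- kk - 1); rewrite e1 e2 e3 eqxx /= => h1 h2.
  by move/idP: h2; move/negbT: h1; lia.
rewrite /= addr0 subr0 => H.
have e1 : (crossD x a <= crossD x a - 1) = false by lia.
have := H (crossD x a); have := H (crossD x a - 1); rewrite e1 lexx /= => h1 h2.
by move/idP: h2; move/negbT: h1; lia.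
Qed.

End Step.

(** * The pair inequality *)

Section Pair.
Variables (x : What S) (k : 'I_n.+1) (be : rootT) (kk : int).
Hypothesis e : hact x (be, kk) = asimple S k.
Hypothesis pbe : positive be.

Variable mu : rootT.
Let kap := wpair (rweight be) mu.
Let mu' := opp_root (refl_root be mu).
Hypothesis kap_gt0 : 0 < kap.

Lemma cor_pair a b : cor b + cor (opp_root (refl_root a b)) = (wpair (rweight a) b)%:~R *: cor a.
Proof.
by rewrite cor_opp cor_refl opprB addrCA subrr addr0 wpairE wt_rweight formC.
Qed.
Lemma wpair_pair (u : P n) a b :
  wpair u b + wpair u (opp_root (refl_root a b)) = wpair (rweight a) b * wpair u a.
Proof.
apply/eqP; rewrite -(eqr_int R) intrD intrM !wpairE -formDr cor_pair formZr.
by rewrite wpairE.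
Qed.
Lemma positive_cor_coord a i : positive a -> 0 <= co (cor a) i.
Proof. by move=> /positiveP h; rewrite corE coordsZ mulr_ge0 // invr_ge0 ltW ?nu_gt0. Qed.
(** The coroots of the pair add up to a positive multiple of the coroot of [a], so
    they are not both negative. *)
Lemma pair_pos a b : positive a -> 0 < wpair (rweight a) b ->
  positive b || positive (opp_root (refl_root a b)).
Proof.
move=> pa kp; apply/negPn/negP; rewrite negb_or -!positive_opp opp_rootK.
move=> /andP[p1 p2]; have [i0 c0] := coords_neq0 a.
have c1 : 0 < co (cor a) i0.
  by rewrite corE coordsZ mulr_gt0 ?invr_gt0 ?nu_gt0 // lt0r c0; move/positiveP: pa; apply.
have := congr1 (fun z : 'rV[R]_n => co z i0) (cor_pair a b).
rewrite coordsD [RHS]coordsZ => E.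
have h1 := positive_cor_coord i0 p1; have h2 := positive_cor_coord i0 p2.
rewrite cor_opp coordsN in h1; rewrite cor_opp coordsN in E.
have : 0 < (wpair (rweight a) b)%:~R * co (cor a) i0 by rewrite mulr_gt0 // ltr0z.
lra.
Qed.
Let pos_or : positive mu || positive mu'.
Proof. exact: pair_pos. Qed.

Let v := x.2.
Let wbe : wroot v be = (asimple S k).1.
Proof. by rewrite -e hactE. Qed.
Let kapE : wpair (rweight (wroot v be)) (wroot v mu) = kap.
Proof. by rewrite -wact_rweight wpair_wact. Qed.
Let wmu' : wroot v mu' = opp_root (refl_root (wroot v be) (wroot v mu)).
Proof. by rewrite wroot_opp wroot_refl. Qed.
Let neg_th a : (asimple S k).1 = opp_root th -> 0 < wpair (rweight (wroot v be)) a -> ~~ positive a.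
Proof.
rewrite wbe => -> h; apply/negP => /thp_pos; move: h.
by rewrite rweight_opp wpairN -/(thp a); lia.
Qed.

Let kap_mu' : 0 < wpair (rweight (wroot v be)) (wroot v mu').
Proof.
rewrite wmu'; have := wpair_pair (rweight (wroot v be)) (wroot v be) (wroot v mu).
by rewrite wpair_self kapE; lia.
Qed.

(** The integral parts of the two crossing numbers add up to the same multiple of
    that of [be] ([wpair_pair]), so only signs of roots remain to be compared. As
    the image of [be] is a simple root or [- theta], at most one of the images of
    the pair is negative in the first case, and both are in the second. *)
Lemma cross_pair : kap * kk <= crossN x mu + crossN x mu' /\
  (mu != be -> crossN x mu + crossN x mu' <= kap * (kk + 1)).
Proof.
have kkE : kk = - wpair x.1 (wroot v be) + (~~ positive (wroot v be))%:Z.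
  by rewrite -(crossD_wall e).
have E := wpair_pair x.1 (wroot v be) (wroot v mu).
rewrite -wmu' kapE in E; rewrite /crossN /crossD -/v {}kkE.
set A := wpair x.1 (wroot v mu) in E *; set B := wpair x.1 (wroot v mu') in E *.
set C := wpair x.1 (wroot v be) in E *.
have or1 := pos_or.
case: (unliftP ord0 k) => [i|] ek.
  have wb : wroot v be = al i by rewrite wbe ek asimple_lift.
  rewrite wb positive_simple.
  have [emu|nmu] := eqVneq mu be.
    have kap2 : kap = 2 by rewrite /kap emu wpair_self.
    have emu' : mu' = be by rewrite /mu' emu refl_root_self opp_rootK.
    have AC : A = C by rewrite /A emu.
    have BC : B = C by rewrite /B emu'.
    rewrite AC BC kap2 emu emu' wb positive_simple pbe /=; split=> [|//]; lia.
  have neg1 : positive (wroot v mu') = ~~ positive (wroot v mu).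
    rewrite wmu' wb positive_opp positive_refl_simple.
    have -> : (wroot v mu == al i) = false.
      by rewrite -wb (inj_eq (wroot_inj (w := v))) (negbTE nmu).
    have -> : (wroot v mu == opp_root (al i)) = false.
      apply/eqP => h; move: kap_gt0; rewrite -kapE wb h wpair_opp wpair_self //.
    by rewrite !addbF.
  rewrite neg1 /= negbK; move: E or1.
  by case: (positive mu); case: (positive mu'); case: (positive (wroot v mu)) => //=; nia.
have wb : (asimple S k).1 = opp_root th by rewrite ek asimple0.
have n1 : ~~ positive (wroot v mu) by apply: neg_th => //; rewrite kapE.
have n2 : ~~ positive (wroot v mu') := neg_th wb kap_mu'.
have n3 : ~~ positive (wroot v be) by rewrite wbe wb positive_opp theta_positive.
have [emu|nmu] := eqVneq mu be.
  have kap2 : kap = 2 by rewrite /kap emu wpair_self.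
  have emu' : mu' = be by rewrite /mu' emu refl_root_self opp_rootK.
  rewrite n1 n2 n3 emu' emu pbe /=; split=> [|//].
  by move: E; rewrite kap2; lia.
have kap1 : kap <= 1.
  have -> : kap = - thp (wroot v mu) by rewrite -kapE wbe wb rweight_opp wpairN.
  have nth : wroot v mu != th.
    by apply/eqP => h; move: n1; rewrite h theta_positive.
  have nth' : wroot v mu != opp_root th.
    by rewrite -wb -wbe (inj_eq (wroot_inj (w := v))).
  by have /andP[] := thp_range nth nth'; lia.
have kap_1 : kap = 1 by lia.
rewrite n1 n2 n3 /=; move: E or1; rewrite kap_1.
by case: (positive mu); case: (positive mu') => //= E _; split; lia.
Qed.

End Pair.

(** * The stabilizer of the simple affine roots *)

Lemma hact_val x ta : val (hact x ta).1 = wvec x.2 (val ta.1).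
Proof. by rewrite wvec_root. Qed.
Lemma hact_level x ta : nu (hact x ta).1 * (hact x ta).2%:~R =
  nu ta.1 * ta.2%:~R + '(wvec x.2 (val ta.1), wt S x.1).
Proof.
rewrite nu_hact hactE /= intrD mulrDr wpairE; congr (_ + _).
by rewrite -(nu_wroot x.2) -form_val_cor formC -wvec_root.
Qed.

(** The level, scaled by [nu a], is the coefficient of [alpha_0]; replacing it by
    theta in the finite part leaves nonnegative coefficients because theta
    dominates every coroot. *)
Lemma apos_comb ta : apos ta -> exists c : 'I_n.+1 -> R, [/\ forall k, 0 <= c k,
  val ta.1 = \sum_k c k *: val (asimple S k).1 &
  nu ta.1 * ta.2%:~R = \sum_k c k * (nu (asimple S k).1 * (asimple S k).2%:~R)].
Proof.
case: ta => a j; rewrite /apos /= => pa.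
exists (fun k => if unlift ord0 k is Some i then co (val a) i + nu a * j%:~R * co (val th) i
                 else nu a * j%:~R); split=> [k||].
- have j0 : 0 <= (j%:~R : R).
    by rewrite ler0z; move: pa => /orP[/ltW//|/andP[/eqP ->]].
  case: (unliftP ord0 k) => [i|] _; last by rewrite mulr_ge0 // ltW ?nu_gt0.
  have t0 : 0 <= co (val th) i by move/positiveP: (theta_positive S).
  have [/positiveP p|np] := boolP (positive a).
    by rewrite addr_ge0 // mulr_ge0 // mulr_ge0 // ltW ?nu_gt0.
  have j1 : 1 <= (j%:~R : R).
    by rewrite -[1]/(1%:~R) ler_int; move: pa; rewrite (negbTE np) andbF orbF; lia.
  have := theta_ge_cor (opp_root a) i.
  rewrite cor_opp coordsN corE coordsZ => h.
  have n0 := nu_gt0 a.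
  have {}h : - co (val a) i <= nu a * co (val th) i.
    by rewrite -ler_pdivrMl // mulrN.
  have : nu a * co (val th) i <= nu a * j%:~R * co (val th) i.
    by rewrite -mulrA ler_pM2l // ler_peMl.
  by rewrite addrC -subr_ge0 in h *; lra.
- rewrite big_ord_recl unlift_none asimple0 [val (opp_root th, _).1]val_opp_root.
  under eq_bigr => i _ do rewrite liftK asimple_lift scalerDl -scalerA.
  rewrite big_split /= -scaler_sumr -!coords_eq.
  by rewrite scalerN addrCA addNr addr0.
- rewrite big_ord_recl unlift_none asimple0 /= nu_opp nu_theta mulr1 mulr1.
  by rewrite big1 ?addr0 // => i _; rewrite liftK asimple_lift /= mulr0 mulr0.
Qed.

Lemma comb_apos ta (c : 'I_n.+1 -> R) (s : 'I_n.+1 -> 'I_n.+1) :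
  (forall k, 0 <= c k) -> val ta.1 = \sum_k c k *: val (asimple S (s k)).1 ->
  nu ta.1 * ta.2%:~R = \sum_k c k * (nu (asimple S (s k)).1 * (asimple S (s k)).2%:~R) ->
  apos ta.
Proof.
case: ta => a j c0; rewrite [(a, j).1]/= [(a, j).2]/= => ea ej.
have t0 k : 0 <= c k * (nu (asimple S (s k)).1 * (asimple S (s k)).2%:~R).
  rewrite mulr_ge0 // mulr_ge0 ?(ltW (nu_gt0 _)) // ler0z.
  by case: (unliftP ord0 (s k)) => [i|] ->; rewrite ?asimple_lift ?asimple0.
have : 0 <= nu a * j%:~R by rewrite ej sumr_ge0.
rewrite pmulr_rge0 ?nu_gt0 // ler0z le0r => /orP[/eqP j0|j0]; last by rewrite /apos j0.
rewrite /apos /= j0 ltxx eqxx /=; apply/positiveP => i.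
have z k : c k * (nu (asimple S (s k)).1 * (asimple S (s k)).2%:~R) = 0.
  apply/eqP; move: ej; rewrite j0 mulr0 => /esym/eqP.
  by rewrite psumr_eq0 => [/allP/(_ k (mem_index_enum k))|k' _].
rewrite ea (big_morph (fun y : 'rV[R]_n => co y i) (id1 := 0) (op1 := +%R)); first last.
- by rewrite -(scale0r 0) coordsZ mul0r.
- by move=> y y'; rewrite coordsD.
apply: sumr_ge0 => k _; rewrite coordsZ; have := z k.
case: (unliftP ord0 (s k)) => [i'|] ->.
  by rewrite asimple_lift [(_, _).1]/= coords_simple mulr_ge0 ?ler0n.
by rewrite asimple0 /= nu_opp nu_theta !mulr1 => ->; rewrite mul0r.
Qed.

(** A permutation of the simple affine roots preserves their nonnegative span. *)
Lemma Pi_apos x ta : in_Pi x -> apos (hact x ta) = apos ta.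
Proof.
move=> xPi; have [s hs] := fin_all_exists xPi.
have fwd t : apos t -> apos (hact x t).
  move=> /apos_comb[c [c0 e1 e2]]; apply: (comb_apos (c := c) (s := s)) => //.
    rewrite hact_val e1; under [RHS]eq_bigr => k _ do rewrite -hs hact_val.
    rewrite (big_morph (wvec x.2) (wvecD x.2) (wvec0 x.2)).
    by apply: eq_bigr => k _; rewrite wvecZ.
  rewrite hact_level e1 e2; under [RHS]eq_bigr => k _ do rewrite -hs hact_level mulrDr.
  rewrite big_split /=; congr (_ + _).
  rewrite (big_morph (wvec x.2) (wvecD x.2) (wvec0 x.2)) form_suml.
  by apply: eq_bigr => k _; rewrite wvecZ formZl.
apply/idP/idP; last exact: fwd.
by apply: contraTT; rewrite -!apos_opp -hact_opp; apply: fwd.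
Qed.

Lemma crossN_Pi x y a : in_Pi x -> crossN (hmul x y) a = crossN y a.
Proof.
move=> xPi; rewrite /crossN; congr (_ - _).
have H (j : int) : (crossD (hmul x y) a <= j) = (crossD y a <= j).
  by rewrite -!apos_hact hact_hmul Pi_apos.
by apply/eqP; rewrite eq_le H lexx -H lexx.
Qed.

(** * Reduced words *)

(** The exchange condition: the simple root becomes negative at a letter of [l]
    whose simple root it has reached, and this letter cancels against [k]. *)
Lemma exchange (l : seq 'I_n.+1) (k : 'I_n.+1) : ~~ apos (hact (swd S l) (asimple S k)) ->
  exists2 l' : seq 'I_n.+1, swd S (rcons l k) = swd S l' & (size l' < size l)%N.
Proof.
elim: l => [|m l IH]; first by rewrite hact1 apos_asimple.
have E : swd S (m :: l) = hmul (srefl (asimple S m)) (swd S l) by [].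
rewrite E hact_hmul; have [pl|nl] := boolP (apos (hact (swd S l) (asimple S k))).
  rewrite apos_asimple_refl pl; have [e|ne] := eqVneq (hact (swd S l) (asimple S k)) (asimple S m).
    move=> _; exists l => //; rewrite rcons_cons -[LHS]/(hmul _ (swd S (rcons l k))).
    by rewrite -cats1 swd_cat swd1 hmul_srefl e hmulA srefl_sq hmul1x.
  case: eqP => // e _; move: pl; rewrite e apos_opp apos_asimple //.
move=> _; have [l' e s'] := IH nl; exists (m :: l') => //.
by rewrite rcons_cons -[LHS]/(hmul _ (swd S (rcons l k))) e.
Qed.

Lemma dominant_pair (b : P n) a : dominant b -> positive a -> 0 <= wpair b a.
Proof.
move=> db pa; rewrite -(ler_int R) wpairE; apply: dominant_pos_cor => // i.
by rewrite form_wt_simple ler0z.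
Qed.

Section Reduced.
Variables (b : P n) (pi : What S) (word : seq 'I_n.+1).
Hypotheses (db : dominant b) (hw : reduced_decomposition (htrans S b) pi word).

Lemma decompE : htrans S b = hmul pi (swd S (rev word)).
Proof. by case: hw => -[]. Qed.

(** By minimality and exchange the affine root is positive and [b] makes it
    negative. As the translation by a dominant [b] lowers the level of
    positive roots and raises that of negative ones, the finite part is
    positive. *)
Lemma reduced_positive (w1 w2 : seq 'I_n.+1) (k : 'I_n.+1) : word = w1 ++ k :: w2 ->
  positive (hact (swd S w1) (asimple S k)).1.
Proof.
move=> ew; have [[piP e] minw] := hw.
have e' : htrans S b = hmul pi (swd S (rev word)) := e.
have shorter (l : seq 'I_n.+1) : swd S (rev l) = swd S (rev word) -> (size word <= size l)%N.
  by move=> h; apply: (minw pi); split=> //; rewrite e' -h.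
have p1 : apos (hact (swd S w1) (asimple S k)).
  apply: contraT => /exchange[l' h sl].
  have := shorter (l' ++ w2); rewrite ew size_cat /= size_cat.
  rewrite -cat_rcons !rev_cat !swd_cat !swd_rev h => /(_ erefl); lia.
have p2 : apos (hact (swd S (rev w2)) (asimple S k)).
  apply: contraT => /exchange[l' h sl].
  have := shorter (w1 ++ rev l'); rewrite ew size_cat size_cat size_rev /=.
  rewrite !rev_cat revK rev_cons !swd_cat h => /(_ erefl); rewrite size_rev in sl; lia.
set ta := hact (swd S w1) (asimple S k) in p1 *.
have n3 : ~~ apos (hact (htrans S b) ta).
  have -> : hact (htrans S b) ta = aopp (hact pi (hact (swd S (rev w2)) (asimple S k))).
    rewrite e' ew rev_cat rev_cons -cats1 !swd_cat swd1 !hact_hmul /ta (swd_rev S w1) hactK.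
    by rewrite hact_srefl_self !hact_opp.
  by rewrite apos_opp negbK Pi_apos.
apply: contraT => na; case/negP: n3; move: p1 na; case: ta => a j.
rewrite hactE /apos /= wroot1 wpairN => /orP[j0|/andP[_ ->//]] na.
have : 0 <= wpair b (opp_root a) by apply: dominant_pair => //; rewrite positive_opp.
by rewrite wpair_opp => h; apply/orP; left; lia.
Qed.

(** Left multiplication by [pi] preserves crossing numbers. *)
Lemma crossN_final a : crossN (swd S (rev word)) a = wpair b a.
Proof.
have [[piP _] _] := hw.
by rewrite -(crossN_Pi _ _ piP) -decompE crossN_trans.
Qed.
End Reduced.
End Crossing.

Section Orders.
Variables (R : realType) (n : nat) (S : root_system R n).
Local Notation rootT := (seq_sub (roots S)).
Local Notation "''(' x , y ')'" := (form (gram S) x y) (format "''(' x ,  y ')'").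
Local Notation al := (simple S).
Local Notation r := (size (nuR S)).
Local Notation E := (ratXt n r).
Implicit Types (a b : rootT) (w : W S) (i : 'I_n) (j : 'I_r) (g : E).

Implicit Types (x y : What S) (ta : aroot S) (u : W S).

(** * Heights *)

(** Twice the height of a root, counting only the simple roots of length [nu_j]. *)
Definition ht2 j a : int := rhop S (rweight a) 0 j.
Definition two_rho j : 'rV[R]_n :=
  \sum_(a : rootT | positive a && (nu a == nu_val j)) cor a.

Lemma ht2E j a : (ht2 j a)%:~R = '(val a, two_rho j) :> R.
Proof.
rewrite /ht2 mxE rmorph_sum form_sumr; apply: eq_bigr => b _ /=.
by rewrite wpairE wt_rweight.
Qed.
Lemma ht2_sum j a : ht2 j a =
  \sum_(b : rootT | positive b && (nu b == nu_val j)) wpair (rweight a) b.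
Proof. by rewrite /ht2 mxE. Qed.
Lemma ht2_opp j a : ht2 j (opp_root a) = - ht2 j a.
Proof. by rewrite /ht2 rweight_opp rhopN mxE. Qed.

Lemma refl_root_inj a : injective (refl_root a).
Proof. exact: can_inj (refl_rootK a). Qed.
Lemma wpair_refl a b c : wpair (rweight a) (refl_root b c) = wpair (rweight (refl_root b a)) c.
Proof. by rewrite -[RHS](wpair_wact (sr b)) wact_rweight !wroot_sr refl_rootK. Qed.

(** The simple reflection permutes the other positive roots of a given length,
    whose pairings therefore cancel. *)
Lemma ht2_simple j i : ht2 j (al i) = 2 * (nu (al i) == nu_val j)%:Z.
Proof.
rewrite ht2_sum; set Q := fun b : rootT => (positive b && (nu b == nu_val j)) && (b != al i).
have s0 : \sum_(b | Q b) wpair (rweight (al i)) b = 0.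
  have /eqP : \sum_(b | Q b) wpair (rweight (al i)) b = - \sum_(b | Q b) wpair (rweight (al i)) b.
    rewrite {1}(reindex_inj (refl_root_inj (a := al i))) -sumrN.
    apply: eq_big => [b|b _]; last by rewrite wpair_refl refl_root_self rweight_opp wpairN.
    rewrite /Q nu_refl positive_refl_simple.
    have -> : (refl_root (al i) b == al i) = (b == opp_root (al i)).
      by rewrite -(inj_eq (refl_root_inj (a := al i))) refl_rootK refl_root_self.
    have [->|n1] := eqVneq b (al i); first by rewrite positive_simple opp_root_neq /= !andbF.
    have [->|n2] := eqVneq b (opp_root (al i)); first by rewrite positive_opp positive_simple /= andbF.
    by rewrite !addbF.
  lia.
case: (eqVneq (nu (al i)) (nu_val j)) => [e|ne].
  rewrite (bigD1 (al i)) /=; last by rewrite positive_simple e eqxx.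
  by rewrite s0 wpair_self addr0.
rewrite mulr0 -[RHS]s0; apply: eq_bigl => b; rewrite /Q.
by case: (eqVneq b (al i)) => [->|_]; rewrite ?andbT // (negbTE ne) andbF.
Qed.

Lemma ht2_pos j a : positive a -> 0 <= ht2 j a.
Proof.
move=> /positiveP pa; rewrite -(ler_int R) ht2E (coords_eq S (val a)) form_suml.
apply: sumr_ge0 => i _; rewrite formZl mulr_ge0 // -ht2E ht2_simple ler0z.
by case: (_ == _).
Qed.
Lemma ht2_neg j a : ~~ positive a -> ht2 j a <= 0.
Proof. by rewrite -positive_opp => /(ht2_pos j); rewrite ht2_opp oppr_ge0. Qed.

Lemma ht2_refl j a b : (ht2 j (refl_root b a))%:~R =
  (ht2 j a)%:~R - '(val a, cor b) * (ht2 j b)%:~R :> R.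
Proof. by rewrite !ht2E val_refl_root formBl formZl. Qed.

(** A root of length [nu_j] descends to a simple root of the same length. *)
Lemma ht2_ge2 j a : positive a -> nu a = nu_val j -> 2 <= ht2 j a.
Proof.
elim/pos_root_ind=> {a} [i e|a i pa _ ai IH e]; first by rewrite ht2_simple e eqxx.
have := IH; rewrite nu_refl => /(_ e); rewrite -!(ler_int R) ht2_refl => h.
apply: le_trans h _; rewrite gerBl mulr_ge0 ?(ltW ai) // ler0z.
exact/ht2_pos/positive_simple.
Qed.

(** * Crossing numbers in a rotated chamber *)

Definition crossS j x u : int :=
  \sum_(a : rootT | positive a && (nu a == nu_val j)) crossN x (wroot u^-1%g a).

Lemma crossS1 j u : crossS j (hone S) u = 0.
Proof. by rewrite /crossS big1 // => a _; rewrite crossN1. Qed.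

Definition sgr a : int := if positive a then 1 else -1.
Lemma sgrE a : sgr a = (positive a)%:Z - (positive (opp_root a))%:Z.
Proof. by rewrite /sgr positive_opp; case: (positive a). Qed.

Lemma crossS_trans j x (b : P n) u : (forall a, crossN x a = wpair b a) ->
  crossS j x u = rhop S (wact u b) 0 j.
Proof.
move=> e; rewrite mxE; apply: eq_bigr => a _.
by rewrite e -(wpair_wact u) wrootVK.
Qed.

(** In this section [be] is the finite part of the affine root of the next letter
    [k], [x] is the product of the letters so far and [u] the chamber. *)
Section KeyInequality.
Variables (x : What S) (k : 'I_n.+1) (be : rootT) (kk : int).
Hypothesis e : hact x (be, kk) = asimple S k.
Hypothesis pbe : positive be.
Variables (j : 'I_r) (u : W S).
Let rt := wroot u be.
Let del : int := (nu be == nu_val j)%:Z.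
Let x' := hmul (srefl (asimple S k)) x.

Lemma crossS_step : crossS j x' u = crossS j x u + del * sgr rt.
Proof.
rewrite /crossS (eq_bigr (fun a => crossN x (wroot u^-1%g a) +
    ((a == rt)%:Z - (a == opp_root rt)%:Z))); last first.
  move=> a _; rewrite (crossN_step e) addrA.
  by rewrite !(can2_eq (wrootVK u) (wrootK u)) wroot_opp.
rewrite big_split /=; congr (_ + _); rewrite sumrB.
have s1 (c : rootT) : \sum_(a | positive a && (nu a == nu_val j)) (a == c)%:Z =
    (positive c && (nu c == nu_val j))%:Z.
  case: (boolP (positive c && (nu c == nu_val j))) => pc.
    rewrite (bigD1 c) //= eqxx big1 ?addr0 // => a /andP[_ /negbTE ->] //.
  by rewrite big1 // => a pa; case: eqP => // ea; move: pc; rewrite -ea pa.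
rewrite !s1 sgrE nu_opp nu_wroot /del.
by case: (nu be == _); rewrite ?andbF ?andbT ?mul1r ?mul0r.
Qed.

Let u' := wcomp (sr rt) u.
Let ee a : int := (positive a)%:Z - (positive (refl_root rt a))%:Z.
Let kp a : int := wpair (rweight rt) a.
Let nn a : int := crossN x (wroot u^-1%g a).

Let sum_pos (F : rootT -> int) :
  \sum_(a | positive a && (nu a == nu_val j)) F a =
  \sum_(a | nu a == nu_val j) (positive a)%:Z * F a.
Proof.
rewrite big_mkcondl; apply: eq_bigr => a _.
by case: (positive a); rewrite ?mul1r ?mul0r.
Qed.
Let sum_refl (F : rootT -> int) : \sum_(a | nu a == nu_val j) F a =
  \sum_(a | nu a == nu_val j) F (refl_root rt a).
Proof.
rewrite (reindex_inj (refl_root_inj (a := rt))).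
by apply: eq_bigl => a; rewrite nu_refl.
Qed.
Let sum_orefl (F : rootT -> int) : \sum_(a | nu a == nu_val j) F a =
  \sum_(a | nu a == nu_val j) F (opp_root (refl_root rt a)).
Proof.
have inj : injective (fun a => opp_root (refl_root rt a)).
  by move=> a b /(can_inj (@opp_rootK _ _ S))/refl_root_inj.
by rewrite (reindex_inj inj); apply: eq_bigl => a; rewrite nu_opp nu_refl.
Qed.

(** [ee] is 0 unless the reflection changes the sign of the root. Averaging over
    the involution [a |-> - s_rt(a)], which preserves [ee], pairs the roots. *)
Let cross_diff : 2 * (crossS j x u - crossS j x u') =
  \sum_(a | nu a == nu_val j) ee a * (nn a + nn (opp_root (refl_root rt a))).
Proof.
have E : crossS j x u - crossS j x u' = \sum_(a | nu a == nu_val j) ee a * nn a.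
  rewrite /crossS !sum_pos [X in _ - X]sum_refl -sumrB; apply: eq_bigr => a _.
  rewrite /ee mulrBl; congr (_ - _ * crossN x _).
  by rewrite /u' wcomp_inv sr_inv wroot_comp wroot_sr refl_rootK.
rewrite mulr_natl mulr2n {1}E E [X in _ + X]sum_orefl -big_split; apply: eq_bigr => a _.
have E2 : ee (opp_root (refl_root rt a)) = ee a.
  rewrite /ee refl_oppr refl_rootK !positive_opp.
  by case: (positive a); case: (positive _).
by rewrite [RHS]mulrDr -E2.
Qed.
Let ht_diff : 2 * ht2 j rt = \sum_(a | nu a == nu_val j) ee a * kp a.
Proof.
rewrite ht2_sum sum_pos mulr_natl mulr2n; apply/esym.
rewrite (eq_bigr (fun a => (positive a)%:Z * kp a - (positive (refl_root rt a))%:Z * kp a)); last first.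
  by move=> a _; rewrite mulrBl.
rewrite sumrB [X in _ - X]sum_refl -sumrN; congr (_ + _); apply: eq_bigr => a _.
by rewrite refl_rootK /kp wpair_refl refl_root_self rweight_opp wpairN mulrN opprK.
Qed.

Let kp_mu a : wpair (rweight be) (wroot u^-1%g a) = kp a.
Proof. by rewrite -(wpair_wact u) wact_rweight wrootVK. Qed.
Let nn_mu' a : nn (opp_root (refl_root rt a)) =
  crossN x (opp_root (refl_root be (wroot u^-1%g a))).
Proof. by rewrite /nn wroot_opp wroot_refl /rt wrootK. Qed.

Let kp_pair_sym a : (0 < kp a) = (0 < '(val a, cor rt)).
Proof.
rewrite -(ltr0z R) wpairE wt_rweight; rewrite -(pmulr_rgt0 _ (nu_gt0 a)) -form_val_cor formC.
by rewrite form_val_cor pmulr_rgt0 ?nu_gt0.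
Qed.

Let ee_pos_kp a : positive a -> ~~ positive (refl_root rt a) ->
  if positive rt then 0 < kp a else kp a < 0.
Proof.
have gen b : positive b -> positive a -> ~~ positive (refl_root b a) -> 0 < '(val a, cor b).
  move=> /positiveP pb /positiveP pa; rewrite ltNge; apply: contra => h.
  apply/positiveP => i; rewrite val_refl_root coordsB coordsZ.
  by rewrite subr_ge0 (le_trans _ (pa i)) // mulr_le0_ge0.
move=> pa na; case: (boolP (positive rt)) => prt.
  by rewrite kp_pair_sym gen.
rewrite -oppr_gt0 /kp -wpairN -rweight_opp.
rewrite -(ltr0z R) wpairE wt_rweight -(pmulr_rgt0 _ (nu_gt0 a)) -form_val_cor formC.
rewrite form_val_cor pmulr_rgt0 ?nu_gt0 //; apply: gen => //.
  by rewrite positive_opp.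
by rewrite refl_root_opp.
Qed.

Let pair_sum a : int := nn a + nn (opp_root (refl_root rt a)).
Let pair_sum_opp a : pair_sum (opp_root a) = - pair_sum a.
Proof.
rewrite /pair_sum /nn refl_oppr !wroot_opp !crossN_opp; lia.
Qed.
Let kp_opp a : kp (opp_root a) = - kp a.
Proof. exact: wpair_opp. Qed.
Let ee_opp a : ee (opp_root a) = - ee a.
Proof. by rewrite /ee refl_oppr !positive_opp; case: (positive a); case: (positive _). Qed.

(** Where [ee] is not 0, the root or its opposite is positive and becomes negative. *)
Let ee_bound (F G : rootT -> int) :
  (forall a, F (opp_root a) = - F a) -> (forall a, G (opp_root a) = - G a) ->
  (forall a, positive a -> ~~ positive (refl_root rt a) -> F a <= G a) ->
  forall a, ee a * F a <= ee a * G a.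
Proof.
move=> Fo Go h a; case: (boolP (positive a)) => pa.
  case: (boolP (positive (refl_root rt a))) => pr; first by rewrite /ee pa pr subrr !mul0r.
  by rewrite /ee pa (negbTE pr) subr0 !mul1r h.
case: (boolP (positive (refl_root rt a))) => pr.
  have := h (opp_root a); rewrite refl_oppr !positive_opp pa pr Fo Go => /(_ isT isT).
  by rewrite /ee (negbTE pa) pr /= sub0r !mulN1r.
by rewrite /ee (negbTE pa) (negbTE pr) subrr !mul0r.
Qed.

(** The exponent of [tau_j] in the reflection summand of an intertwiner: the three
    terms come from [t^{-1/2}], from the translation part of the affine reflection
    and from the denominator of [gaff]. *)
Definition gexp : int :=
  - del - kk * ht2 j rt - (if positive rt then 0 else ht2 j rt).

(** If [rt] is negative, the upper bound of [cross_pair] is used; for the pair of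
    [rt] itself the sum is smaller than this bound by 2, which [ind] records and
    which yields the terms with [del]. *)
Lemma key_inequality : - crossS j x' u <= gexp - crossS j x u'.
Proof.
rewrite crossS_step /gexp /sgr; case: (boolP (positive rt)) => prt.
  suff : 2 * kk * ht2 j rt <= 2 * (crossS j x u - crossS j x u') by lia.
  rewrite mulrAC ht_diff cross_diff mulr_suml; apply: ler_sum => a _.
  rewrite -mulrA; move: a; apply: ee_bound => [a|a|a pa na].
  - by rewrite kp_opp mulNr.
  - exact: pair_sum_opp.
  have := ee_pos_kp pa na; rewrite prt -kp_mu => h.
  by have [h1 _] := cross_pair e pbe h; rewrite nn_mu'.
suff : 2 * (kk + 1) * ht2 j rt + 4 * del <= 2 * (crossS j x u - crossS j x u') by lia.
pose ind a : int := (a == opp_root rt)%:Z - (a == rt)%:Z.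
have indE : \sum_(a | nu a == nu_val j) ee a * ind a = 2 * del.
  have ert : ee rt = -1 by rewrite /ee refl_root_self positive_opp (negbTE prt).
  have eort : ee (opp_root rt) = 1 by rewrite ee_opp ert opprK.
  case: (boolP (nu be == nu_val j)) => nj; last first.
    rewrite /del (negbTE nj) mulr0 big1 // => a na; rewrite /ind.
    have -> : (a == rt) = false.
      by apply/eqP => ea; move: na; rewrite ea nu_wroot (negbTE nj).
    have -> : (a == opp_root rt) = false.
      by apply/eqP => ea; move: na; rewrite ea nu_opp nu_wroot (negbTE nj).
    by rewrite subrr mulr0.
  rewrite (bigD1 rt) /=; last by rewrite nu_wroot.
  rewrite (bigD1 (opp_root rt)) /=; last first.
    by rewrite nu_opp nu_wroot nj eq_sym opp_root_neq.
  rewrite big1 ?addr0 => [|a /andP[/andP[_ n1] n2]].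
    rewrite ert eort /ind !eqxx opp_root_neq eq_sym opp_root_neq /del nj; lia.
  by rewrite /ind (negbTE n1) (negbTE n2) subrr mulr0.
have -> : 2 * (kk + 1) * ht2 j rt + 4 * del =
    \sum_(a | nu a == nu_val j) ee a * (kp a * (kk + 1) + 2 * ind a).
  rewrite (eq_bigr (fun a => ee a * kp a * (kk + 1) + 2 * (ee a * ind a))); last first.
    by move=> a _; ring.
  rewrite big_split /= -mulr_suml -ht_diff -mulr_sumr indE; ring.
rewrite cross_diff; apply: ler_sum => a _; move: a; apply: ee_bound => [a|a|a pa na].
- rewrite kp_opp /ind (can2_eq (@opp_rootK _ _ S) (@opp_rootK _ _ S)) opp_rootK.
  by rewrite (can2_eq (@opp_rootK _ _ S) (@opp_rootK _ _ S)); ring.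
- exact: pair_sum_opp.
have := ee_pos_kp pa na; rewrite (negbTE prt) => kneg.
have a_ne : (a == rt) = false by apply/eqP => ea; move: pa; rewrite ea (negbTE prt).
have kpos : 0 < wpair (rweight be) (wroot u^-1%g (opp_root a)) by rewrite kp_mu kp_opp oppr_gt0.
have [_ h2] := cross_pair e pbe kpos.
have [ea|nea] := eqVneq a (opp_root rt).
  rewrite /ind a_ne ea eqxx subr0 mulr1 refl_oppr refl_root_self opp_rootK.
  rewrite /nn wroot_opp /rt wrootK crossN_opp (crossN_wall e pbe).
  by rewrite /kp wpair_opp wpair_self; lia.
have ne : wroot u^-1%g (opp_root a) != be.
  apply: contra nea => /eqP h; apply/eqP.
  by rewrite /rt -h wrootVK opp_rootK.
move: (h2 ne); rewrite -nn_mu' kp_mu kp_opp -/(nn (opp_root a)) -/(pair_sum _) pair_sum_opp.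
by rewrite /ind a_ne (negbTE nea) /pair_sum; lia.
Qed.

End KeyInequality.
End Orders.


(** * Orders and limits at the origin *)

Lemma bigmin_attained (T : eqType) (f : T -> nat) (B : nat) (s : seq T) : s != [::] ->
  (forall m, m \in s -> (f m <= B)%N) ->
  exists2 m, m \in s & f m = \big[minn/B]_(m' <- s) f m'.
Proof.
elim: s => // m s IH _ le; rewrite big_cons.
have [->|ne] := eqVneq s [::].
  exists m; first exact: mem_head.
  by rewrite big_nil; apply/esym/minn_idPl/le/mem_head.
have [m' m's <-] := IH ne (fun m' h => le m' (mem_behead (s := m :: s) h)).
case: (leqP (f m) (f m')) => h.
  by exists m; rewrite ?mem_head.
by exists m'; rewrite ?inE ?m's ?orbT.
Qed.
Lemma bigmin_le (T : eqType) (f : T -> nat) (B : nat) (s : seq T) m :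
  m \in s -> (\big[minn/B]_(m' <- s) f m' <= f m)%N.
Proof.
elim: s => // m' s IH; rewrite inE big_cons.
by case/orP=> [/eqP ->|/IH h]; rewrite geq_min ?leqnn ?h ?orbT.
Qed.

Lemma cross_mul (K : fieldType) (a b c d f g : K) : b != 0 -> d != 0 -> g != 0 ->
  a / b = f / g * (c / d) -> a * d * g = b * c * f.
Proof.
move=> b0 d0 g0 h; rewrite -[a](divfK b0) h.
by field; rewrite d0 g0.
Qed.

Lemma inv_neq1 (K : fieldType) (a : K) : a != 1 -> a^-1 != 1.
Proof. by rewrite invr_eq1. Qed.

Section Valuation.
Variables (k : fieldType) (N : nat).
Local Notation F := {fraction {mpoly k[N]}}.
Local Notation tvar := (@tvar k N).
Local Notation tpow := (@tpow k N).
Implicit Types (x y : F) (p d : {mpoly k[N]}) (e f : 'rV[int]_N).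

(** Unlike the order in a single variable, this determines the function up to a
    unit at the origin, so it is easily propagated through products, and for
    nonnegative [e] it gives a limit. *)
Definition has_val e x : Prop := exists p d,
  [/\ p@_0%MM != 0, d@_0%MM != 0 & x = tpow e * (p%:F / d%:F)].

Lemma mcoeff00 p d : (p * d)@_0%MM = p@_0%MM * d@_0%MM.
Proof. exact: (rmorphM (@mcoeff N k 0%MM)). Qed.
Lemma mcoeff0_neq0 p : p@_0%MM != 0 -> p != 0.
Proof. by apply: contraNneq => ->; rewrite mcoeff0. Qed.
Lemma tofrac_neq0 p : p@_0%MM != 0 -> p%:F != 0.
Proof. by move=> h; rewrite tofrac_eq0 mcoeff0_neq0. Qed.

Lemma has_valM e f x y : has_val e x -> has_val f y -> has_val (e + f) (x * y).
Proof.
case=> [p [d [p0 d0 ->]]] [p' [d' [p0' d0' ->]]].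
exists (p * p'), (d * d'); rewrite !mcoeff00 !mulf_neq0 //; split=> //.
by rewrite tpowD !tofracM mulrACA mulf_div.
Qed.
Lemma has_valV e x : has_val e x -> has_val (- e) x^-1.
Proof.
case=> [p [d [p0 d0 ->]]]; exists d, p; split=> //.
by rewrite tpowN invfM invf_div.
Qed.
Lemma has_val_unit p : p@_0%MM != 0 -> has_val 0 p%:F.
Proof.
move=> p0; exists p, 1; rewrite mcoeff1 eqxx oner_neq0; split=> //.
by rewrite tpow0 mul1r tofrac1 divr1.
Qed.
Lemma has_val_const (g : k) : g != 0 -> has_val 0 (g%:MP)%:F.
Proof. by move=> g0; apply: has_val_unit; rewrite mcoeffC eqxx mulr1. Qed.
Lemma has_val1 : has_val 0 1.
Proof. by rewrite -tofrac1; apply: has_val_unit; rewrite mcoeff1 eqxx oner_neq0. Qed.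
Lemma has_val_tpow e : has_val e (tpow e).
Proof.
exists 1, 1; rewrite mcoeff1 eqxx oner_neq0; split=> //.
by rewrite tofrac1 divr1 mulr1.
Qed.
Lemma has_valN e x : has_val e x -> has_val e (- x).
Proof.
case=> [p [d [p0 d0 ->]]]; exists (- p), d; rewrite mcoeffN oppr_eq0; split=> //.
by rewrite tofracN mulNr mulrN.
Qed.
Lemma has_val_neq0 e x : has_val e x -> x != 0.
Proof.
case=> [p [d [p0 d0 ->]]]; rewrite mulf_neq0 ?tpow_neq0 // mulf_neq0 ?tofrac_neq0 //.
by rewrite invr_eq0 tofrac_neq0.
Qed.

(** Either [e] is 0, or the constant term is -1. *)
Lemma has_val_sub1_pos (g : k) e : nonneg e -> (g%:MP)%:F * tpow e != 1 ->
  has_val 0 ((g%:MP)%:F * tpow e - 1).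
Proof.
move=> e0; have [->|en] := eqVneq e 0.
  rewrite tpow0 mulr1 -tofrac1 -mpolyC1 -tofracB -mpolyCB => h; apply: has_val_const.
  by rewrite subr_eq0; apply: contra h => /eqP ->.
move=> _; rewrite (tpow_nonneg e0) -tofracM -tofrac1 -tofracB; apply: has_val_unit.
rewrite mcoeffB mcoeffCM mcoeffX mcoeff1 eqxx (_ : (posexp e == 0%MM) = false).
  by rewrite mulr0 sub0r oppr_eq0 oner_neq0.
apply/negbTE; apply: contra en => /eqP h; apply/eqP; apply: posexp_inj => //.
  by move=> j; rewrite mxE.
by rewrite h; apply/mnmP => j; rewrite mnm0E mnmE mxE.
Qed.
Lemma has_val_monomial (g : k) e : g != 0 -> has_val e ((g%:MP)%:F * tpow e).
Proof.
move=> g0; rewrite -[e in has_val e]add0r; apply: has_valM; last exact: has_val_tpow.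
exact: has_val_const.
Qed.
(** [A - 1 = - A (A^-1 - 1)] reduces to the previous case. *)
Lemma has_val_sub1_neg (g : k) e : g != 0 -> nonneg (- e) ->
  (g%:MP)%:F * tpow e != 1 -> has_val e ((g%:MP)%:F * tpow e - 1).
Proof.
move=> g0 e0 ne; set A := _ * _.
have gF : (g%:MP_[N])%:F != 0 by rewrite tofrac_eq0 mpolyC_eq0.
have AV : A^-1 = (g^-1%:MP)%:F * tpow (- e).
  rewrite /A invfM tpowN; congr (_ * _); apply: (mulfI gF).
  by rewrite divff // -tofracM -mpolyCM divff // mpolyC1 tofrac1.
have A0 : A != 0 by rewrite mulf_neq0 ?tpow_neq0.
have -> : A - 1 = A * - (A^-1 - 1) by rewrite mulrN mulrBr mulr1 divff // opprB.
rewrite -[e in has_val e]addr0; apply: has_valM; first exact: has_val_monomial.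
have ne' : A^-1 != 1 := inv_neq1 ne.
apply: has_valN; move: ne'; rewrite AV => ne'; exact: (has_val_sub1_pos e0 ne').
Qed.

Definition tord (j : 'I_N) p : nat := \big[minn/msize p]_(m <- msupp p) m j.

Lemma tord_attained (j : 'I_N) p : p != 0 -> exists2 m, m \in msupp p & m j = tord j p.
Proof.
move=> p0; apply: bigmin_attained; first by rewrite msupp_eq0.
move=> m h; apply: leq_trans (ltnW (msize_mdeg_lt h)).
by rewrite mdegE (bigD1 j) //= leq_addr.
Qed.
Lemma tord_le (j : 'I_N) p m : m \in msupp p -> (tord j p <= m j)%N.
Proof. exact: bigmin_le. Qed.
Lemma tordP (j : 'I_N) p l : p != 0 ->
  (forall m, m \in msupp p -> (l <= m j)%N) -> (exists2 m, m \in msupp p & m j = l) ->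
  tord j p = l.
Proof.
move=> p0 le [m mp mk]; apply/eqP; rewrite eqn_leq -{1}mk tord_le //=.
by have [m' m'p <-] := tord_attained j p0; apply: le.
Qed.

Lemma tord_mulX (j : 'I_N) p m : p != 0 -> tord j (p * 'X_[m]) = (m j + tord j p)%N.
Proof.
move=> p0; apply: tordP.
- by rewrite mulf_neq0 // mpolyX_neq0.
- move=> m' ; rewrite (perm_mem (msuppMX p m)) => /mapP[m2 m2p ->].
  by rewrite mnmDE leq_add2l tord_le.
- have [m2 m2p h] := tord_attained j p0; exists (m + m2)%MM; last by rewrite mnmDE h.
  by rewrite (perm_mem (msuppMX p m)) map_f.
Qed.

Definition restr (Q : pred 'X_{1..N}) p : {mpoly k[N]} :=
  \sum_(m <- msupp p | Q m) p@_m *: 'X_[m].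
Lemma restrE Q p m : (restr Q p)@_m = if Q m then p@_m else 0.
Proof.
rewrite /restr raddf_sum /=.
rewrite (eq_bigr (fun m' => p@_m' * (m' == m)%:R)); last by move=> m' _; rewrite mcoeffZ mcoeffX.
have [mp|mp] := boolP (m \in msupp p); last first.
  rewrite big_seq_cond big1 => [|m' /andP[m'p _]].
    by move: mp; rewrite -mcoeff_eq0 => /eqP ->; case: ifP.
  by case: eqP m'p mp => [-> -> //|]; rewrite mulr0.
rewrite big_mkcond (bigD1_seq m) ?msupp_uniq //= eqxx mulr1 big1 ?addr0 // => m' /negbTE ->.
by rewrite mulr0; case: ifP.
Qed.
Lemma restr_supp Q p m : m \in msupp (restr Q p) -> Q m /\ m \in msupp p.
Proof. by rewrite !mcoeff_msupp restrE; case: ifP; rewrite ?eqxx. Qed.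
Lemma restr_split Q p : p = restr Q p + restr (predC Q) p.
Proof. by apply/mpolyP => m; rewrite mcoeffD !restrE /=; case: (Q m); rewrite ?addr0 ?add0r. Qed.

(** The terms of least exponent in the product are those of the product of the
    part of least exponent of [p] and the part of [d] without the variable, which
    is not 0 as it contains the constant term. *)
Lemma tord_mul_unit (j : 'I_N) p d : p != 0 -> d@_0%MM != 0 -> tord j (p * d) = tord j p.
Proof.
move=> p0 d0; have dn := mcoeff0_neq0 d0; apply: tordP; first exact: mulf_neq0.
  move=> m /msuppM_le/allpairsP[[m1 m2] /= [h1 h2 ->]].
  by rewrite mnmDE (leq_trans (tord_le j h1)) // leq_addr.
set l := tord j p.
pose p1 := restr (fun m : 'X_{1..N} => m j == l) p; pose d1 := restr (fun m : 'X_{1..N} => m j == 0)%N d.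
have p10 : p1 != 0.
  have [m mp ml] := tord_attained j p0; apply/eqP => h.
  have := restrE (fun m : 'X_{1..N} => m j == l) p m; rewrite -/p1 h mcoeff0 ml eqxx.
  by move=> e; move: mp; rewrite mcoeff_msupp -e eqxx.
have d10 : d1 != 0 by apply: mcoeff0_neq0; rewrite restrE mnm0E eqxx.
have [m mp] : exists m, m \in msupp (p1 * d1).
  have : p1 * d1 != 0 by rewrite mulf_neq0.
  by rewrite -msupp_eq0; case: (msupp _) => // m s _; exists m; rewrite mem_head.
have mj : m j = l.
  have /allpairsP[[m1 m2] /= [/restr_supp[/eqP h1 _] /restr_supp[/eqP h2 _] ->]] := msuppM_le mp.
  by rewrite mnmDE h1 h2 addn0.
exists m => //.
have E : p * d = p1 * d1 + (p1 * restr (predC (fun m : 'X_{1..N} => m j == 0)%N) d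
    + restr (predC (fun m : 'X_{1..N} => m j == l)) p * d).
  by rewrite {1}(restr_split (fun m : 'X_{1..N} => m j == l) p) mulrDl {1}(restr_split (fun m : 'X_{1..N} => m j == 0)%N d) mulrDr addrA.
rewrite mcoeff_msupp E mcoeffD mcoeffD.
have -> : (p1 * restr (predC (fun m : 'X_{1..N} => m j == 0)%N) d)@_m = 0.
  apply/eqP; rewrite mcoeff_eq0; apply/negP.
  move=> /msuppM_le/allpairsP[[m1 m2] /= [/restr_supp[/eqP h1 _] /restr_supp[h2 _] h]].
  by move: mj h2; rewrite h mnmDE h1 /=; lia.
have -> : (restr (predC (fun m : 'X_{1..N} => m j == l)) p * d)@_m = 0.
  apply/eqP; rewrite mcoeff_eq0; apply/negP.
  move=> /msuppM_le/allpairsP[[m1 m2] /= [/restr_supp[h1 h3] h2 h]].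
  by move: mj h1 (tord_le j h3); rewrite h mnmDE -/l /=; lia.
by rewrite !addr0 -mcoeff_msupp.
Qed.

(** The order is read off from one particular fraction. Two representations are
    compared by cross-multiplication, after the monomial has been split into
    positive and negative exponents. *)
Lemma has_val_ord e x (j : 'I_N) : has_val e x ->
  (tord j \n_(repr x))%:Z - (tord j \d_(repr x))%:Z = e 0 j.
Proof.
move=> hx; have x0 := has_val_neq0 hx; case: hx => p [d [p0 d0 xe]].
have b0 := denom_repr_neq0 x; have xab := frac_repr x.
move: (\n_(repr x)) (\d_(repr x)) b0 xab => a b b0 xab.
have a0 : a != 0 by apply: contraNneq x0 => a0; rewrite xab a0 tofrac0 mul0r.
pose ep : 'rV[int]_N := \row_i Num.max (e 0 i) 0.
pose em : 'rV[int]_N := \row_i Num.max (- e 0 i) 0.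
have epos : nonneg ep by move=> i; rewrite mxE le_max lexx orbT.
have eneg : nonneg em by move=> i; rewrite mxE le_max lexx orbT.
have ee : e = ep - em.
  by apply/rowP => i; rewrite !mxE /Num.max; do 2!case: ifP => ?; lia.
have E : a * d * 'X_[posexp em] = b * p * 'X_[posexp ep].
  apply/eqP; rewrite -tofrac_eq !tofracM -!tpow_nonneg //; apply/eqP.
  have bF : b%:F != 0 by rewrite tofrac_eq0.
  have dF := tofrac_neq0 d0; have mF := tpow_neq0 k em.
  move: xe; rewrite xab ee tpowD tpowN => h.
  exact: (cross_mul bF dF mF h).
have := congr1 (tord j) E.
rewrite !tord_mulX ?mulf_neq0 ?(mcoeff0_neq0 p0) ?(mcoeff0_neq0 d0) // !tord_mul_unit //.
rewrite {1}ee !mxE !mnmE !mxE.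
by move: (tord j a) (tord j b) => ta tb; rewrite /Num.max; do 2!case: ifP => ?; lia.
Qed.

Definition flim x (y : k) : Prop := exists p d,
  [/\ d@_0%MM != 0, x = p%:F / d%:F & y = p@_0%MM / d@_0%MM].

Lemma flim_uniq x (y y' : k) : flim x y -> flim x y' -> y = y'.
Proof.
case=> p [d [d0 -> ->]] [p' [d' [d0' /eqP e ->]]]; apply/eqP.
move: e; rewrite !eqr_div ?tofrac_neq0 // -!tofracM tofrac_eq => /eqP e.
by rewrite -!mcoeff00 e.
Qed.
Lemma flim_const (g : k) : flim (g%:MP)%:F g.
Proof.
exists (g%:MP), 1; rewrite mcoeff1 mcoeffC !eqxx oner_neq0; split=> //.
  by rewrite tofrac1 divr1.
by rewrite /= mulr1n mulr1 divr1.
Qed.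
Lemma flim0 : flim 0 0.
Proof. by have := flim_const 0; rewrite mpolyC0 tofrac0. Qed.
Lemma flim1 : flim 1 1.
Proof. by have := flim_const 1; rewrite mpolyC1 tofrac1. Qed.
Lemma flimD x y (a b : k) : flim x a -> flim y b -> flim (x + y) (a + b).
Proof.
case=> p [d [d0 -> ->]] [p' [d' [d0' -> ->]]].
exists (p * d' + p' * d), (d * d'); rewrite mcoeffD !mcoeff00; split.
- exact: mulf_neq0.
- by rewrite addf_div ?tofrac_neq0 // !tofracD !tofracM.
- by rewrite addf_div.
Qed.
Lemma flimM x y (a b : k) : flim x a -> flim y b -> flim (x * y) (a * b).
Proof.
case=> p [d [d0 -> ->]] [p' [d' [d0' -> ->]]].
exists (p * p'), (d * d'); rewrite !mcoeff00 !tofracM !mulf_div; split=> //.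
exact: mulf_neq0.
Qed.
Lemma has_val_lim e x : nonneg e -> has_val e x -> exists y : k, flim x y.
Proof.
move=> e0 [p [d [p0 d0 ->]]]; eexists; exists ('X_[posexp e] * p), d; split=> //.
by rewrite tpow_nonneg // tofracM mulrA.
Qed.

(** Conjugation by a translation is of this kind: it is an automorphism of the
    functions of X, extended trivially to the [t_nu]. *)
Section Coefficients.
Variables (phi : {rmorphism F -> F}) (psi : {rmorphism k -> k}).
Hypothesis phi_const : forall g : k, phi (g%:MP)%:F = ((psi g)%:MP)%:F.
Hypothesis phi_var : forall j, phi (tvar j) = tvar j.
Let coef_morph p : phi p%:F = (map_mpoly psi p)%:F.
Proof.
rewrite /map_mpoly /mmap {1}(mpolyE p) !rmorph_sum; apply: eq_bigr => m _ /=.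
rewrite -mul_mpolyC !rmorphM /= phi_const; congr (_ * _).
rewrite mpolyXE_id /mmap1 !rmorph_prod; apply: eq_bigr => i _ /=.
by rewrite !rmorphXn /= phi_var.
Qed.
Let coef_map p m : (map_mpoly psi p)@_m = psi p@_m.
Proof. exact: mcoeff_map_mpoly. Qed.
Let phi_tpow e : phi (tpow e) = tpow e.
Proof. by rewrite rmorph_prod; apply: eq_bigr => j _; rewrite fmorphXz /= phi_var. Qed.

Lemma has_val_coef e x : has_val e x -> has_val e (phi x).
Proof.
case=> p [d [p0 d0 ->]]; exists (map_mpoly psi p), (map_mpoly psi d).
rewrite !coef_map !fmorph_eq0; split=> //.
by rewrite rmorphM fmorph_div /= phi_tpow !coef_morph.
Qed.
Lemma flim_coef x (y : k) : flim x y -> flim (phi x) (psi y).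
Proof.
case=> p [d [d0 -> ->]]; exists (map_mpoly psi p), (map_mpoly psi d).
by rewrite !coef_map fmorph_eq0 !fmorph_div /= !coef_morph.
Qed.
End Coefficients.

End Valuation.

Section Valuations.
Variables (R : realType) (n : nat) (S : root_system R n).
Local Notation rootT := (seq_sub (roots S)).
Local Notation r := (size (nuR S)).
Local Notation E0 := (ratX n).
Local Notation E := (ratXt n r).
Implicit Types (a b : rootT) (w : W S) (i : 'I_n) (j : 'I_r) (g : E).

Implicit Types (ta : aroot S) (s t : term S) (u : P n).

(** * Orders of the summands *)

Local Notation hv := (@has_val E0 r).

Lemma hv_tmon e : hv e (tmon n e).
Proof. exact: has_val_tpow. Qed.

Lemma hv_sub1_pos (g0 : E0) e : nonneg e -> constt r g0 * tmon n e != 1 ->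
  hv 0 (constt r g0 * tmon n e - 1).
Proof. exact: has_val_sub1_pos. Qed.
Lemma hv_sub1_neg (g0 : E0) e : g0 != 0 -> nonneg (- e) -> constt r g0 * tmon n e != 1 ->
  hv e (constt r g0 * tmon n e - 1).
Proof. exact: has_val_sub1_neg. Qed.

Lemma hv_conj u e g : hv e g -> hv e (conjXt (u, 1%g : W S) g).
Proof.
apply: (@has_val_coef E0 r (conjXt (u, 1%g : W S)) (GammaX S u)).
  exact: conjXt_const.
exact: conjXt_tau.
Qed.

Definition dvec a : 'rV[int]_r := \row_j (nu_val j == nu a)%:Z.
Definition hvec a : 'rV[int]_r := \row_j ht2 j a.

Lemma inv_shift (F : fieldType) (q x m : F) : (q * (x^-1 * m))^-1 = (q * m)^-1 * x.
Proof. by rewrite mulrCA invfM invrK mulrC. Qed.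

Lemma rhop_rweight a : rhop S (rweight a) = hvec a.
Proof. by apply/rowP => j; rewrite [RHS]mxE. Qed.

Lemma kappa_t_half w a : kappa_fun w (t_half a) = tmon n (dvec a).
Proof.
rewrite t_half_tmon rmorph_prod /=; apply: eq_bigr => j _.
by rewrite fmorphXz /= kappa_tau.
Qed.

Lemma kappa_XaffV w ta : exists2 g0 : E0, g0 != 0 &
  kappa_fun w (Xaff ta)^-1 = constt r g0 * tmon n (hvec (wroot w^-1%g ta.1)).
Proof.
exists ((qX S (nu ta.1 * ta.2%:~R) * monX (rweight (wroot w^-1%g ta.1)))^-1).
  by rewrite invr_eq0 mulf_neq0 ?monX_neq0 // fmorph_eq0 qpow_neq0.
rewrite fmorphV XaffE rmorphM /= kappa_q kappa_mon wact_rweight qrhoE rhop_rweight.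
by rewrite fmorphV rmorphM /= inv_shift.
Qed.

Lemma nonneg_hvec a : positive a -> nonneg (hvec a).
Proof. by move=> pa j; rewrite mxE ht2_pos. Qed.
Lemma nonneg_hvecN a : ~~ positive a -> nonneg (- hvec a).
Proof. by move=> pa j; rewrite !mxE oppr_ge0 ht2_neg. Qed.

Lemma kappa_XaffV_neq1 w ta : kappa_fun w (Xaff ta)^-1 != 1.
Proof. by rewrite -(rmorph1 (kappa_fun w)) (inj_eq (fmorph_inj _)) -Xaff_opp Xaff_neq1. Qed.

(** For a negative root the exponents of the monomial are at most 0. *)
Lemma hv_XaffV1 w ta (a := wroot w^-1%g ta.1) :
  hv (if positive a then 0 else hvec a) (kappa_fun w (Xaff ta)^-1 - 1).
Proof.
have := kappa_XaffV_neq1 w ta; have [g0 g0n ->] := kappa_XaffV w ta => ne.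
case: ifP => pa; first by apply: hv_sub1_pos => //; apply: nonneg_hvec.
by apply: hv_sub1_neg => //; apply: nonneg_hvecN; rewrite -/a pa.
Qed.

Lemma t_parE a : t_par a = tmon n (dvec a *+ 2).
Proof. by rewrite /t_par t_half_tmon expr2 mulr2n tmonD. Qed.
Lemma kappa_t_par w a : kappa_fun w (t_par a) = tmon n (dvec a *+ 2).
Proof. by rewrite /t_par rmorphXn /= kappa_t_half expr2 mulr2n tmonD. Qed.

Lemma dvec2E a j : (dvec a *+ 2) 0 j = 2 * (nu_val j == nu a)%:Z.
Proof. by rewrite mulmxnE mxE mulr_natl. Qed.
Lemma dvec2_neq0 a : dvec a *+ 2 != 0.
Proof.
have : nu a \in nuR S by rewrite mem_undup map_f // mem_enum.
rewrite -index_mem => lt; apply/eqP => /rowP /(_ (Ordinal lt)).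
by rewrite dvec2E !mxE /nu_val /= nth_index -?index_mem // eqxx.
Qed.

(** For a positive root the quotient is a unit, so [t^{-1/2}] remains. For a
    negative one the exponents of the two monomials differ by that of [t]; the
    numerator also has exponents at most 0, as a negative root of length [nu_j]
    has [ht2] at most -2. *)
Lemma hv_faff w ta (a := wroot w^-1%g ta.1) :
  hv (\row_j (- ((nu ta.1 == nu_val j)%:Z * sgr a)))
     (kappa_fun w ((t_half ta.1)^-1 * faff ta)).
Proof.
have h1 := hv_XaffV1 w ta.
have [g0 g0n Xe] := kappa_XaffV w ta.
rewrite /faff rmorphM fmorphV fmorph_div !rmorphB rmorphM rmorph1 /= kappa_t_half kappa_t_par.
have h2 : hv (if positive a then 0 else dvec ta.1 *+ 2 + hvec a)
    (tmon n (dvec ta.1 *+ 2) * kappa_fun w (Xaff ta)^-1 - 1).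
  rewrite Xe mulrCA -tmonD.
  have ne : constt r g0 * tmon n (dvec ta.1 *+ 2 + hvec a) != 1.
    move: (Xe); rewrite -/a => Xe'.
    apply/eqP => h.
    have : tmon n (dvec ta.1 *+ 2) * kappa_fun w (Xaff ta)^-1 = 1 by rewrite Xe' mulrCA -tmonD.
    rewrite -(kappa_t_par w) -rmorphM -(rmorph1 (kappa_fun w)) => /fmorph_inj.
    rewrite -Xaff_opp Xaff_lmon mulrCA.
    rewrite t_parE /lmon [tmon _ _ * (_ * _)]mulrCA -tmonD => /eqP; apply/negP.
    by apply: lmon_neq1; rewrite rweight_neq0.
  case: ifP => pa.
    by apply: hv_sub1_pos => // j; rewrite mxE dvec2E [hvec _ _ _]mxE addr_ge0 ?ht2_pos.
  apply: hv_sub1_neg => // j; rewrite 2!mxE dvec2E [hvec _ _ _]mxE oppr_ge0 [nu_val j == _]eq_sym.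
  case: eqP => [e|_]; last by rewrite mulr0 add0r ht2_neg ?pa.
  have : 2 <= ht2 j (opp_root a) by apply: ht2_ge2; rewrite ?positive_opp ?pa // nu_opp nu_wroot e.
  by rewrite ht2_opp; lia.
have := has_valM (has_valV (hv_tmon (dvec ta.1))) (has_valM h2 (has_valV h1)).
congr (hv _ _); apply/rowP => j; rewrite /sgr -/a.
have := dvec2E ta.1 j; case: ifP => _; move: (dvec _ *+ 2) => D; rewrite !mxE ![nu_val j == _]eq_sym; lia.
Qed.

Lemma hv_gaff w ta (a := wroot w^-1%g ta.1) :
  hv (\row_j gexp ta.1 ta.2 j w^-1%g)
     (kappa_fun w ((t_half ta.1)^-1 * gaff ta) * (qrho S (wact w^-1%g (srefl ta).1))^-1).
Proof.
have h1 := has_valN (hv_XaffV1 w ta); rewrite opprB in h1.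
rewrite /gaff rmorphM fmorphV fmorph_div !rmorphB rmorph1 /= kappa_t_half kappa_t_par.
have h2 : hv 0 (tmon n (dvec ta.1 *+ 2) - 1).
  have := @hv_sub1_pos 1 (dvec ta.1 *+ 2); rewrite rmorph1 mul1r; apply.
    by move=> j; rewrite dvec2E.
  have := @lmon_neq1 R n S 1 0 (dvec ta.1 *+ 2); rewrite dvec2_neq0 orbT => /(_ isT).
  by rewrite /lmon monX0 !rmorph1 !mul1r.
have -> : qrho S (wact w^-1%g (ta.2 *: to_weight S (val ta.1))) = tmon n (ta.2 *: hvec a).
  by rewrite qrhoE (wactZ w^-1%g) (wact_rweight w^-1%g ta.1) rhopZ rhop_rweight.
have := has_valM (has_valM (has_valV (hv_tmon (dvec ta.1))) (has_valM h2 (has_valV h1)))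
   (has_valV (hv_tmon (ta.2 *: hvec a))).
congr (hv _ _); apply/rowP => j; rewrite !mxE /gexp -/a [nu ta.1 == _]eq_sym.
by case: ifP => _; rewrite !mxE; lia.
Qed.

(** * Coefficients of the images of terms *)

(** Under kappa each term has a single component at [w], with this coefficient. *)
Definition kcoef w s : E := kappa_fun w s.1 * (qrho S (wact w^-1%g s.2.1))^-1.

Lemma conj_div_qrho u v (g : E) : conjXt (u, 1%g : W S) (g * (qrho S v)^-1) =
  conjXt (u, 1%g : W S) g * (qrho S v)^-1.
Proof.
rewrite rmorphM fmorphV /= qrhoE; congr (_ * _^-1).
by rewrite rmorph_prod; apply: eq_bigr => j _; rewrite fmorphXz /= conjXt_tau.
Qed.
Lemma kcoef_mul w s t : kcoef w (term_mul s t) =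
  kcoef w s * conjXt (wact w^-1%g s.2.1, 1%g : W S) (kcoef (wcomp s.2.2^-1%g w) t).
Proof.
rewrite /kcoef /term_mul /= (rmorphM (kappa_fun w)) /= kappa_conj conj_div_qrho.
rewrite wactD qrhoD -(wact_comp w^-1%g) wcomp_inv invgK invfM.
by rewrite mulrACA.
Qed.

Lemma kappaE A w : kappa A w =
  lin (fun x (g : E) => mkmalgU (wact w^-1%g x.1, x.2) (kcoef w (g, x))) A.
Proof. by rewrite ffunE. Qed.

Section KappaSum.
Variable w : W S.
Let F (x : What S) (g : E) : malg (What S) E :=
  mkmalgU (wact w^-1%g x.1, x.2) (kcoef w (g, x)).
Let F0 x : F x 0 = 0.
Proof. by rewrite /F /kcoef /= rmorph0 mul0r monalg.monalgU0. Qed.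
Let FD x g h : F x (g + h) = F x g + F x h.
Proof. by rewrite /F /kcoef /= rmorphD mulrDl monalg.monalgUD. Qed.
Lemma kappaD A B : kappa (A + B) w = kappa A w + kappa B w.
Proof. apply: etrans (kappaE _ _) (etrans (linD F0 FD A B) _); exact: (congr2 +%R (esym (kappaE A w)) (esym (kappaE B w))). Qed.
Lemma kappa0 : kappa (0 : refl_op S) w = 0.
Proof. rewrite kappaE; exact: (lin0 F0 FD). Qed.
Lemma kappa_op s : kappa (op s) w = mkmalgU (wact w^-1%g s.2.1, s.2.2) (kcoef w s).
Proof. case: s => g x; rewrite kappaE; exact: (linU F0). Qed.
End KappaSum.

Lemma ordw_kcoef w j s : ordw w j s = ordt j (kcoef w s).
Proof. by rewrite /ordw kappa_op monalg.mcoeffUU. Qed.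

Lemma ordw_hv w j s e : hv e (kcoef w s) -> ordw w j s = (e 0 j)%:~R / 2.
Proof.
rewrite ordw_kcoef /ordt => /(has_val_ord j) <-.
by rewrite intrB.
Qed.

Lemma kcoef_trans w (b : P n) : hv (rhop S (wact w^-1%g b)) (kcoef w (of_What (htrans S b))).
Proof.
rewrite /kcoef rmorph1 mul1r wactN qrhoE rhopN tmonN invrK; exact: hv_tmon.
Qed.
End Valuations.

Section Products.
Variables (R : realType) (n : nat) (S : root_system R n).
Local Notation rootT := (seq_sub (roots S)).
Local Notation r := (size (nuR S)).
Local Notation E0 := (ratX n).
Local Notation E := (ratXt n r).
Implicit Types (a b : rootT) (w : W S) (i : 'I_n) (j : 'I_r) (g : E).

Implicit Types (ta : aroot S) (s t : term S) (u : W S) (word : seq 'I_n.+1) (c : seq bool).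
Local Notation hv := (@has_val E0 r).

(** * Orders of the products in the expansions *)

Lemma Gp_product_rcons word (k : 'I_n.+1) c (c0 : bool) : size c = size word ->
  Gp_product S (rcons word k) (rcons c c0) =
  term_mul (Gp_summand c0 (hact (swd S word) (asimple S k))) (Gp_product S word c).
Proof.
move=> sc; rewrite /Gp_product alpha_seq_rcons zip_rcons ?size_alpha_seq //.
by rewrite map_rcons rev_rcons.
Qed.
Lemma term_prod_rcons (l : seq (term S)) s :
  term_prod (rcons l s) = term_mul (term_prod l) s.
Proof.
elim: l => [|t l IH] /=; first by rewrite term_mul1l term_mul1r.
by rewrite IH term_mulA.
Qed.
Lemma Gm_product_rcons word (k : 'I_n.+1) c (c0 : bool) : size c = size word ->
  Gm_product S (rcons word k) (rcons c c0) =
  term_mul (Gm_product S word c) (Gm_summand c0 (aopp (hact (swd S word) (asimple S k)))).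
Proof.
move=> sc; rewrite /Gm_product alpha_seq_rcons zip_rcons ?size_alpha_seq //.
by rewrite map_rcons term_prod_rcons.
Qed.

Lemma rowDE (x y : 'rV[int]_r) j : (x + y) 0 j = x 0 j + y 0 j.
Proof. by rewrite mxE. Qed.
Lemma rowNE (x : 'rV[int]_r) j : (- x) 0 j = - x 0 j.
Proof. by rewrite mxE. Qed.
Lemma kcoef_one w : kcoef w (term_one S) = 1.
Proof. by rewrite /kcoef /= rmorph1 wact0 qrho0 divr1. Qed.

(** The affine roots here are the inversions of the element with this word. *)
Definition positive_word word := forall (w1 w2 : seq 'I_n.+1) (k : 'I_n.+1), word = w1 ++ k :: w2 ->
  positive (hact (swd S w1) (asimple S k)).1.
Lemma positive_word_rcons word (k : 'I_n.+1) : positive_word (rcons word k) ->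
  positive_word word /\ positive (hact (swd S word) (asimple S k)).1.
Proof.
move=> h; split=> [w1 w2 k' e|]; last by apply: (h word [::]); rewrite cats1.
by apply: (h w1 (rcons w2 k)); rewrite e rcons_cat.
Qed.
Lemma swd_rev_rcons word (k : 'I_n.+1) :
  swd S (rev (rcons word k)) = hmul (srefl (asimple S k)) (swd S (rev word)).
Proof. by rewrite rev_rcons. Qed.
Lemma hact_swd_rev word ta : hact (swd S (rev word)) (hact (swd S word) ta) = ta.
Proof. by rewrite swd_rev hactK. Qed.

(** The factor of the last letter stands on the left, so the induction hypothesis
    is used at the component to which its reflection moves [w]. *)
Lemma Gp_product_order word c w : positive_word word -> size c = size word ->
  exists2 e, hv e (kcoef w (Gp_product S word c)) &
    forall j, - crossS j (swd S (rev word)) w^-1%g <= e 0 j.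
Proof.
elim/last_ind: word c w => [|word k IH] c w.
  move=> _ /size0nil ->; have -> : Gp_product S [::] [::] = term_one S by [].
  rewrite kcoef_one; exists 0; first exact: has_val1.
  by move=> j; rewrite crossS1 mxE.
case/positive_word_rcons=> pw pk; case/lastP: c => [|c c0]; first by rewrite size_rcons.
rewrite !size_rcons => -[sc]; rewrite Gp_product_rcons // swd_rev_rcons kcoef_mul.
have h0 := hact_swd_rev word (asimple S k).
move: (hact (swd S word) _) h0 pk => [be kk] h0 /= pk.
case: c0.
  have [e he le] := IH c (wcomp (sr be)^-1%g w) pw sc.
  exists (\row_j gexp be kk j w^-1%g + e).
    by apply: has_valM; [exact: (hv_gaff w (be, kk))|exact: hv_conj].
  move=> j; have := le j; have := key_inequality h0 pk j w^-1%g.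
  rewrite wcomp_inv invgK wcomp_sr rowDE [X in _ -> _ -> _ <= X + _]mxE; lia.
have [e he le] := IH c (wcomp (1%g : W S)^-1%g w) pw sc.
exists (\row_j (- ((nu be == nu_val j)%:Z * sgr (wroot w^-1%g be))) + e).
  apply: has_valM; last exact: hv_conj.
  rewrite /kcoef /= wact0 qrho0 divr1; exact: (hv_faff w (be, kk)).
move=> j; have := le j; rewrite (crossS_step h0) invg1 w1comp rowDE [X in _ -> _ <= X + _]mxE; lia.
Qed.

(** The factor of the last letter stands on the right, so it is seen in the chamber
    moved by the reflections of all previous factors. *)
Lemma Gm_product_order word c w (p := Gm_product S word c) :
  positive_word word -> size c = size word ->
  exists2 e, hv e (kcoef w p) &
    forall j, crossS j (swd S (rev word)) (wcomp w^-1%g p.2.2) <= e 0 j.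
Proof.
rewrite {}/p; elim/last_ind: word c => [|word k IH] c.
  move=> _ /size0nil ->; have -> : Gm_product S [::] [::] = term_one S by [].
  rewrite kcoef_one; exists 0; first exact: has_val1.
  by move=> j; rewrite crossS1 mxE.
case/positive_word_rcons=> pw pk; case/lastP: c => [|c c0]; first by rewrite size_rcons.
rewrite !size_rcons => -[sc]; rewrite Gm_product_rcons // swd_rev_rcons kcoef_mul.
have [e he le] := IH c pw sc.
have h0 := hact_swd_rev word (asimple S k).
move: (hact (swd S word) _) h0 pk => [be kk] h0 /= pk.
move: (Gm_product S word c) he le => p he le.
set u := wcomp w^-1%g p.2.2.
have ue : (wcomp p.2.2^-1%g w)^-1%g = u by rewrite wcomp_inv invgK.
case: c0.
  exists (e + \row_j gexp be kk j u).
    apply: has_valM => //; apply: hv_conj; rewrite Gm_true /kcoef rmorphN mulNr.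
    by apply: has_valN; rewrite -ue; exact: (hv_gaff (wcomp p.2.2^-1%g w) (be, kk)).
  move=> j; have := le j; have := key_inequality h0 pk j u.
  rewrite Gm_true /= (wcompA w^-1%g) -/u wcomp_sr !(crossS_step h0).
  have -> : sgr (wroot (wcomp (sr (wroot u be)) u) be) = - sgr (wroot u be).
    rewrite wroot_comp wroot_sr refl_root_self /sgr positive_opp.
    by case: (positive _); rewrite ?opprK.
  rewrite rowDE [X in _ -> _ -> _ <= _ + X]mxE; lia.
exists (e + \row_j ((nu be == nu_val j)%:Z * sgr (wroot u be))).
  apply: has_valM => //; apply: hv_conj; rewrite Gm_false /kcoef /= wact0 qrho0 divr1.
  rewrite -ue -(t_half_opp be).
  have := hv_faff (wcomp p.2.2^-1%g w) (aopp (be, kk)).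
  congr (hv _ _); apply/rowP => j; rewrite !mxE /= nu_opp wroot_opp /sgr positive_opp.
  by case: (positive _) => /=; lia.
move=> j; have := le j; rewrite Gm_false /= (wcompA w^-1%g) -/u wcomp1 (crossS_step h0) rowDE [X in _ -> _ <= _ + X]mxE; lia.
Qed.

Section Reduced.
Variables (b : P n) (pi : What S) (word : seq 'I_n.+1).
Hypotheses (hb : dominant b) (hword : reduced_decomposition (htrans S b) pi word).
Let Tb : term S := of_What (htrans S b).
Let Tb' : term S := of_What (htrans S (- b)).
Let pw : positive_word word.
Proof. by move=> w1 w2 k; exact: (reduced_positive hb hword). Qed.
Let cross_final j u : crossS j (swd S (rev word)) u = rhop S (wact u b) 0 j.
Proof. exact/crossS_trans/(crossN_final hword). Qed.

Lemma expansion_orders w j c (p := Gp_product S word c) (p' := Gm_product S word c) :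
  size c = size word ->
  ordw w j Tb' <= ordw w j p /\ ordw (wcomp (p'.2.2)^-1%g w) j Tb <= ordw w j p'.
Proof.
move=> sc; have [e he le] := Gp_product_order w pw sc.
have [e' he' le'] := Gm_product_order w pw sc.
rewrite (ordw_hv j he) (ordw_hv j he') (ordw_hv j (kcoef_trans w (- b))).
rewrite (ordw_hv j (kcoef_trans (wcomp (p'.2.2)^-1%g w) b)).
rewrite !ler_pM2r // !ler_int wactN rhopN wcomp_inv invgK -!cross_final.
by rewrite mxE -cross_final; split; [exact: le|exact: le'].
Qed.

Lemma Gp_product_regular w c : size c = size word ->
  exists2 e, hv e (kcoef w (term_mul Tb (Gp_product S word c))) & nonneg e.
Proof.
move=> sc; rewrite kcoef_mul; have [e he le] := Gp_product_order (wcomp 1^-1%g w) pw sc.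
exists (rhop S (wact w^-1%g b) + e).
  by apply: has_valM; [exact: kcoef_trans|exact: hv_conj].
move=> j; have := le j; rewrite cross_final invg1 w1comp rowDE -lerBlDl sub0r; apply.
Qed.
Lemma Gm_product_regular w c : size c = size word ->
  exists2 e, hv e (kcoef w (term_mul (Gm_product S word c) Tb')) & nonneg e.
Proof.
move=> sc; rewrite kcoef_mul; have [e he le] := Gm_product_order w pw sc.
move: (Gm_product S word c) he le => p he le.
exists (e + rhop S (wact (wcomp p.2.2^-1%g w)^-1%g (- b))).
  by apply: has_valM => //; apply: hv_conj; exact: kcoef_trans.
move=> j; have := le j; rewrite cross_final wactN rhopN wcomp_inv invgK rowDE rowNE subr_ge0; apply.
Qed.
End Reduced.
End Products.

(** * Twisted products *)

(** The composition law of spinor operators, for an abstract index set [I] in place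
    of the affine Weyl group and [V] in place of W: the second factor is twisted
    by [G] and read at the component to which [mv] moves. *)
Section TwistedProduct.
Variables (K : fieldType) (I : choiceType) (V : Type) (m : I -> I -> I)
  (mv : I -> V -> V) (G : I -> {rmorphism K -> K}).
Implicit Types (L M : V -> malg I K) (v : V) (x y z : I) (g h : K) (f : V -> K).

Definition tinner x g y h : malg I K := mkmalgU (m x y) (g * G x h).
Definition touter M v x g : malg I K := lin (tinner x g) (M (mv x v)).
Definition tmul L M v : malg I K := lin (touter M v) (L v).

Let inner0 x g y : tinner x g y 0 = 0.
Proof. by rewrite /tinner rmorph0 mulr0 monalg.monalgU0. Qed.
Let innerD x g y h h' : tinner x g y (h + h') = tinner x g y h + tinner x g y h'.
Proof. by rewrite /tinner rmorphD mulrDr monalg.monalgUD. Qed.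
Let outer0 M v x : touter M v x 0 = 0.
Proof. by rewrite /touter /lin big1 // => y _; rewrite /tinner mul0r monalg.monalgU0. Qed.
Let outerD M v x g h : touter M v x (g + h) = touter M v x g + touter M v x h.
Proof.
rewrite /touter /lin -big_split; apply: eq_bigr => y _.
by rewrite /tinner mulrDl monalg.monalgUD.
Qed.

Lemma tmulDl L L' M v : tmul (fun v' => L v' + L' v') M v = tmul L M v + tmul L' M v.
Proof. exact: (linD (outer0 M v) (outerD M v)). Qed.
Lemma tmulDr L M M' v : tmul L (fun v' => M v' + M' v') v = tmul L M v + tmul L M' v.
Proof.
rewrite /tmul /lin -big_split; apply: eq_bigr => x _.
exact: (linD (inner0 x _) (innerD x _)).
Qed.
Lemma tmul0l L M v : L v = 0 -> tmul L M v = 0.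
Proof. by rewrite /tmul => ->; exact: (lin0 (outer0 M v) (outerD M v)). Qed.
Lemma tmul0r L M v : (forall v', M v' = 0) -> tmul L M v = 0.
Proof.
move=> h; rewrite /tmul /lin big1 // => x _; rewrite /touter h.
exact: (lin0 (inner0 x _) (innerD x _)).
Qed.
Lemma tmulU L M v x y g h : L v = mkmalgU x g -> M (mv x v) = mkmalgU y h ->
  tmul L M v = mkmalgU (m x y) (g * G x h).
Proof.
move=> e e'; rewrite /tmul e (linU (outer0 M v)) /touter e'.
exact: (linU (inner0 x g)).
Qed.
Lemma eq_tmul L L' M M' v : L =1 L' -> M =1 M' -> tmul L M v = tmul L' M' v.
Proof.
move=> e e'; rewrite /tmul e /lin; apply: eq_bigr => x _.
by rewrite /touter e'.
Qed.

(** The sums may run over any larger finite sets, which allows the supports of an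
    operator and of its limit to be enlarged to a common one. *)
Lemma tmul_coef L M v z (d : {fset I}) (d' : I -> {fset I}) :
  fsubset (monalg.msupp (L v)) d ->
  (forall x, fsubset (monalg.msupp (M (mv x v))) (d' x)) ->
  monalg.mcoeff z (tmul L M v) = \sum_(x <- d) \sum_(y <- d' x)
    (monalg.mcoeff x (L v) * G x (monalg.mcoeff y (M (mv x v)))) *+ (m x y == z).
Proof.
move=> le le'; rewrite /tmul (lin_le (outer0 M v) le).
rewrite [LHS](raddf_sum (monalg.mcoeff z)); apply: eq_bigr => x _.
rewrite /= /touter (lin_le (inner0 x _) (le' x)).
rewrite [LHS](raddf_sum (monalg.mcoeff z)); apply: eq_bigr => y _.
exact: monalg.mcoeffU.
Qed.

Definition tact L f v : K := lin (fun x g => g * G x (f (mv x v))) (L v).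

Hypothesis mvM : forall x y v, mv (m x y) v = mv y (mv x v).
Hypothesis GM : forall x y g, G (m x y) g = G x (G y g).

Let act0 f v x : 0 * G x (f (mv x v)) = 0.
Proof. exact: mul0r. Qed.
Let actD f v x g h : (g + h) * G x (f (mv x v)) = g * G x (f (mv x v)) + h * G x (f (mv x v)).
Proof. exact: mulrDl. Qed.

Lemma tact_mul L M f v : tact (tmul L M) f v = tact L (tact M f) v.
Proof.
rewrite /tact /tmul {1}/lin.
pose phi := lin (fun x g => g * G x (f (mv x v))).
have phiD : {morph phi : A B / A + B} := linD (act0 f v) (actD f v).
have phi0 : phi 0 = 0 := lin0 (act0 f v) (actD f v).
transitivity (phi (\sum_(x <- monalg.msupp (L v)) touter M v x (monalg.mcoeff x (L v)))); first by [].
rewrite (big_morph phi phiD phi0) [RHS]/lin; apply: eq_bigr => x _.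
rewrite /touter {1}/lin (big_morph phi phiD phi0) [in RHS]/lin rmorph_sum mulr_sumr.
apply: eq_bigr => y _; rewrite /tinner /phi (linU (act0 f v)).
by rewrite GM mvM rmorphM mulrA.
Qed.
End TwistedProduct.

Section Limits.
Variables (R : realType) (n : nat) (S : root_system R n).
Local Notation rootT := (seq_sub (roots S)).
Local Notation r := (size (nuR S)).
Local Notation E0 := (ratX n).
Local Notation E := (ratXt n r).
Implicit Types (a b : rootT) (w : W S) (i : 'I_n) (j : 'I_r) (g : E).

Implicit Types (s t : term S) (u v : P n) (word : seq 'I_n.+1) (c : seq bool).
Implicit Types (A C : refl_op S).
Local Notation hv := (@has_val E0 r).

(** * Limits of operators *)

Lemma limt_uniq g (y y' : E0) : limt g y -> limt g y' -> y = y'.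
Proof. exact: flim_uniq. Qed.
Lemma limt0 : limt (0 : E) (0 : E0).
Proof. exact: flim0. Qed.
Lemma limt1 : limt (1 : E) (1 : E0).
Proof. exact: flim1. Qed.
Lemma limtD g h (y z : E0) : limt g y -> limt h z -> limt (g + h) (y + z).
Proof. exact: flimD. Qed.
Lemma limtM g h (y z : E0) : limt g y -> limt h z -> limt (g * h) (y * z).
Proof. exact: flimM. Qed.
Lemma limt_conj u g (y : E0) : limt g y -> limt (conjXt (u, 1%g : W S) g) (GammaX S u y).
Proof.
apply: (@flim_coef E0 r (conjXt (u, 1%g : W S)) (GammaX S u)).
  exact: conjXt_const.
exact: conjXt_tau.
Qed.
Lemma limt_natb g (y : E0) (p : bool) : limt g y -> limt (g *+ p) (y *+ p).
Proof. by case: p => // _; exact: limt0. Qed.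

Lemma RE_uniq A (L L' : spinor_op S E0) : RE A L -> RE A L' -> L = L'.
Proof.
move=> h h'; apply/ffunP => w; apply/monalg.malgP => x.
exact: limt_uniq (h w x) (h' w x).
Qed.
Lemma RE_unique A (L : spinor_op S E0) : RE A L -> unique (RE A) L.
Proof. by move=> h; split=> // L'; apply: RE_uniq. Qed.

Definition has_RE A := exists L, RE A L.
Lemma has_RE_unique A : has_RE A -> exists! L, RE A L.
Proof. by case=> L h; exists L; apply: RE_unique. Qed.

Lemma has_RED A C : has_RE A -> has_RE C -> has_RE (A + C).
Proof.
case=> L h [M h']; exists [ffun w => L w + M w] => w x.
have -> : monalg.mcoeff x (kappa (A + C) w) = monalg.mcoeff x (kappa A w) + monalg.mcoeff x (kappa C w).
  exact: etrans (congr1 (monalg.mcoeff x) (kappaD w A C)) (monalg.mcoeffD x _ _).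
rewrite [X in limt _ (monalg.mcoeff _ X)]ffunE [X in limt _ X]monalg.mcoeffD.
exact: limtD (h w x) (h' w x).
Qed.

Lemma RE_op s : (forall w, exists2 e, hv e (kcoef w s) & nonneg e) -> has_RE (op s).
Proof.
move=> h; have lim w : exists y : E0, limt (kcoef w s) y.
  by have [e he e0] := h w; exact: has_val_lim e0 he.
have [y hy] := fin_all_exists lim.
exists [ffun w => mkmalgU (wact w^-1%g s.2.1, s.2.2) (y w)] => w x.
rewrite kappa_op ffunE !monalg.mcoeffU; exact/limt_natb/hy.
Qed.

(** For additive properties that hold for every product in the expansion of a
    product of sums. *)
Lemma expansion_ind (Rg : nzRingType) (I : Type) (F : bool -> I -> Rg) (Q : Rg -> Prop)
    (z z' : Rg) (l : seq I) :
  (forall a b : Rg, Q a -> Q b -> Q (a + b)) ->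
  (forall c, size c = size l -> Q (z * (\prod_(x <- zip c l) F x.1 x.2) * z')) ->
  Q (z * (\prod_(i <- l) (F false i + F true i)) * z').
Proof.
move=> QD; elim: l z => [|i l IH] z h; first by have := h [::] erefl; rewrite !big_nil.
rewrite big_cons mulrA mulrDr !mulrDl; apply: (QD); apply: IH => c sc.
  by have := h (false :: c) (congr1 succn sc); rewrite /= big_cons mulrA.
by have := h (true :: c) (congr1 succn sc); rewrite /= big_cons mulrA.
Qed.

Section Existence.
Variables (b : P n) (pi : What S) (word : seq 'I_n.+1).
Hypotheses (hb : dominant b) (hword : reduced_decomposition (htrans S b) pi word).
Let Tb : term S := of_What (htrans S b).
Let Tb' : term S := of_What (htrans S (- b)).

Lemma Gp_product_RE c : size c = size word -> has_RE (op (term_mul Tb (Gp_product S word c))).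
Proof. by move=> sc; apply: RE_op => w; exact: (Gp_product_regular hb hword w sc). Qed.
Lemma Gm_product_RE c : size c = size word -> has_RE (op (term_mul (Gm_product S word c) Tb')).
Proof. by move=> sc; apply: RE_op => w; exact: (Gm_product_regular hb hword w sc). Qed.

Let Q (z : op_ring S) := exists2 A, opr A = z & has_RE A.
Let QD (y z : op_ring S) : Q y -> Q z -> Q (y + z).
Proof.
case=> A <- hA [C <- hC]; exists (A + C); first exact: oprD.
exact: has_RED.
Qed.
Let Q_tmr s : has_RE (op s) -> Q (tmr s).
Proof. by move=> h; exists (op s); rewrite ?tmrE. Qed.
Let Q_opr A : Q (opr A) -> has_RE A.
Proof. by case=> C /(@opr_inj _ _ S) ->. Qed.

Lemma Y_RE : has_RE (Y pi word).
Proof.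
apply: Q_opr; rewrite (Y_fact (decompE hword)) -[_ * \prod_(_ <- _) _]mulr1.
rewrite (eq_bigr (fun ta => tmr (Gp_summand false ta) + tmr (Gp_summand true ta))); last first.
  by move=> ta _; apply: GpR_sum.
apply: (expansion_ind (F := fun p ta => tmr (Gp_summand p ta))) => // c sc.
rewrite size_rev size_alpha_seq in sc.
have := Q_tmr (@Gp_product_RE (rev c) _); rewrite size_rev => /(_ sc).
congr Q; rewrite -tmrM mulr1 tmr_prod -map_rev big_map; congr (_ * _).
by rewrite rev_zip ?size_rev ?size_alpha_seq // revK.
Qed.
Lemma Yinv_RE : has_RE (Yinv S b word).
Proof.
apply: Q_opr; rewrite YinvE -[\prod_(_ <- _) _]mul1r.
rewrite (eq_bigr (fun ta => tmr (Gm_summand false (aopp ta)) + tmr (Gm_summand true (aopp ta)))); last first.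
  by move=> ta _; apply: GmR_sum.
apply: (expansion_ind (F := fun p ta => tmr (Gm_summand p (aopp ta)))) => // c sc.
rewrite size_alpha_seq in sc.
have := Q_tmr (Gm_product_RE sc); congr Q.
by rewrite -tmrM mul1r tmr_prod big_map.
Qed.
End Existence.


(** * Products of spinor operators *)

Definition smove (x : What S) w : W S := wcomp x.2^-1%g w.
Definition smulx (x y : What S) : What S := (x.1 + y.1, wcomp x.2 y.2).
Definition sGammaE (x : What S) : {rmorphism E -> E} := conjXt (x.1, 1%g : W S).
Definition sGamma (x : What S) : {rmorphism E0 -> E0} := GammaX S x.1.
Local Notation smulE := (tmul smulx smove sGammaE).
Local Notation smul := (tmul smulx smove sGamma).
Implicit Types L M : spinor_op S E0.

Lemma op_mul0l C : op_mul 0 C = 0.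
Proof. by apply: (addrI (op_mul 0 C)); rewrite -op_mulDl !addr0. Qed.
Lemma op_mul0r A : op_mul A 0 = 0.
Proof. by apply: (addrI (op_mul A 0)); rewrite -op_mulDr !addr0. Qed.

Lemma kappa_mul_op s t w :
  kappa (op (term_mul s t)) w = smulE (kappa (op s)) (kappa (op t)) w.
Proof.
apply: etrans (kappa_op w (term_mul s t)) _; apply/esym.
have e2 := kappa_op (smove (wact w^-1%g s.2.1, s.2.2) w) t.
apply: etrans (tmulU smulx sGammaE (kappa_op w s) e2) _.
apply: congr2; last exact: esym (kcoef_mul w s t).
by rewrite /smulx /smove /= wcomp_inv invgK wactD wact_comp.
Qed.
(** By additivity it is enough to consider terms. *)
Lemma kappa_mul A C w : kappa (op_mul A C) w = smulE (kappa A) (kappa C) w.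
Proof.
move: A w; apply: refl_op_ind => [w|A A' h h' w|s].
- by rewrite op_mul0l (kappa0 w) tmul0l // (kappa0 w).
- apply: etrans (congr1 (fun B : refl_op S => kappa B w) (op_mulDl A A' C)) _.
  apply: etrans (kappaD w (op_mul A C) (op_mul A' C)) _.
  apply: etrans (congr2 +%R (h w) (h' w)) _.
  apply: etrans (esym (tmulDl smulx smove sGammaE (kappa A) (kappa A') (kappa C) w)) _.
  have e : (fun v : W S => kappa A v + kappa A' v) =1 kappa (A + A') := fun v : W S => esym (kappaD v A A').
  exact: (eq_tmul smulx smove sGammaE w e (fun _ => erefl)).
move: C; apply: refl_op_ind => [w|C C' h h' w|t w].
- by rewrite op_mul0r (kappa0 w) tmul0r // => w'; rewrite (kappa0 w').
- apply: etrans (congr1 (fun B : refl_op S => kappa B w) (op_mulDr (op s) C C')) _.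
  apply: etrans (kappaD w (op_mul (op s) C) (op_mul (op s) C')) _.
  apply: etrans (congr2 +%R (h w) (h' w)) _.
  apply: etrans (esym (tmulDr smulx smove sGammaE (kappa (op s)) (kappa C) (kappa C') w)) _.
  have e : (fun v : W S => kappa C v + kappa C' v) =1 kappa (C + C') := fun v : W S => esym (kappaD v C C').
  exact: (eq_tmul smulx smove sGammaE w (fun _ => erefl) e).
by rewrite op_mul_op kappa_mul_op.
Qed.

Lemma limt_sum (I : Type) (l : seq I) (F : I -> E) (H : I -> E0) :
  (forall k, limt (F k) (H k)) -> limt (\sum_(i <- l) F i) (\sum_(i <- l) H i).
Proof.
move=> h; elim: l => [|i l IH]; first by rewrite !big_nil; exact: limt0.
by rewrite !big_cons; apply: limtD.
Qed.

Lemma RE_mul A C L M : RE A L -> RE C M -> RE (op_mul A C) [ffun w => smul L M w].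
Proof.
move=> hA hC w z; rewrite kappa_mul ffunE.
pose d := fsetU (monalg.msupp (kappa A w)) (monalg.msupp (L w)).
pose d' x := fsetU (monalg.msupp (kappa C (smove x w))) (monalg.msupp (M (smove x w))).
rewrite (@tmul_coef _ _ _ _ _ _ (kappa A) (kappa C) w z d d') ?fsubsetUl //; last first.
  by move=> x; rewrite fsubsetUl.
rewrite (@tmul_coef _ _ _ _ _ _ L M w z d d') ?fsubsetUr //; last first.
  by move=> x; rewrite fsubsetUr.
apply: limt_sum => x; apply: limt_sum => y; apply: limt_natb.
exact: limtM (hA w x) (limt_conj x.1 (hC (smove x w) y)).
Qed.

Lemma RE_one : RE (op_one S) [ffun w => mkmalgU (hone S) 1].
Proof.
move=> w x; rewrite [X in limt _ (monalg.mcoeff _ X)]ffunE (kappa_op w (term_one S)) kcoef_one wact0 !monalg.mcoeffU.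
exact/limt_natb/limt1.
Qed.

Lemma GammaX_comp u v (y : E0) : GammaX S (u + v) y = GammaX S u (GammaX S v y).
Proof.
apply: (fmorph_inj (@constt n r)); rewrite /= -!conjXt_const -conjXt_comp /hmul /=.
by rewrite wact1 wcomp1.
Qed.
Lemma GammaX0 (y : E0) : GammaX S 0 y = y.
Proof. by apply: (fmorph_inj (@constt n r)); rewrite /= -conjXt_const conjXt1. Qed.

Lemma spinor_actE L (f : spinor S E0) w : spinor_act L f w = tact smove sGamma L f w.
Proof. by rewrite ffunE. Qed.

(** The product of the limits is a limit of the identity; by uniqueness it is the
    identity. *)
Lemma RE_cancel A C L M : op_mul A C = op_one S -> RE A L -> RE C M ->
  cancel (spinor_act M) (spinor_act L).
Proof.
move=> e hA hC f; apply/ffunP => w; rewrite spinor_actE.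
have e1 : [ffun w => smul L M w] = [ffun w => mkmalgU (hone S) 1].
  by apply: (@RE_uniq (op_one S)); [rewrite -e; exact: RE_mul|exact: RE_one].
have -> : tact smove sGamma L (spinor_act M f) w = tact smove sGamma L (tact smove sGamma M f) w.
  by rewrite /tact /lin; apply: eq_bigr => x _; rewrite spinor_actE.
rewrite -(@tact_mul _ _ _ smulx); last 2 first.
- by move=> x y v; rewrite /smove /= wcomp_inv wcompA.
- by move=> x y g; exact: GammaX_comp.
have e2 : smul L M w = mkmalgU (hone S) 1 by have := congr1 (fun F : spinor_op S E0 => F w) e1; rewrite !ffunE.
rewrite /tact e2 linU; last by move=> x; rewrite mul0r.
by rewrite mul1r /smove /= invg1 w1comp; exact: GammaX0.
Qed.
End Limits.

(** * The limits of the Y-operators *)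

Theorem corollary5p2 (R : realType) (n : nat) (Phi : root_system R n)
    (b : P n) (pi : What Phi) (word : seq 'I_n.+1)
    (hb : dominant b)
    (hword : reduced_decomposition (htrans Phi b) pi word) :
  let Tb : term Phi := of_What (htrans Phi b) in
  let Tb' : term Phi := of_What (htrans Phi (- b)) in
  let Yb : refl_op Phi := Y pi word in
  exists Yb' : refl_op Phi,
    (* Yb' is the inverse of Yb *)
    op_mul Yb Yb' = op_one Phi /\ op_mul Yb' Yb = op_one Phi /\
    op_mul (op Tb') Yb = op_prod (rev [seq Gp ta | ta <- alpha_seq Phi word]) /\
    op_mul Yb' (op Tb) = op_prod [seq Gm (aopp ta) | ta <- alpha_seq Phi word] /\
    (* orders of the products in the two expansions *)
    (forall (w : W Phi) (j : 'I_(size (nuR Phi))) (c : seq bool),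
       size c = size word ->
       let p := Gp_product Phi word c in
       let p' := Gm_product Phi word c in
       ordw w j Tb' <= ordw w j p /\
       ordw (wcomp (p'.2.2)^-1%g w) j Tb <= ordw w j p') /\
    (* the limit operators exist, are unique and mutually inverse *)
    (exists Yh Yh' : spinor_op Phi (ratX n),
       unique (RE Yb) Yh /\ unique (RE Yb') Yh' /\
       cancel (spinor_act Yh') (spinor_act Yh) /\
       cancel (spinor_act Yh) (spinor_act Yh')) /\
    (* limits of the individual products *)
    (forall c : seq bool, size c = size word ->
       (exists! L, RE (op (term_mul Tb (Gp_product Phi word c))) L) /\
       (exists! L, RE (op (term_mul (Gm_product Phi word c) Tb')) L)).
Proof.
move=> Tb Tb' Yb; exists (Yinv Phi b word).
have hd := decompE hword.
have YV := Y_Yinv hd; have VY := Yinv_Y hd.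
split; first exact: YV.
split; first exact: VY.
split; first exact: (Y_expansion hd).
split; first exact: Yinv_expansion.
split; first by move=> w j c sc; exact: (expansion_orders hb hword w j sc).
split.
  have [Yh hY] := Y_RE hb hword; have [Yh' hY'] := Yinv_RE hb hword.
  exists Yh, Yh'; split; first exact: RE_unique hY.
  split; first exact: RE_unique hY'.
  by split; [exact: RE_cancel YV hY hY'|exact: RE_cancel VY hY' hY].
move=> c sc; split; apply: has_RE_unique.
  exact: (Gp_product_RE hb hword sc).
exact: (Gm_product_RE hb hword sc).
Qed.
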